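(* Let $\gamma\in(1,2)$ and $\alpha=1-\gamma^{-1}$. Let $\tau$ be a recurrent renewal process with inter-arrival law $K$ satisfying $K(n)\sim C_K n^{-(1+\alpha)}$ as $n\to\infty$ for some $C_K>0$, and let $(\omega_n)_{n\ge 0}$ be i.i.d. with $\mathbb{E}[\omega_1]=0$, $\mathbb{P}[\omega_1\ge -a]=1$ for some $a\in(0,1)$, and $\mathbb{P}[\omega_1\ge x]\sim C_{\mathbb{P}}\,x^{-\gamma}$ as $x\to\infty$ for some $C_{\mathbb{P}}>0$. Then for every $\beta\in(0,1]$ one has $h_c(\beta)>0$, and furthermore there exists a constant $A>0$ such that $$\forall \beta\in(0,1],\qquad h_c(\beta)\ \ge\ \exp\left(-A\,\beta^{-2\gamma}\right).$$
   Context: The renewal process $\tau=(\tau_n)_{n\ge 0}$ has $\tau_0=0$ and i.i.d. increments $\tau_{n+1}-\tau_n$ that are (almost surely finite) positive integers; its law is $\mathbf{P}$ (expectation $\mathbf{E}$), and $K(n):=\mathbf{P}[\tau_1=n]$. We identify $\tau$ with the random subset $\{\tau_k: k\ge 0\}$ of the non-negative integers. The environment $\omega=(\omega_n)_{n\ge0}$ has law $\mathbb{P}$ (expectation $\mathbb{E}$). For $\beta\in[0,1]$, $h\in\mathbb{R}$, $N\in\mathbb{N}$, the partition function is $$Z^{\beta,\omega}_{N,h}:=\mathbf{E}\Big[\Big(\prod_{n\in[1,N]\cap\tau}e^{h}(\beta\omega_n+1)\Big)\mathbf{1}_{\{N\in\tau\}}\Big].$$ The free energy is $\textsc{f}(\beta,h):=\lim_{N\to\infty}\frac1N\log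 Z^{\beta,\omega}_{N,h}$, where the limit exists $\mathbb{P}$-a.s., is non-random, finite, non-negative, and equals $\lim_{N\to\infty}\frac1N\mathbb{E}[\log Z^{\beta,\omega}_{N,h}]$. It is non-decreasing and convex in $h$. The critical point is $h_c(\beta):=\inf\{h\in\mathbb{R}:\ \textsc{f}(\beta,h)>0\}$. *)

(* Defs.v *)
From HB Require Import structures.
From mathcomp Require Import all_boot all_order all_algebra.
From mathcomp Require Import all_classical all_reals all_analysis.

Set Implicit Arguments.
Unset Strict Implicit.
Unset Printing Implicit Defensive.
Import Order.TTheory GRing.Theory Num.Theory.
Import numFieldNormedType.Exports.

Local Open Scope classical_set_scope.
Local Open Scope ring_scope.

(* The asymptotic equivalence of landau.v requires a canonical filter structure,
   which the filter of neighbourhoods of +oo in R does not have. *)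
Definition asymp_equiv {R : realType} {I : Type} (F : set_system I) (f g : I -> R) : Prop :=
  f x / g x @[x --> F] --> (1 : R).

Section iid.
Context {d d' : measure_display} {T : measurableType d} {U : measurableType d'}.
Context {R : realType}.

Definition mutually_independent (P : probability T R) (X : nat -> T -> U) : Prop :=
  forall (s : seq nat) (B : nat -> set U), uniq s ->
    (forall i, measurable (B i)) ->
    P (\big[setI/setT]_(i <- s) (X i @^-1` B i)) =
    (\prod_(i <- s) P (X i @^-1` B i))%E.

Definition identically_distributed (P : probability T R) (X : nat -> T -> U) : Prop :=
  forall (i j : nat) (B : set U), measurable B ->
    P (X i @^-1` B) = P (X j @^-1` B).

Definition iid (P : probability T R) (X : nat -> T -> U) : Prop :=
  [/\ forall n, measurable_fun setT (X n),
      mutually_independent P X &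
      identically_distributed P X].

End iid.

Section renewal.
Context {d : measure_display} {T : measurableType d} {R : realType}.

(* Since tau takes values in nat, every inter-arrival time is finite, so
   renewal processes are recurrent by construction. *)
Definition is_renewal (Q : probability T R) (tau : nat -> T -> nat) : Prop :=
  [/\ forall t, tau 0%N t = 0%N,
      forall n t, (tau n t < tau n.+1 t)%N &
      iid Q (fun n t => (tau n.+1 t - tau n t)%N)].

Definition interarrival_law (Q : probability T R) (tau : nat -> T -> nat) (n : nat) : R :=
  fine (Q [set t | tau 1%N t = n]).

Definition renewal_set (tau : nat -> T -> nat) (t : T) : set nat :=
  range (tau ^~ t).

End renewal.

Section pinning.
Context {d d' : measure_display} {T : measurableType d} {W : measurableType d'}.
Context {R : realType}.
Variables (Q : probability T R) (tau : nat -> T -> nat).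
Variables (P : probability W R) (omega : nat -> W -> R).

(* The integrand is bounded for a fixed environment, so the expectation is
   finite and fine loses nothing. *)
Definition partition_function (beta h : R) (N : nat) (w : W) : R :=
  fine 'E_Q[fun t =>
    (\prod_(1 <= n < N.+1 | n \in renewal_set tau t)
        (expR h * (beta * omega n w + 1)))
    * \1_[set t' | renewal_set tau t' N] t].

(* The deterministic P-almost sure limit. It is unique, and it exists for i.i.d.
   environments by superadditivity, so the default value 0 is never used. *)
Definition free_energy (beta h : R) : R :=
  xget 0 [set f : R | {ae P, forall w,
    (fun N : nat => N%:R^-1 * ln (partition_function beta h N w)) @ \oo --> f}].

(* The infimum is taken in the extended reals because the real-valued inf is 0
   on empty or unbounded sets. *)
Definition critical_point (beta : R) : \bar R :=
  ereal_inf [set h%:E | h in [set h : R | 0 < free_energy beta h]].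

End pinning.

(* Main.v *)
(** Fractional moments with a change of measure by penalisation. With
    [h = exp (- A beta ^ (- 2 gamma))], cut the sites into blocks of length [l] of
    order [1 / h] and decompose a trajectory along a chain of visited blocks, each at
    distance at least two from the previous one; the piece issued from block [i] lives
    in the chunk made of blocks [i] and [i + 1], so that the pieces are independent and
    a long window is always available after the first point of each.
    A chunk is bad when it contains sites [i < j] with [omega_i >= A] and
    [omega_j >= u (j - i) ^ (1 / gamma)]. Under the original law this has probability at most
    [C (v u) ^ (- gamma) (1 + ln l)] with [A = v l ^ (1 / gamma)], so penalising bad
    chunks by a factor [eta] costs nothing in the weighted AM-GM inequality
    [Z ^ t <= t c ^ (t - 1) g Z + (1 - t) c ^ t g ^ (- t / (1 - t))]. Under the law tilted
    by the weights [1 + beta omega], heavy charges at the renewal points are so frequent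
    that a trajectory meets a bad pair with probability close to one as soon as
    [beta ^ (2 gamma) ln l] is large. This is proved without any
    renewal theorem: the weight of the trajectories avoiding bad pairs is dominated by
    explicit supersolutions, once before the first charge above [A] and once after it. *)

Require Import Defs.
From HB Require Import structures.
From mathcomp Require Import all_boot all_order all_algebra.
From mathcomp Require Import all_classical all_reals all_analysis.
From mathcomp Require Import measurable_realfun ring lra zify.

Set Implicit Arguments.
Unset Strict Implicit.
Unset Printing Implicit Defensive.
Import Order.TTheory GRing.Theory Num.Theory.
Import numFieldNormedType.Exports.

Local Open Scope classical_set_scope.
Local Open Scope ring_scope.

(** * Independence of functions of disjoint sets of sites *)

(** One heavy charge cannot serve as the bad event: with [A = v l ^ (1 / gamma)], rarity requires
    [v] large, while being met under the tilt requires [beta * v ^ (1 - gamma)] large. Hence pairs,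
    with [v ^ (gamma - 1)] of order [beta]. The second charge, at distance [r], exceeds
    [u * r ^ (1 / gamma)] with tilted probability at least of order
    [beta * u ^ (1 - gamma) * r ^ (- alpha)], because [(1 - gamma) / gamma = - alpha]. The renewal
    makes about [r ^ alpha] steps on scale [r], so this killing rate is critical: every dyadic scale
    offers the same chance, and survival up to [L] has probability about [L ^ (- ka)] with [ka] of
    order [beta * u ^ (1 - gamma)]. Rarity of bad pairs makes [v * u] of order
    [(ln l) ^ (1 / gamma)]. Hence [ka * ln L] is of order [beta ^ 2 * (ln l) ^ (1 - alpha)], which
    is [(beta ^ (2 * gamma) * ln l) ^ (1 / gamma)]; requiring it to exceed a constant gives the
    exponent [- 2 * gamma] of the theorem. *)

Lemma integral_prod {d d' : measure_display} {T : measurableType d}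
    {U : measurableType d'} {R : realType} (p : probability T R)
    (p' : probability U R) (f : T -> R) (g : U -> R) :
  measurable_fun setT f -> measurable_fun setT g ->
  (forall x, 0 <= f x) -> (forall x, 0 <= g x) ->
  measurable_fun setT (fun z : T * U => (f z.1 * g z.2)%:E : \bar R) /\
  (\int[p \x p']_z (f z.1 * g z.2)%:E =
   (\int[p]_x (f x)%:E) * (\int[p']_x (g x)%:E))%E.
Proof.
move=> mf mg f0 g0.
have mfg : measurable_fun setT (fun z : T * U => (f z.1 * g z.2)%:E : \bar R).
  apply/measurable_EFinP; apply: measurable_funM.
    exact: (measurableT_comp mf measurable_fst).
  exact: (measurableT_comp mg measurable_snd).
split=> //; rewrite fubini_tonelli1//=; last by move=> z; rewrite lee_fin mulr_ge0.
rewrite /fubini_F /= -ge0_integralZr//=; last 3 first.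
- exact/measurable_EFinP.
- by move=> x _; rewrite lee_fin.
- by apply: integral_ge0 => x _; rewrite lee_fin.
apply: eq_integral => x _; under eq_integral do rewrite EFinM.
by rewrite ge0_integralZl_EFin//; [move=> y _; rewrite lee_fin|exact/measurable_EFinP].
Qed.

Section independence.
Context {d d' : measure_display} {T : measurableType d} {U : measurableType d'}.
Context {R : realType} (P : probability T R) (X : nat -> T -> U).

Definition cylinder (A : set nat) : set (set T) :=
  [set S | exists s : seq nat, exists B : nat -> set U,
    [/\ uniq s, {in s, forall i, A i}, forall i, measurable (B i) &
        S = \big[setI/setT]_(i <- s) (X i @^-1` B i)]].

(** The sigma-algebra generated by the [X i] with [i] in [A], carried by a type of its own so that
    depending on these sites only is plain measurability on that type. *)
Definition sites (A : set nat) := g_sigma_algebraType (cylinder A).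

Lemma bigsetI_preimageE (s : seq nat) (B : nat -> set U) w :
  (\big[setI/setT]_(i <- s) (X i @^-1` B i)) w <->
  (forall i, i \in s -> B i (X i w)).
Proof.
elim: s => [|j s IH]; first by rewrite big_nil; split.
rewrite big_cons; split => [[Bj /IH H] i|H].
  by rewrite inE => /orP[/eqP->|/H].
split; first by apply: H; rewrite mem_head.
by apply/IH => i is_; apply: H; rewrite inE is_ orbT.
Qed.

Lemma cylinder_setI (A B : set nat) S S' : cylinder A S -> cylinder B S' ->
  cylinder (A `|` B) (S `&` S').
Proof.
move=> [s [C [us sA mC ->]]] [s' [C' [us' sB mC' ->]]].
exists (undup (s ++ s')), (fun i => (if i \in s then C i else setT) `&`
  (if i \in s' then C' i else setT)); split.
- exact: undup_uniq.
- move=> i; rewrite mem_undup mem_cat => /orP[/sA|/sB]; [by left|by right].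
- by move=> i; apply: measurableI; case: ifP.
- apply/seteqP; split => w.
    move=> [/bigsetI_preimageE H /bigsetI_preimageE H'].
    apply/bigsetI_preimageE => i _; split; case: ifP => //; [exact: H|exact: H'].
  move/bigsetI_preimageE => H; split; apply/bigsetI_preimageE => i si.
    by have := H i; rewrite mem_undup mem_cat si => /(_ isT)[].
  by have := H i; rewrite mem_undup mem_cat si orbT => /(_ isT)[].
Qed.

Lemma setI_closed_cylinder A : setI_closed (cylinder A).
Proof. by move=> S S' HS HS'; rewrite -[A]setUid; exact: cylinder_setI. Qed.

Lemma cylinder_setT A : cylinder A setT.
Proof. by exists [::], (fun=> setT); split => //; rewrite big_nil. Qed.

Hypothesis mX : forall n, measurable_fun setT (X n).
Hypothesis indX : mutually_independent P X.

Lemma cylinder_measurable A : cylinder A `<=` measurable.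
Proof.
move=> _ [s [B [_ _ mB ->]]].
elim: s => [|i s IH]; first by rewrite big_nil.
rewrite big_cons; apply: measurableI => //.
by rewrite -[X in measurable X]setTI; exact: mX.
Qed.

Lemma sites_measurable A : <<s cylinder A>> `<=` measurable.
Proof. exact: smallest_sub (@sigma_algebra_measurable _ T) (@cylinder_measurable A). Qed.

Lemma cylinder_indep (A B : set nat) S S' : (forall i, A i -> B i -> False) ->
  cylinder A S -> cylinder B S' -> P (S `&` S') = (P S * P S')%E.
Proof.
move=> AB [s [C [us sA mC ->]]] [s' [C' [us' sB mC' ->]]].
have disj i : i \in s -> i \in s' -> False by move=> /sA + /sB; exact: AB.
pose C2 i := if i \in s then C i else C' i.
have u2 : uniq (s ++ s').
  rewrite cat_uniq us us' andbT /=; apply/hasPn => i i' /=.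
  by apply/negP => /disj; exact.
have m2 i : measurable (C2 i) by rewrite /C2; case: ifP.
have e1 : \big[setI/setT]_(i <- s) (X i @^-1` C i) =
    \big[setI/setT]_(i <- s) (X i @^-1` C2 i).
  by apply: eq_big_seq => i is_; rewrite /C2 is_.
have e2 : \big[setI/setT]_(i <- s') (X i @^-1` C' i) =
    \big[setI/setT]_(i <- s') (X i @^-1` C2 i).
  apply: eq_big_seq => i is_; rewrite /C2; case: ifP => // h.
  by case: (disj _ h is_).
rewrite e1 e2 -big_cat /= (indX u2 m2) big_cat/=.
by rewrite (indX us m2) (indX us' m2).
Qed.

(** The pi-lambda argument, used twice. For a fixed [S], the restriction of [P] to [S] and [P]
    scaled by the mass of [S] agree on the pi-system of cylinders, hence on the sigma-algebra it
    generates; the roles of the two events are then exchanged. *)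
Lemma sites_indep (A B : set nat) S S' : (forall i, A i -> B i -> False) ->
  <<s cylinder A>> S -> <<s cylinder B>> S' -> P (S `&` S') = (P S * P S')%E.
Proof.
move=> AB AS BS'.
have step : forall (A B : set nat) S, measurable S -> 
    (forall S', cylinder B S' -> P (S `&` S') = (P S * P S')%E) ->
    forall S', <<s cylinder B>> S' -> P (S `&` S') = (P S * P S')%E.
  move=> A0 B0 S0 mS0 H S'0 BS'0.
  have c0 : (0 <= fine (P S0)) by apply: fine_ge0.
  pose m1 : {measure set T -> \bar R} := mrestr P mS0.
  pose m2 : {measure set T -> \bar R} := mscale (NngNum c0) P.
  have := @g_sigma_algebra_measure_unique _ _ _ (cylinder B0)
    (@cylinder_measurable B0) (fun=> setT) (fun=> @cylinder_setT B0) _ m1 m2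
    (@setI_closed_cylinder B0).
  have cov : \bigcup_(k : nat) [set: T] = setT.
    by apply/seteqP; split => // x _; exists 0%N.
  move=> /(_ cov).
  have h1 : forall A, cylinder B0 A -> m1 A = m2 A.
    move=> C BC; rewrite /m1 /m2 /= /mrestr /mscale /= fineK ?fin_num_measure//.
    by rewrite setIC H.
  move=> /(_ h1).
  have h2 : forall n : nat, (m1 setT < +oo)%E.
    by move=> n; rewrite /m1 /= /mrestr setTI; rewrite ltey_eq fin_num_measure.
  move=> /(_ h2) /(_ _ BS'0).
  by rewrite /m1 /m2 /= /mrestr /mscale /= fineK ?fin_num_measure// setIC.
have mS' : measurable S' by exact: sites_measurable BS'.
have mS : measurable S by exact: sites_measurable AS.
apply: (step setT B) => // S2 cS2.
have mS2 := cylinder_measurable cS2.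
rewrite setIC muleC; apply: (step setT A) => // S1 cS1.
by rewrite setIC muleC; exact: cylinder_indep AB cS1 cS2.
Qed.

Definition locfun (A : set nat) (F : T -> R) : Prop :=
  measurable_fun [set: sites A] (F : sites A -> R).

Lemma locfun_measurable A F : locfun A F -> measurable_fun [set: T] F.
Proof.
move=> mF _ B mB; apply: (@sites_measurable A).
exact: (mF measurableT B mB).
Qed.

Lemma locfun_site (A : set nat) n (f : U -> R) : A n -> measurable_fun setT f ->
  locfun A (f \o X n).
Proof.
move=> An mf _ B mB; apply: sub_sigma_algebra.
exists [:: n], (fun=> f @^-1` B); split => //.
- by move=> i; rewrite inE => /eqP ->.
- by move=> _; rewrite -[X in measurable X]setTI; exact: mf.
- by rewrite big_seq1 setTI.
Qed.

Lemma locfun_sub (A B : set nat) F : A `<=` B -> locfun A F -> locfun B F.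
Proof.
move=> AB mF _ S mS; have := mF measurableT S mS.
rewrite /measurable/=; apply: sub_sigma_algebra2.
move=> _ [s [C [us sA mC ->]]]; exists s, C; split => // i /sA; exact: AB.
Qed.

(** The joint law of [F] and [G] is the product of their laws on rectangles, hence everywhere, and
    Tonelli splits the integral. *)
Lemma locfun_indep (A B : set nat) F G : (forall i, A i -> B i -> False) ->
  locfun A F -> locfun B G -> (forall w, 0 <= F w) -> (forall w, 0 <= G w) ->
  (\int[P]_w (F w * G w)%:E = (\int[P]_w (F w)%:E) * (\int[P]_w (G w)%:E))%E.
Proof.
move=> AB sF sG F0 G0.
have mF := locfun_measurable sF; have mG := locfun_measurable sG.
pose FG w := (F w, G w).
have mFG : measurable_fun setT FG by apply/measurable_fun_pairP.
pose mF' : {mfun T >-> R} := HB.pack F (isMeasurableFun.Build _ _ _ _ _ mF).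
pose mG' : {mfun T >-> R} := HB.pack G (isMeasurableFun.Build _ _ _ _ _ mG).
pose p1 := distribution P mF'. pose p2 := distribution P mG'.
pose FG' : {mfun T >-> (R * R)%type} :=
  HB.pack FG (isMeasurableFun.Build _ _ _ _ _ mFG).
pose m' : {measure set (R * R) -> \bar R} := distribution P FG'.
have ind (C D : set R) : measurable C -> measurable D -> m' (C `*` D) = (p1 C * p2 D)%E.
  move=> mC mD; apply: (@sites_indep A B (F @^-1` C) (G @^-1` D) AB).
  - by rewrite -[F @^-1` C]setTI; exact: sF measurableT C mC.
  - by rewrite -[G @^-1` D]setTI; exact: sG measurableT D mD.
have E C : measurable C -> (p1 \x p2)%E C = m' C.
  exact: product_measure_unique.
(* Absolute values make the integrand nonnegative on the whole plane; they change nothing along [F]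
   and [G]. *)
have mn : measurable_fun setT (fun x : R => `|x| : R) by exact: normr_measurable.
have mne : measurable_fun setT (fun x : R => `|x|%:E : \bar R) by apply/measurable_EFinP.
have [mf pf] := integral_prod p1 p2 mn mn (fun=> normr_ge0 _) (fun=> normr_ge0 _).
have -> : (\int[P]_w (F w)%:E = \int[p1]_x (`|x|)%:E)%E.
  rewrite (@ge0_integral_distribution _ _ _ _ _ P mF' _ mne)//=.
  by apply: eq_integral => w _; rewrite /= ger0_norm.
have -> : (\int[P]_w (G w)%:E = \int[p2]_x (`|x|)%:E)%E.
  rewrite (@ge0_integral_distribution _ _ _ _ _ P mG' _ mne)//=.
  by apply: eq_integral => w _; rewrite /= ger0_norm.
rewrite -pf; transitivity (\int[m']_z (`|z.1| * `|z.2|)%:E)%E.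
  rewrite (@ge0_integral_distribution _ _ _ _ _ P FG' _ mf)//=.
  by apply: eq_integral => w _; rewrite /= !ger0_norm.
by apply: eq_measure_integral => C mC _; rewrite -E.
Qed.

Lemma locfunD A F G : locfun A F -> locfun A G -> locfun A (fun w => F w + G w).
Proof. by move=> mF mG; exact: measurable_funD. Qed.

Lemma locfunM A F G : locfun A F -> locfun A G -> locfun A (fun w => F w * G w).
Proof. by move=> mF mG; exact: measurable_funM. Qed.

Lemma locfun_cst A (c : R) : locfun A (fun=> c).
Proof. exact: measurable_cst. Qed.

Definition Ex (F : T -> R) : R := \int[P]_w F w.

(** [Ex] is real-valued and sends an infinite integral to zero, so integrability has to travel with
    locality and sign for the linearity and product rules to hold. *)
Definition admissible (A : set nat) (F : T -> R) : Prop :=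
  [/\ locfun A F, forall w, 0 <= F w & P.-integrable setT (EFin \o F)].

Lemma admissible_sub (A B : set nat) F : A `<=` B -> admissible A F ->
  admissible B F.
Proof. by move=> AB [sF F0 iF]; split => //; exact: locfun_sub sF. Qed.

Lemma admissibleD A F G : admissible A F -> admissible A G ->
  admissible A (fun w => F w + G w).
Proof.
move=> [sF F0 iF] [sG G0 iG]; split; first exact: locfunD.
  by move=> w; exact: addr_ge0.
exact: (integrableD _ iF iG).
Qed.

Lemma admissible_dom A F G : locfun A G -> (forall w, 0 <= G w <= F w) ->
  P.-integrable setT (EFin \o F) -> admissible A G.
Proof.
move=> sG GF iF; split => //; first by move=> w; case/andP: (GF w).
apply: le_integrable iF => //; first exact/measurable_EFinP/(locfun_measurable sG).
move=> w _ /=; rewrite lee_fin; case/andP: (GF w) => G0 GFw.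
by rewrite !ger0_norm// (le_trans G0).
Qed.

Lemma admissible_cst A c : 0 <= c -> admissible A (fun=> c).
Proof.
move=> c0; split => //; first exact: locfun_cst.
exact: (finite_measure_integrable_cst P c measurableT).
Qed.

Lemma admissibleZ A F c : 0 <= c -> admissible A F ->
  admissible A (fun w => c * F w).
Proof.
move=> c0 [sF F0 iF]; split; first exact: locfunM (@locfun_cst A c) sF.
  by move=> w; exact: mulr_ge0.
exact: (integrableZl measurableT c iF).
Qed.

Lemma admissible_bdd A F G c : admissible A F -> locfun A G ->
  (forall w, 0 <= G w <= c) -> admissible A (fun w => G w * F w).
Proof.
move=> [sF F0 iF] sG Gc.
apply: (@admissible_dom _ (fun w => c * F w)); first exact: locfunM.
  move=> w; case/andP: (Gc w) => G0 Gcw.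
  by rewrite mulr_ge0//= ler_wpM2r.
exact: (integrableZl measurableT c iF).
Qed.

Lemma admissible_sum A (I : Type) (s : seq I) (p : pred I) (F : I -> T -> R) :
  (forall i, p i -> admissible A (F i)) ->
  admissible A (fun w => \sum_(i <- s | p i) F i w).
Proof.
move=> aF; elim: s => [|i s IH].
  rewrite [X in admissible _ X](_ : _ = fun=> 0); first exact: admissible_cst.
  by apply/funext => w; rewrite big_nil.
rewrite [X in admissible _ X](_ : _ = fun w => if p i then F i w +
  \sum_(j <- s | p j) F j w else \sum_(j <- s | p j) F j w); last first.
  by apply/funext => w; exact: big_cons.
by case pi: (p i) => //; apply: admissibleD IH; exact: aF.
Qed.

(** Integrability of the product comes from independence alone; no second moment is asked for. *)
Lemma admissibleM (A B C : set nat) F G : (forall i, A i -> B i -> False) ->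
  A `<=` C -> B `<=` C -> admissible A F -> admissible B G ->
  admissible C (fun w => F w * G w).
Proof.
move=> AB AC BC [sF F0 iF] [sG G0 iG].
have sFG : locfun C (fun w => F w * G w).
  by apply: locfunM; [exact: locfun_sub sF|exact: locfun_sub sG].
split => //; first by move=> w; exact: mulr_ge0.
apply/integrableP; split; first exact/measurable_EFinP/(locfun_measurable sFG).
under eq_integral do rewrite /= ger0_norm ?mulr_ge0//.
rewrite (locfun_indep AB sF sG F0 G0) lte_mul_pinfty//.
- by apply: integral_ge0 => w _; rewrite lee_fin.
- exact: (integrable_fin_num measurableT iF).
- have := integrable_fin_num measurableT iG.
  by rewrite fin_numElt => /andP[].
Qed.

Lemma ExM (A B : set nat) F G : (forall i, A i -> B i -> False) ->
  admissible A F -> admissible B G -> Ex (fun w => F w * G w) = Ex F * Ex G.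
Proof.
move=> AB [sF F0 iF] [sG G0 iG]; rewrite /Ex /Rintegral.
rewrite (locfun_indep AB sF sG F0 G0) fineM//.
  exact: (integrable_fin_num measurableT iF).
exact: (integrable_fin_num measurableT iG).
Qed.

Lemma ExD A F G : admissible A F -> admissible A G ->
  Ex (fun w => F w + G w) = Ex F + Ex G.
Proof. by move=> [_ _ iF] [_ _ iG]; rewrite /Ex RintegralD. Qed.

Lemma ExZ A F c : admissible A F -> Ex (fun w => c * F w) = c * Ex F.
Proof. by move=> [_ _ iF]; rewrite /Ex RintegralZl. Qed.

Lemma Ex_cst c : Ex (fun=> c) = c.
Proof.
rewrite /Ex Rintegral_cst//.
by have /= -> := @probability_setT _ _ _ P; rewrite mulr1.
Qed.

Lemma Ex_ge0 F : (forall w, 0 <= F w) -> 0 <= Ex F.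
Proof. by move=> F0; exact: Rintegral_ge0. Qed.

Lemma le_Ex A F G : admissible A F -> admissible A G ->
  (forall w, F w <= G w) -> Ex F <= Ex G.
Proof. by move=> [_ _ iF] [_ _ iG] FG; exact: le_Rintegral. Qed.

Lemma Ex_sum A (I : Type) (s : seq I) (p : pred I) (F : I -> T -> R) :
  (forall i, p i -> admissible A (F i)) ->
  Ex (fun w => \sum_(i <- s | p i) F i w) = \sum_(i <- s | p i) Ex (F i).
Proof.
move=> aF; elim: s => [|i s IH].
  rewrite [X in Ex X](_ : _ = fun=> 0) ?Ex_cst ?big_nil//.
  by apply/funext => w; rewrite big_nil.
rewrite [X in Ex X](_ : _ = fun w => if p i then F i w +
  \sum_(j <- s | p j) F j w else \sum_(j <- s | p j) F j w); last first.
  by apply/funext => w; exact: big_cons.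
rewrite big_cons; case pi: (p i) => //.
by rewrite (@ExD A) ?IH//; [exact: aF|exact: admissible_sum].
Qed.

End independence.

(** * Inequalities for powers *)

Section powers.
Context {R : realType}.
Implicit Types a b x y t : R.

(** Young's inequality with conjugate exponents [1 / t] and [1 / (1 - t)]. *)
Lemma powR_amgm a b t : 0 <= a -> 0 <= b -> 0 < t < 1 ->
  a `^ t * b `^ (1 - t) <= t * a + (1 - t) * b.
Proof.
move=> a0 b0 /andP[t0 t1]; have s0 : 0 < 1 - t by lra.
have ht : 0 < t^-1 by rewrite invr_gt0.
have hs : 0 < (1 - t)^-1 by rewrite invr_gt0.
have := @conjugate_powR _ (a `^ t) (b `^ (1 - t)) t^-1 (1 - t)^-1
  (powR_ge0 _ _) (powR_ge0 _ _) ht hs.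
rewrite !invrK => /(_ (subrKC _ _)).
rewrite -!powRrM !mulfV ?gt_eqF// !powRr1//.
by rewrite [a * t]mulrC [b * _]mulrC.
Qed.

Lemma powR_bernoulli x t : 0 <= x -> 0 < t < 1 -> x `^ t <= 1 + t * (x - 1).
Proof.
move=> x0 t01; have := powR_amgm x0 ler01 t01.
by rewrite powR1 mulr1; lra.
Qed.

Lemma powR_succ_le (n : nat) (t : R) : (0 < n)%N -> 0 < t < 1 ->
  n.+1%:R `^ t - n%:R `^ t <= t * n%:R `^ (t - 1).
Proof.
move=> n0 t01; have n0' : (0 : R) < n%:R by rewrite ltr0n.
have nn0 : (n%:R : R) != 0 by rewrite gt_eqF.
have -> : n.+1%:R = n%:R * (n.+1%:R / n%:R) :> R by rewrite mulrC divfK.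
rewrite powRM ?ler0n ?divr_ge0// powRB ?nn0 ?implybT// powRr1 ?ler0n//.
have /(@powR_bernoulli _ t) : (0 : R) <= n.+1%:R / n%:R by rewrite divr_ge0.
have e : n.+1%:R / n%:R - 1 = n%:R^-1 :> R by rewrite -natr1; field.
move=> /(_ t01); rewrite e => h.
have := ler_wpM2l (powR_ge0 n%:R t) h; lra.
Qed.

Lemma powR_pred_le (n : nat) (t : R) : 0 < t < 1 ->
  n%:R `^ t + t * n.+1%:R `^ (t - 1) <= n.+1%:R `^ t.
Proof.
move=> t01; have n0' : (0 : R) < n.+1%:R by rewrite ltr0n.
have nn0 : (n.+1%:R : R) != 0 by rewrite gt_eqF.
have {1}-> : n%:R = n.+1%:R * (n%:R / n.+1%:R) :> R by rewrite mulrC divfK.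
rewrite powRM ?ler0n ?divr_ge0// powRB ?nn0 ?implybT// powRr1 ?ler0n//.
have /(@powR_bernoulli _ t) : (0 : R) <= n%:R / n.+1%:R by rewrite divr_ge0.
have e : n%:R / n.+1%:R - 1 = - n.+1%:R^-1 :> R.
  by rewrite -[n.+1%:R]natr1; field; rewrite natr1.
move=> /(_ t01); rewrite e => h.
move: h; set x := _ `^ t; set y := _ `^ t; set z := _^-1 => h.
have y0 : 0 <= y by exact: powR_ge0.
have := ler_wpM2l y0 h; lra.
Qed.

Lemma powR_inv x t : 0 <= x -> x^-1 `^ t = (x `^ t)^-1.
Proof. by move=> x0; rewrite -powR_inv1// -powRrM mulN1r powRN. Qed.

Lemma sum_powRN (n : nat) (t : R) : 0 < t < 1 ->
  \sum_(j < n) j.+1%:R `^ (t - 1) <= n%:R `^ t / t.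
Proof.
move=> t01; have t0 : 0 < t by case/andP: t01.
elim: n => [|n IH]; first by rewrite big_ord0 divr_ge0// ?powR_ge0// ltW.
rewrite big_ord_recr /= ler_pdivlMr// mulrDl.
have := powR_pred_le n t01; move: IH; rewrite ler_pdivlMr// => IH.
by rewrite [_ * t]mulrC in IH *; lra.
Qed.

Lemma powRN_pred_le (n : nat) (t : R) : (0 < n)%N -> 0 < t < 1 ->
  n.+1%:R `^ (- t) + t * n.+1%:R `^ (- (1 + t)) <= n%:R `^ (- t).
Proof.
move=> n0 t01; have n0' : (0 : R) < n%:R by rewrite ltr0n.
have n1' : (0 : R) < n.+1%:R by rewrite ltr0n.
have nn1 : (n.+1%:R : R) != 0 by rewrite gt_eqF.
have := powR_pred_le n t01.
set u := n%:R `^ t; set v := n.+1%:R `^ t.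
have u0 : 0 < u by exact: powR_gt0.
have v0 : 0 < v by exact: powR_gt0.
rewrite opprD !powRN -/u -/v powRB ?nn1 ?implybT// powRD ?nn1 ?implybT//.
rewrite !powRN -/u -/v powRr1 ?ler0n//.
set w := n.+1%:R; have w0 : 0 < w by [].
move=> h.
have h1 : v^-1 + t * (w^-1 * v^-1) = (v + t * (v / w)) / (v * v).
  by field; rewrite !gt_eqF.
rewrite h1 ler_pdivrMr ?mulr_gt0// [u^-1 * _]mulrC ler_pdivlMr//.
have p0 : 0 <= t * (v / w) by case/andP: t01 => t0 _; rewrite mulr_ge0// ?divr_ge0// ltW.
move: p0 h; set p := t * (v / w) => p0 h.
have h2 : u <= v - p by lra.
have h3 : 0 <= v + p by lra.
by apply: (le_trans (ler_wpM2l h3 h2)); nra.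
Qed.

Lemma sum_powRN_tail (m n : nat) (t : R) : (0 < m)%N -> 0 < t < 1 ->
  \sum_(m <= j < m + n) j.+1%:R `^ (- (1 + t)) <= m%:R `^ (- t) / t.
Proof.
move=> m0 t01; have t0 : 0 < t by case/andP: t01.
suff : \sum_(m <= j < m + n) j.+1%:R `^ (- (1 + t)) <=
    (m%:R `^ (- t) - (m + n)%:R `^ (- t)) / t.
  move/le_trans; apply; rewrite ler_pM2r ?invr_gt0// lerBlDr lerDl.
  exact: powR_ge0.
elim: n => [|n IH]; first by rewrite addn0 big_geq// subrr mul0r.
rewrite addnS big_nat_recr ?leq_addr//= ler_pdivlMr// mulrDl.
have := @powRN_pred_le (m + n) t; rewrite ltn_addr// => /(_ isT t01).
by move: IH; rewrite ler_pdivlMr//; set A := _ * t; lra.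
Qed.

(** Split at [j = m]. Below, [(m + j) ^ (ka - 1) <= m ^ (ka - 1)] and the other factor sums to
    [m ^ (1 - al) / (1 - al)]. Above, [m + j >= j + 1] leaves a tail of exponent [- (1 + al - ka)],
    and [ka <= al / 2] bounds its constant by [2 / al]. *)
Lemma sum_powR_conv (m J : nat) (al ka : R) : (0 < m)%N -> 0 < al < 1 ->
  0 < ka <= al / 2 ->
  \sum_(j < J) j.+1%:R `^ (- al) * (m + j)%:R `^ (ka - 1) <=
  (1 / (1 - al) + 2 / al) * m%:R `^ (ka - al).
Proof.
move=> m0 /andP[al0 al1] /andP[ka0 kaal].
pose f j : R := j.+1%:R `^ (- al) * (m + j)%:R `^ (ka - 1).
have f0 j : 0 <= f j by rewrite mulr_ge0// powR_ge0.
have m0' : (0 : R) < m%:R by rewrite ltr0n.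
rewrite -(big_mkord xpredT f).
have le1 : \sum_(0 <= j < J) f j <= \sum_(0 <= j < m + J) f j.
  rewrite [leRHS](big_cat_nat (leq0n J) (leq_addl m J))/= lerDl.
  exact: sumr_ge0.
apply: (le_trans le1).
rewrite (big_cat_nat (leq0n m) (leq_addr J m))/= mulrDl; apply: lerD.
  have : \sum_(0 <= j < m) f j <= m%:R `^ (ka - 1) *
      \sum_(j < m) j.+1%:R `^ ((1 - al) - 1).
    rewrite mulr_sumr big_mkord; apply: ler_sum => j _.
    rewrite /f mulrC (_ : 1 - al - 1 = - al); last by ring.
    rewrite ler_wpM2r ?powR_ge0//.
    rewrite -[ka - 1]opprB !powRN lef_pV2 ?posrE ?powR_gt0 ?ltr0n ?ltn_addr//.
    by apply: ge0_ler_powR; rewrite ?nnegrE ?ler0n ?ler_nat ?leq_addr//; lra.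
  move/le_trans; apply.
  have al1' : 0 < 1 - al < 1 by lra.
  have h := sum_powRN m al1'.
  apply: (le_trans (ler_wpM2l (powR_ge0 _ _) h)).
  rewrite mulrA -powRD; last by rewrite (gt_eqF m0') implybT.
  by rewrite (_ : ka - 1 + (1 - al) = ka - al) 1?mulrC ?mul1r//; ring.
have p01 : 0 < al - ka < 1 by lra.
have : \sum_(m <= j < m + J) f j <=
    \sum_(m <= j < m + J) j.+1%:R `^ (- (1 + (al - ka))).
  apply: ler_sum => j _; rewrite /f.
  have -> : - (1 + (al - ka)) = - al + (ka - 1) by ring.
  rewrite [X in _ <= X]powRD ?pnatr_eq0 ?implybT//.
  rewrite ler_wpM2l ?powR_ge0//.
  rewrite -[ka - 1]opprB !powRN lef_pV2 ?posrE ?powR_gt0 ?ltr0n ?ltn_addr//.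
  apply: ge0_ler_powR; rewrite ?nnegrE ?ler0n ?ler_nat//; first lra.
  by rewrite -add1n leq_add2r.
move/le_trans; apply; apply: (le_trans (sum_powRN_tail J m0 p01)).
rewrite opprB mulrC ler_wpM2r ?powR_ge0//.
rewrite -[2 / al]invf_div lef_pV2 ?posrE ?divr_gt0//; lra.
Qed.

End powers.

(** * Supersolutions for the killed renewal *)

Section escape.
Context {R : realType} (K : nat -> R) (al c2 : R).
Hypotheses (K_0 : K 0%N = 0) (K_ge0 : forall n, 0 <= K n).

Definition tail (n : nat) : R := 1 - \sum_(k < n) K k.

Lemma tailS n : tail n = K n + tail n.+1.
Proof. by rewrite /tail big_ord_recr /= opprD; ring. Qed.

Lemma tail_le m n : (m <= n)%N -> tail n <= tail m.
Proof.
move/subnKC <-; elim: (n - m)%N => [|k IH]; first by rewrite addn0.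
by rewrite addnS (le_trans _ IH)// [leRHS]tailS lerDr.
Qed.

(** Summation by parts: it expresses the drift of a function along the renewal through its
    increments, weighted by [tail]. *)
Lemma tail_abel (f : nat -> R) n : f 0%N = 0 ->
  \sum_(j < n.+1) K j * f j + tail n.+1 * f n =
  \sum_(j < n) tail j.+1 * (f j.+1 - f j).
Proof.
move=> f0; elim: n => [|n IH].
  by rewrite big_ord_recr !big_ord0 /= f0; ring.
rewrite big_ord_recr [RHS]big_ord_recr /= -IH.
by rewrite [in RHS](tailS n.+1); ring.
Qed.

Hypotheses (al01 : 0 < al < 1) (tail_ge0 : forall n, 0 <= tail n).
Hypothesis (tail_up : forall n, (0 < n)%N -> tail n <= c2 * n%:R `^ (- al)).

(** Dominates the probability that a renewal killed at a rate of order [ka * (n + n0) ^ (- al)] gets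
    from [n] to [L] alive. The shift [n0] is later proportional to [L] where the killing rate is
    constant, and equal to 1 where it decays with the distance. *)
Definition barrier (n0 L : nat) (ka : R) (n : nat) : R :=
  Num.min 1 (((n + n0)%:R / (L + n0)%:R) `^ ka).

(** The constant of [sum_powR_conv] times that of the tail, doubled because killing is only known on
    steps of length at most [j0], which carry half of the mass of [K]. *)
Definition escape_cst : R := 2 * c2 * (1 / (1 - al) + 2 / al).

Lemma barrier_ge0 n0 L ka n : 0 <= barrier n0 L ka n.
Proof. by rewrite /barrier le_min ler01 powR_ge0. Qed.

Lemma barrier_eq1 n0 L ka n : (0 < n0)%N -> 0 <= ka -> (L <= n)%N ->
  barrier n0 L ka n = 1.
Proof.
move=> n00 ka0 Ln; apply/min_idPl; have p1 : 1 `^ ka = 1 :> R by rewrite powR1.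
rewrite -[leLHS]p1.
have D0 : (0 : R) < (L + n0)%:R by rewrite ltr0n addn_gt0 n00 orbT.
apply: ge0_ler_powR => //; rewrite ?nnegrE ?divr_ge0 ?ler0n//.
by rewrite ler_pdivlMr// mul1r ler_nat leq_add2r.
Qed.

Lemma barrier_small n0 L ka n : (0 < n0)%N -> 0 <= ka -> (n <= L)%N ->
  barrier n0 L ka n = ((n + n0)%:R / (L + n0)%:R) `^ ka.
Proof.
move=> n00 ka0 Ln; apply/min_idPr; have p1 : 1 `^ ka = 1 :> R by rewrite powR1.
rewrite -[leRHS]p1.
have D0 : (0 : R) < (L + n0)%:R by rewrite ltr0n addn_gt0 n00 orbT.
apply: ge0_ler_powR => //; rewrite ?nnegrE ?divr_ge0 ?ler0n//.
by rewrite ler_pdivrMr// mul1r ler_nat leq_add2r.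
Qed.

Lemma barrier_nd n0 L ka m n : 0 <= ka -> (m <= n)%N ->
  barrier n0 L ka m <= barrier n0 L ka n.
Proof.
move=> ka0 mn; rewrite /barrier; apply: le_min2 => //.
apply: ge0_ler_powR => //; rewrite ?nnegrE ?divr_ge0 ?ler0n//.
by rewrite ler_wpM2r ?invr_ge0 ?ler0n// ler_nat leq_add2r.
Qed.

Lemma barrier_step n0 L ka n : (0 < n0)%N -> 0 < ka < 1 ->
  barrier n0 L ka n.+1 - barrier n0 L ka n <=
  ka * (n + n0)%:R `^ (ka - 1) / (L + n0)%:R `^ ka.
Proof.
move=> n00 ka01; have [ka0 ka1] : 0 < ka /\ ka < 1 by case/andP: ka01.
have D0 : (0 : R) < (L + n0)%:R `^ ka.
  by apply: powR_gt0; rewrite ltr0n addn_gt0 n00 orbT.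
have h : ((n.+1 + n0)%:R / (L + n0)%:R) `^ ka - ((n + n0)%:R / (L + n0)%:R) `^ ka
    <= ka * (n + n0)%:R `^ (ka - 1) / (L + n0)%:R `^ ka.
  rewrite !powRM ?invr_ge0 ?ler0n// powR_inv ?ler0n// -mulrBl.
  rewrite ler_pM2r ?invr_gt0//.
  by rewrite addSn powR_succ_le// addn_gt0 n00 orbT.
have p0 : 0 <= ka * (n + n0)%:R `^ (ka - 1) / (L + n0)%:R `^ ka.
  by rewrite divr_ge0 ?mulr_ge0 ?powR_ge0// ltW.
move: h; rewrite /barrier; set a := _ `^ ka; set b := _ `^ ka => h.
by rewrite /Num.min; case: ifP => ?; case: ifP => ?; lra.
Qed.

(* Killing at rate [escape_cst * ka * (n + n0) ^ (- al)] beats the drift of the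
   barrier, so the barrier is superharmonic for the killed renewal. *)
Lemma barrier_super (n0 L j0 : nat) (ka : R) (r : nat -> R) (n J : nat) :
  (0 < n0)%N -> 0 < ka <= al / 2 -> (forall k, 0 <= r k <= 1) ->
  1 / 2 <= \sum_(j < j0.+1) K j ->
  (forall j, (0 < j <= j0)%N ->
    escape_cst * ka * (n + n0)%:R `^ (- al) <= r (n + j)%N) ->
  (n < L)%N -> (j0 < J)%N ->
  \sum_(j < J) K j * (1 - r (n + j)%N) * barrier n0 L ka (n + j) <=
  barrier n0 L ka n.
Proof.
move=> n00 /andP[ka0 kaal] r01 Kj0 rlow nL j0J.
have [al0 al1] : 0 < al /\ al < 1 by case/andP: al01.
have c20 : 0 <= c2.
  by have := tail_up (ltn0Sn 0); rewrite powR1 mulr1; exact: le_trans.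
set V := barrier n0 L ka.
set m := (n + n0)%N.
have m0 : (0 < m)%N by rewrite /m addn_gt0 n00 orbT.
have mR0 : (0 : R) < m%:R by rewrite ltr0n.
have ka0' : 0 <= ka by exact: ltW.
pose C := 1 / (1 - al) + 2 / al.
have C0 : 0 <= C by rewrite addr_ge0// divr_ge0//; lra.
have V0 k : 0 <= V k by exact: barrier_ge0.
(* After summation by parts the boundary term has a sign, the barrier being nondecreasing, and the
   increments are at most [ka * (m + j) ^ (ka - 1)] up to normalisation. Since [n < L], the barrier
   at [n] is the power itself, so [m ^ (ka - al)] becomes [m ^ (- al) * V n]. *)
have drift : \sum_(j < J) K j * (V (n + j)%N - V n) <=
    c2 * C * ka * m%:R `^ (- al) * V n.
  case: J j0J => // J _.
  have -> : \sum_(j < J.+1) K j * (V (n + j)%N - V n) =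
      \sum_(j < J) tail j.+1 * (V (n + j.+1)%N - V (n + j)%N) -
      tail J.+1 * (V (n + J)%N - V n).
    have h := @tail_abel (fun j => V (n + j)%N - V n) J.
    rewrite addn0 subrr in h; have {}h := h erefl.
    apply: (canRL (addrK _)); rewrite h.
    by apply: eq_bigr => j _; congr (_ * _); ring.
  rewrite lerBlDr -[leLHS]addr0; apply: lerD; last first.
    by rewrite mulr_ge0// subr_ge0 barrier_nd// leq_addr.
  pose D := (L + n0)%:R `^ ka : R.
  have D0 : 0 < D by apply: powR_gt0; rewrite ltr0n addn_gt0 n00 orbT.
  have h1 : \sum_(j < J) tail j.+1 * (V (n + j.+1)%N - V (n + j)%N) <=
      c2 * ka / D * \sum_(j < J) j.+1%:R `^ (- al) * (m + j)%:R `^ (ka - 1).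
    rewrite mulr_sumr; apply: ler_sum => j _.
    have ka01 : 0 < ka < 1 by lra.
    have := @barrier_step n0 L ka (n + j) n00 ka01; rewrite -addnS -/V.
    rewrite addnAC -/m -/D => h.
    have t0 := tail_ge0 j.+1; have t1 := tail_up (ltn0Sn j).
    apply: (le_trans (ler_wpM2l t0 h)).
    have p0 : 0 <= ka * (m + j)%:R `^ (ka - 1) / D.
      by rewrite divr_ge0 ?(ltW D0)// mulr_ge0 ?powR_ge0.
    apply: (le_trans (ler_wpM2r p0 t1)).
    by rewrite le_eqVlt; apply/orP; left; apply/eqP; ring.
  apply: (le_trans h1).
  have h2 := @sum_powR_conv _ m J al ka m0 al01.
  rewrite ka0 kaal in h2; have {}h2 := h2 isT.
  have p0 : 0 <= c2 * ka / D by rewrite divr_ge0 ?(ltW D0)// mulr_ge0.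
  apply: (le_trans (ler_wpM2l p0 h2)).
  rewrite /V barrier_small ?(ltnW nL)// -/m.
  rewrite powRM ?invr_ge0 ?ler0n// powR_inv ?ler0n// -/D -/C.
  rewrite [_ `^ (ka - al)]powRD; last by rewrite (gt_eqF mR0) implybT.
  by rewrite le_eqVlt; apply/orP; left; apply/eqP; ring.
(* Only steps of length at most [j0] are kept; the barrier is nondecreasing, so each of them loses
   at least the killing rate times [V n]. *)
have kill : c2 * C * ka * m%:R `^ (- al) * V n <=
    \sum_(j < J) K j * (r (n + j)%N * V (n + j)%N).
  have -> : \sum_(j < J) K j * (r (n + j)%N * V (n + j)%N) =
      \sum_(0 <= j < J) K j * (r (n + j)%N * V (n + j)%N) by rewrite big_mkord.
  rewrite (big_cat_nat (leq0n j0.+1) j0J) /=.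
  rewrite -[leLHS]addr0; apply: lerD; last first.
    by apply: sumr_ge0 => j _; rewrite !mulr_ge0//; case/andP: (r01 (n + j)%N).
  rewrite big_mkord.
  pose q := escape_cst * ka * m%:R `^ (- al).
  have q0 : 0 <= q.
    by rewrite /q /escape_cst -/C !mulr_ge0// powR_ge0.
  have : \sum_(j < j0.+1) K j * (q * V n) <=
      \sum_(j < j0.+1) K j * (r (n + j)%N * V (n + j)%N).
    apply: ler_sum => -[[|j] jj] _ /=; first by rewrite K_0 !mul0r.
    rewrite ler_wpM2l// ler_pM//; first by apply: rlow; rewrite /= -ltnS.
    by apply: barrier_nd => //; rewrite leq_addr.
  apply: le_trans; rewrite -mulr_suml.
  have qV : 0 <= q * V n by rewrite mulr_ge0.
  apply: (le_trans _ (ler_wpM2r qV Kj0)).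
  by rewrite /q /escape_cst -/C le_eqVlt; apply/orP; left; apply/eqP; field.
have KJ : \sum_(j < J) K j <= 1.
  by have := tail_ge0 J; rewrite /tail subr_ge0.
have -> : \sum_(j < J) K j * (1 - r (n + j)%N) * V (n + j)%N =
   \sum_(j < J) K j * (V (n + j)%N - V n) + (\sum_(j < J) K j) * V n
   - \sum_(j < J) K j * (r (n + j)%N * V (n + j)%N).
  rewrite mulr_suml -big_split /= -sumrB; apply: eq_bigr => j _; ring.
have := ler_wpM2r (V0 n) KJ; lra.
Qed.

End escape.

(** * Sums over renewal paths *)

Section path_sums.
Context {R : realType} (K : nat -> R).
Hypotheses (K_0 : K 0%N = 0) (K_ge0 : forall n, 0 <= K n).

(* Total weight of the renewal paths started at [n], with at most [k - 1] steps,
   all of them below [e]: a step of length [j] into [m] weighs [K j * z m], and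
   the last point [f] weighs [q f]. *)
Fixpoint path_sum (k e : nat) (q z : nat -> R) (n : nat) : R :=
  if k is k'.+1 then
    q n + \sum_(j < e - n) K j * (z (n + j)%N * path_sum k' e q z (n + j)%N)
  else 0.

Lemma path_sum_ge0 k e q z n : (forall m, 0 <= q m) -> (forall m, 0 <= z m) ->
  0 <= path_sum k e q z n.
Proof.
move=> q0 z0; elim: k n => [|k IH] n //=.
by rewrite addr_ge0// sumr_ge0// => j _; rewrite !mulr_ge0.
Qed.

(** Comparison principle: a supersolution dominates, by induction on the number of steps. It is only
    tested on [[s, e)], which the paths never leave. *)
Lemma path_sum_le k e q z s n (W : nat -> R) :
  (forall m, 0 <= z m) -> (forall m, (s <= m < e)%N -> 0 <= W m) ->
  (forall m, (s <= m < e)%N ->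
     q m + \sum_(j < e - m) K j * (z (m + j)%N * W (m + j)%N) <= W m) ->
  (s <= n < e)%N -> path_sum k e q z n <= W n.
Proof.
move=> z0 W0 sup; elim: k n => [|k IH] n sn /=; first exact: W0.
apply: (le_trans _ (sup n sn)); rewrite lerD2l; apply: ler_sum => -[j jn] _.
by rewrite ler_wpM2l// ler_wpM2l// IH//=; lia.
Qed.

Lemma path_sum_succ k e q z n : (forall m, 0 <= q m) -> (forall m, 0 <= z m) ->
  path_sum k e q z n <= path_sum k.+1 e q z n.
Proof.
move=> q0 z0; elim: k n => [|k IH] n.
  by rewrite [leLHS]/=; exact: path_sum_ge0.
rewrite [leLHS]/= [leRHS]/= lerD2l; apply: ler_sum => j _.
by rewrite ler_wpM2l// ler_wpM2l//; exact: IH.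
Qed.

Lemma eq_path_sum k e q z z' n :
  (forall m, (n < m < e)%N -> z m = z' m) ->
  path_sum k e q z n = path_sum k e q z' n.
Proof.
elim: k n => [|k IH] n zz //=; congr (_ + _); apply: eq_bigr => -[j jn] _ /=.
case: j jn => [|j] jn; first by rewrite K_0 !mul0r.
rewrite zz; last by lia.
by congr (_ * (_ * _)); apply: IH => m hm; apply: zz; lia.
Qed.

Lemma path_sum_add (I : Type) (r : seq I) (p : pred I) k e (q : I -> nat -> R) z n :
  path_sum k e (fun m => \sum_(i <- r | p i) q i m) z n =
  \sum_(i <- r | p i) path_sum k e (q i) z n.
Proof.
elim: k n => [|k IH] n /=; first by rewrite big1.
rewrite big_split /=; congr (_ + _); rewrite exchange_big /=.
by apply: eq_bigr => j _; rewrite IH !mulr_sumr.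
Qed.

(** Steps of length zero have no mass, so a path from [n] meets fewer than [e - n] further sites. *)
Lemma path_sum_scale k e q z n (c : R) : (forall m, 0 <= q m) ->
  (forall m, 0 <= z m) -> 1 <= c ->
  path_sum k e q (fun m => c * z m) n <= c ^+ (e - n) * path_sum k e q z n.
Proof.
move=> q0 z0 c1; elim: k n => [|k IH] n /=; first by rewrite mulr0.
rewrite mulrDr; apply: lerD; first by rewrite ler_peMl// exprn_ege1.
rewrite mulr_sumr; apply: ler_sum => -[j jn] _ /=.
case: j jn => [|j] jn; first by rewrite K_0 !mul0r mulr0.
rewrite [leRHS]mulrCA ler_wpM2l// -[c * _ * _]mulrA [leLHS]mulrCA [leRHS]mulrCA ler_wpM2l//.
apply: (@le_trans _ _ (c * (c ^+ (e - (n + j.+1)) *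
    path_sum k e q z (n + j.+1)%N))).
  by rewrite ler_wpM2l// (le_trans _ c1).
rewrite mulrA -exprS ler_wpM2r ?path_sum_ge0// ler_weXn2l//; lia.
Qed.

Lemma path_sum_fuel k k' e q z n : (forall m, 0 <= q m) ->
  (forall m, 0 <= z m) -> (k <= k')%N ->
  path_sum k e q z n <= path_sum k' e q z n.
Proof.
move=> q0 z0 /subnKC <-; elim: (k' - k)%N => [|i IH]; first by rewrite addn0.
by rewrite addnS (le_trans IH)// path_sum_succ.
Qed.

(* The paths are cut at their first point beyond [e]. *)
Lemma path_sum_cut k k' e N q z n : (e <= N)%N -> (n < e)%N ->
  (forall m, 0 <= q m) -> (forall m, 0 <= z m) -> (k <= k')%N ->
  path_sum k N q z n <= path_sum k e (fun m => q m +
    \sum_(e <= d < N) K (d - m) * (z d * path_sum k' N q z d)) z n.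
Proof.
move=> eN + q0 z0; elim: k n => [|k IH] n ne kk' //=.
rewrite -addrA lerD2l.
have -> : \sum_(j < N - n) K j * (z (n + j)%N * path_sum k N q z (n + j)%N) =
    \sum_(0 <= j < e - n) K j * (z (n + j)%N * path_sum k N q z (n + j)%N) +
    \sum_(e <= d < N) K (d - n) * (z d * path_sum k N q z d).
  rewrite -(big_mkord xpredT (fun j => K j * (z (n + j)%N * path_sum k N q z (n + j)%N))).
  have h : (e - n <= N - n)%N by lia.
  rewrite (big_cat_nat (leq0n _) h) /=; congr (_ + _).
  rewrite -[in RHS](subnK (ltnW ne)) big_addn.
  by apply: eq_big_nat => j hj; rewrite addnK addnC.
rewrite addrC; apply: lerD; last first.
  apply: ler_sum_nat => d hd; rewrite ler_wpM2l// ler_wpM2l//.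
  by apply: path_sum_fuel => //; exact: ltnW.
rewrite big_mkord; apply: ler_sum => -[j jn] _ /=.
by rewrite ler_wpM2l// ler_wpM2l// IH//; lia.
Qed.

(* Paths whose weights change once they have used a weight [zl]: afterwards
   the weights are [zc i], where [i] is the place where this happened. *)
Fixpoint phase_sum (k e : nat) (q zs zl : nat -> R) (zc : nat -> nat -> R)
    (n : nat) : R :=
  if k is k'.+1 then
    q n + \sum_(j < e - n) K j *
      (zs (n + j)%N * phase_sum k' e q zs zl zc (n + j)%N +
       zl (n + j)%N * path_sum k' e q (zc (n + j)%N) (n + j)%N)
  else 0.

Lemma phase_sum_ge0 k e q zs zl zc n : (forall m, 0 <= q m) ->
  (forall m, 0 <= zs m) -> (forall m, 0 <= zl m) ->
  (forall i m, 0 <= zc i m) -> 0 <= phase_sum k e q zs zl zc n.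
Proof.
move=> q0 zs0 zl0 zc0; elim: k n => [|k IH] n //=.
rewrite addr_ge0// sumr_ge0// => j _; rewrite mulr_ge0// addr_ge0//.
  by rewrite mulr_ge0.
by rewrite mulr_ge0// path_sum_ge0.
Qed.

(** Expand [z = zs + zl] along the path and sort by the first point [m] where [zl] is used. Beyond
    it the weights may be replaced by [zc m], since they agree with [z] whenever [zl m] is not
    zero. *)
Lemma phase_sum_eq k e q z zs zl zc n :
  (forall m, (n < m < e)%N -> z m = zs m + zl m) ->
  (forall m m', (n < m)%N -> (m < m' < e)%N -> zl m = 0 \/ zc m m' = z m') ->
  path_sum k e q z n = phase_sum k e q zs zl zc n.
Proof.
elim: k n => [|k IH] n zz zlc //=; congr (_ + _).
apply: eq_bigr => -[j jn] _ /=.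
case: j jn => [|j] jn; first by rewrite K_0 !mul0r.
rewrite {1}zz ?mulrDl; last by lia.
congr (_ * (_ + _)).
  congr (_ * _); apply: IH => [m hm|m m' hm hm']; first by apply: zz; lia.
  by apply: zlc; lia.
have [->|nz] := eqVneq (zl (n + j.+1)%N) 0; first by rewrite !mul0r.
congr (_ * _); apply: eq_path_sum => m hm.
have nj : (n < n + j.+1)%N by lia.
by case: (zlc _ _ nj hm) => [/eqP|//]; rewrite (negbTE nz).
Qed.

(** * Survival of the killed renewal before and after its first heavy charge *)

Section two_phases.
Variables (al c2 : R) (e d L j0 : nat) (q : nat -> R) (Cq c1 p : R) (r1 : nat -> R).
Hypotheses (al01 : 0 < al < 1) (tail_ge0 : forall n, 0 <= tail K n).
Hypothesis (tail_up : forall n, (0 < n)%N -> tail K n <= c2 * n%:R `^ (- al)).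
Hypotheses (q_ge0 : forall m, 0 <= q m) (Cq_ge0 : 0 <= Cq) (c1_ge0 : 0 <= c1).
Hypothesis (q_tail : forall m, (d <= m < e)%N -> q m <= Cq * tail K (e - m)).
Hypothesis (q_window : forall m, (d <= m < d + L.*2)%N ->
  q m <= c1 * tail K L.*2).
Hypotheses (window : (d + L.*2 <= e)%N) (j0L : (j0 < L)%N) (p01 : 0 <= p <= 1).
Hypotheses (r01 : forall k, 0 <= r1 k <= 1) (Kj0 : 1 / 2 <= \sum_(j < j0.+1) K j).

Local Notation L' := (L - j0)%N.

(** The constant [Cq] is a supersolution: from [m] the renewal leaves [[m, e)] with probability
    [tail K (e - m)], and this loss pays for [q m]. *)
Lemma path_sum_le_cst k z n : (forall m, 0 <= z m <= 1) -> (d <= n < e)%N ->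
  path_sum k e q z n <= Cq.
Proof.
move=> z01 dn; apply: (@path_sum_le k e q z d n (fun=> Cq)) => //.
  by move=> m; case/andP: (z01 m).
move=> m hm.
have : \sum_(j < e - m) K j * (z (m + j)%N * Cq) <= (1 - tail K (e - m)) * Cq.
  rewrite /tail subKr mulr_suml; apply: ler_sum => j _; rewrite ler_wpM2l//.
  by rewrite ler_piMl//; case/andP: (z01 (m + j)%N).
have := q_tail hm; lra.
Qed.

Lemma phase_sum_le_cst k n : (d <= n < e)%N ->
  phase_sum k e q (fun=> 1 - p) (fun=> p) (fun i m => 1 - r1 (m - i)%N) n <= Cq.
Proof.
elim: k n => [|k IH] n dn //=.
have : \sum_(j < e - n) K j * ((1 - p) * phase_sum k e q (fun=> 1 - p)
     (fun=> p) (fun i m => 1 - r1 (m - i)%N) (n + j)%N +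
     p * path_sum k e q (fun m => 1 - r1 (m - (n + j))%N) (n + j)%N) <=
   (1 - tail K (e - n)) * Cq.
  rewrite /tail subKr mulr_suml; apply: ler_sum => -[j jn] _ /=.
  rewrite ler_wpM2l//.
  have dnj : (d <= n + j < e)%N by lia.
  have h1 := IH _ dnj.
  have z01 m : 0 <= 1 - r1 (m - (n + j))%N <= 1.
    by have := r01 (m - (n + j)); lra.
  have h2 := path_sum_le_cst k z01 dnj.
  have [p0 p1] : 0 <= p /\ 0 <= 1 - p by split; move: p01; lra.
  by have := ler_wpM2l p0 h2; have := ler_wpM2l p1 h1; lra.
have := q_tail dn; lra.
Qed.

(** Pays for paths that end inside the window, possibly before any killing. It is a supersolution
    there because a step leaves the window with probability at least [tail K L.*2]. *)
Definition window_cst (m : nat) : R := if (m < d + L.*2)%N then c1 else 0.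

Lemma window_cst_ge0 m : 0 <= window_cst m.
Proof. by rewrite /window_cst; case: ifP. Qed.

Lemma window_cst_super m : (d <= m < d + L.*2)%N ->
  q m + \sum_(j < e - m) K j * window_cst (m + j)%N <= window_cst m.
Proof.
move=> hm; rewrite {2}/window_cst (andP hm).2.
have -> : \sum_(j < e - m) K j * window_cst (m + j)%N =
    (1 - tail K (d + L.*2 - m)) * c1.
  rewrite /tail subKr mulr_suml.
  rewrite -(big_mkord xpredT (fun j => K j * window_cst (m + j)%N)).
  have h : (d + L.*2 - m <= e - m)%N by lia.
  rewrite (big_cat_nat (leq0n _) h) /=.
  rewrite [X in _ + X](_ : _ = 0) ?addr0; last first.
    by rewrite big_nat big1// => j hj; rewrite /window_cst ifF ?mulr0//; lia.
  rewrite big_mkord; apply: eq_bigr => -[j jn] _ /=.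
  by rewrite /window_cst ifT//; lia.
have t : tail K L.*2 <= tail K (d + L.*2 - m) by apply: tail_le => //; lia.
have := ler_wpM2l c1_ge0 t; have := q_window hm; lra.
Qed.

Variables (ka0 ka1 : R) (n0 : nat).
Hypotheses (n00 : (0 < n0)%N) (ka0P : 0 < ka0 <= al / 2) (ka1P : 0 < ka1 <= al / 2).
Hypothesis (hp : escape_cst al c2 * ka0 * n0%:R `^ (- al) <= p).
Hypothesis (hr1 : forall n j, (0 < j <= j0)%N ->
  escape_cst al c2 * ka1 * (n + 1)%:R `^ (- al) <= r1 (n + j)%N).

(** Second phase, after a heavy charge at [i]. Up to distance [L'] the right-hand side is a
    supersolution; beyond it the barrier equals one and the trivial bound [Cq] is enough. As
    [i < d + L], this stretch fits into the window of length [L.*2]. *)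
Lemma path_sum_le_barrier k i m : (d <= i < d + L)%N -> (i <= m < e)%N ->
  path_sum k e q (fun m => 1 - r1 (m - i)%N) m <=
  window_cst m + Cq * barrier 1 L' ka1 (m - i).
Proof.
move=> di; have ka0' : 0 <= ka1 by move: ka1P; lra.
elim: k m => [|k IH] m im.
  by rewrite /= addr_ge0 ?window_cst_ge0// mulr_ge0// barrier_ge0.
have [Lm|mL] := leqP (i + L') m.
  rewrite barrier_eq1//; last by clear -Lm im; lia.
  apply: ler_wpDl; first exact: window_cst_ge0.
  rewrite mulr1; apply: path_sum_le_cst; last by clear -im di; lia.
  by move=> l; have := r01 (l - i); lra.
have mw : (d <= m < d + L.*2)%N by clear -mL im di j0L; lia.
apply: (@le_trans _ _ (q m + (\sum_(j < e - m) K j * window_cst (m + j)%N +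
  Cq * \sum_(j < e - m) K j * (1 - r1 (m - i + j)%N) *
     barrier 1 L' ka1 (m - i + j)))).
  rewrite [leLHS]/= lerD2l mulr_sumr -big_split; apply: ler_sum => -[j jn] _ /=.
  have -> : (m - i + j)%N = (m + j - i)%N by clear -im; lia.
  set l := (m + j)%N; have il : (i <= l < e)%N by clear -im jn; lia.
  have [ra rb] : 0 <= 1 - r1 (l - i)%N /\ 1 - r1 (l - i)%N <= 1.
    by split; have := r01 (l - i); lra.
  have := ler_wpM2l ra (IH l il).
  have := window_cst_ge0 l; set w := window_cst l => w0 h.
  have h2 : (1 - r1 (l - i)%N) * w <= w by rewrite ler_piMl.
  have := ler_wpM2l (K_ge0 j) h; have := ler_wpM2l (K_ge0 j) h2; lra.
have hs := @barrier_super R K al c2 K_0 K_ge0 al01 tail_ge0 tail_up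
  1 L' j0 ka1 r1 (m - i) (e - m) isT ka1P r01 Kj0.
have /hs hs1 : forall j, (0 < j <= j0)%N ->
    escape_cst al c2 * ka1 * (m - i + 1)%:R `^ (- al) <= r1 (m - i + j)%N.
  by move=> j jj; exact: hr1.
have a1 : (m - i < L')%N by clear -mL im j0L; lia.
have a2 : (j0 < e - m)%N by clear -mL im di window j0L; lia.
have := ler_wpM2l Cq_ge0 (hs1 a1 a2); have := window_cst_super mw; lra.
Qed.

(** A surviving path either meets no heavy charge for a distance [L'], which the first barrier pays
    for, or meets one and then no partner for a distance [L'], which costs the second barrier at its
    origin. The latter is a constant, harmless because [K] has mass at most one. *)
Lemma phase_sum_le_barrier k n : (d <= n < e)%N ->
  phase_sum k e q (fun=> 1 - p) (fun=> p) (fun i m => 1 - r1 (m - i)%N) n <=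
  window_cst n + Cq * (barrier n0 L' ka0 (n - d) + barrier 1 L' ka1 0).
Proof.
have ka0' : 0 <= ka0 by move: ka0P; lra.
pose b1 := barrier 1 L' ka1 0; have b10 : 0 <= b1 by exact: barrier_ge0.
(* A heavy charge at distance [L] or more leaves too little of the window for the second phase, so
   it is not counted as killing. Stopping the barrier at [L - j0] keeps every step of length at most
   [j0] within the killing zone. *)
pose r0 k := if (k < L)%N then p else 0.
have r0P j : 0 <= r0 j <= 1 by rewrite /r0; case: ifP => // _; rewrite lexx ler01.
elim: k n => [|k IH] n dn.
  rewrite /= addr_ge0 ?window_cst_ge0// mulr_ge0// addr_ge0 ?barrier_ge0//.
have [Ln|nL] := leqP (d + L') n.
  rewrite barrier_eq1//; last by clear -Ln dn; lia.
  apply: ler_wpDl; first exact: window_cst_ge0.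
  rewrite mulrDr mulr1; apply: ler_wpDr; first by rewrite mulr_ge0.
  exact: phase_sum_le_cst.
have nw : (d <= n < d + L.*2)%N by clear -nL dn j0L; lia.
apply: (@le_trans _ _ (q n + (\sum_(j < e - n) K j * window_cst (n + j)%N +
  (Cq * (\sum_(j < e - n) K j * (1 - r0 (n - d + j)%N) *
     barrier n0 L' ka0 (n - d + j)) + Cq * (\sum_(j < e - n) K j * b1))))).
  rewrite [leLHS]/= lerD2l !mulr_sumr -!big_split; apply: ler_sum => -[j jn] _ /=.
  have -> : (n - d + j)%N = (n + j - d)%N by clear -dn; lia.
  set l := (n + j)%N; have dl : (d <= l < e)%N by clear -dn jn; lia.
  have [pa pb] : 0 <= p /\ 0 <= 1 - p by split; move: p01; lra.
  have := IH l dl; set V := barrier n0 L' ka0 (l - d) => h0.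
  have V0 : 0 <= V by exact: barrier_ge0.
  have w0 := window_cst_ge0 l; move: h0 w0; set w := window_cst l => h0 w0.
  rewrite -!mulrDr.
  rewrite [X in _ <= X](_ : _ = K j * (w + Cq * ((1 - r0 (l - d)%N) * V) + Cq * b1)); last by ring.
  rewrite ler_wpM2l//; have [lL|Ll] := ltnP (l - d) L.
    rewrite /r0 lL.
    have hl : (d <= l < d + L)%N by clear -lL dl; lia.
    have ll : (l <= l < e)%N by clear -dl; lia.
    have := @path_sum_le_barrier k l l hl ll; rewrite subnn -/b1 -/w => h1.
    have := ler_wpM2l pa h1; have := ler_wpM2l pb h0; rewrite -/b1; lra.
  rewrite /r0 ltnNge Ll /= subr0 mul1r /V barrier_eq1//; last by clear -Ll; lia.
  have h1 : path_sum k e q (fun m => 1 - r1 (m - l)%N) l <= Cq.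
    by apply: path_sum_le_cst => // m; have := r01 (m - l); lra.
  have h2 := @phase_sum_le_cst k l dl.
  have := ler_wpM2l pa h1; have := ler_wpM2l pb h2.
  have := mulr_ge0 Cq_ge0 b10; lra.
have hs := @barrier_super R K al c2 K_0 K_ge0 al01 tail_ge0 tail_up
  n0 L' j0 ka0 r0 (n - d) (e - n) n00 ka0P r0P Kj0.
have /hs hs1 : forall j, (0 < j <= j0)%N ->
    escape_cst al c2 * ka0 * (n - d + n0)%:R `^ (- al) <= r0 (n - d + j)%N.
  move=> j jj; rewrite /r0 ifT; last by clear -jj nL dn j0L; lia.
  apply: (le_trans _ hp); rewrite ler_wpM2l//.
    rewrite /escape_cst !mulr_ge0 ?addr_ge0 ?divr_ge0 ?ler0n//; try (move: al01; lra).
    by have := tail_up (ltn0Sn 0); rewrite powR1 mulr1; exact: le_trans.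
  rewrite !powRN lef_pV2 ?posrE ?powR_gt0 ?ltr0n ?addn_gt0 ?n00 ?orbT//.
  by apply: ge0_ler_powR; rewrite ?nnegrE ?ler0n ?ler_nat ?leq_addl//; move: al01; lra.
have a1 : (n - d < L')%N by clear -nL dn j0L; lia.
have a2 : (j0 < e - n)%N by clear -nL dn window j0L; lia.
have h1 := ler_wpM2l Cq_ge0 (hs1 a1 a2); have h2 := window_cst_super nw.
have h3 : Cq * (\sum_(j < e - n) K j * b1) <= Cq * b1.
  rewrite ler_wpM2l// -mulr_suml ler_piMl//.
  by have := tail_ge0 (e - n); rewrite /tail subr_ge0.
by rewrite -/b1; lra.
Qed.

End two_phases.

End path_sums.

(** * Random weights *)

Section random_path_sums.
Context {d : measure_display} {W : measurableType d} {R : realType}.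
Variables (P : probability W R) (X : nat -> W -> R) (K : nat -> R).
Hypotheses (mX : forall n, measurable_fun setT (X n)).
Hypothesis (indX : mutually_independent P X).
Hypotheses (K_0 : K 0%N = 0) (K_ge0 : forall n, 0 <= K n).

Definition weight (f : nat -> R -> R) : Prop := forall m,
  [/\ measurable_fun setT (f m), forall x, 0 <= f m x &
      P.-integrable setT (EFin \o (f m \o X m))].

Local Notation adm := (admissible P X).
Local Notation E := (Ex P).
Local Notation mean f := (fun m => E (f m \o X m)).

Lemma admissible_site A f m : weight f -> A m -> adm A (f m \o X m).
Proof.
move=> wf Am; have [mf f0 If] := wf m; split => //; first exact: locfun_site.
by move=> w; exact: f0.
Qed.

Definition between (n e : nat) : set nat := [set m | (n < m < e)%N].

(** The arrival site [n + j] is disjoint from the sites used afterwards. The step [j = 0], which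
    would arrive at a site outside [between n e], has no mass. *)
Lemma random_step (e n j : nat) (F G : W -> R) :
  adm (fun m => m = (n + j)%N) F -> adm (between (n + j) e) G -> (j < e - n)%N ->
  adm (between n e) (fun w => K j * (F w * G w)) /\
  E (fun w => K j * (F w * G w)) = K j * (E F * E G).
Proof.
move=> aF aG jn; case: j jn aF aG => [|j] jn aF aG.
  have -> : (fun w => K 0%N * (F w * G w)) = fun=> 0.
    by apply/funext => w; rewrite K_0 mul0r.
  by rewrite K_0 mul0r Ex_cst; split => //; exact: admissible_cst.
have disj i : i = (n + j.+1)%N -> between (n + j.+1) e i -> False.
  by rewrite /between /= => ->; rewrite ltnn.
have aFG : adm (between n e) (fun w => F w * G w).
  apply: (admissibleM mX indX disj _ _ aF aG).
    by move=> i /= ->; rewrite /between /=; clear -jn; lia.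
  by move=> i /=; rewrite /between /=; clear -jn; lia.
split; first exact: admissibleZ.
by rewrite (ExZ _ aFG) (ExM mX indX disj aF aG).
Qed.

(** A path visits distinct sites, so by independence the expectation replaces every weight by its
    mean. *)
Lemma random_path_sum k e q f n : weight f -> (forall m, 0 <= q m) ->
  adm (between n e) (fun w => path_sum K k e q (fun m => f m (X m w)) n) /\
  E (fun w => path_sum K k e q (fun m => f m (X m w)) n) =
  path_sum K k e q (mean f) n.
Proof.
move=> wf q0; elim: k n => [|k IH] n /=.
  by rewrite Ex_cst; split => //; exact: admissible_cst.
have H (j : 'I_(e - n)) := random_step (admissible_site (A := fun m => m = (n + j)%N)
  wf erefl) (IH (n + j)%N).1 (ltn_ord j).
have aS : adm (between n e) (fun w => \sum_(j < e - n) K j *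
    (f (n + j)%N (X (n + j)%N w) *
     path_sum K k e q (fun m => f m (X m w)) (n + j))).
  by apply: admissible_sum => j _; have [] := H j.
have ac : adm (between n e) (fun=> q n) by exact: admissible_cst.
split; first exact: (admissibleD ac aS).
rewrite (ExD ac aS) Ex_cst (@Ex_sum _ _ _ _ _ P X (between n e)); last first.
  by move=> j _; have [] := H j.
congr (_ + _); apply: eq_bigr => j _; rewrite (H j).2.
by rewrite (IH (n + j)%N).2.
Qed.

Lemma random_phase_sum k e q fs fl fc n : weight fs -> weight fl ->
  (forall i, weight (fc i)) -> (forall m, 0 <= q m) ->
  adm (between n e) (fun w => phase_sum K k e q (fun m => fs m (X m w))
    (fun m => fl m (X m w)) (fun i m => fc i m (X m w)) n) /\
  E (fun w => phase_sum K k e q (fun m => fs m (X m w))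
    (fun m => fl m (X m w)) (fun i m => fc i m (X m w)) n) =
  phase_sum K k e q (mean fs) (mean fl) (fun i => mean (fc i)) n.
Proof.
move=> ws wl wc q0; elim: k n => [|k IH] n /=.
  by rewrite Ex_cst; split => //; exact: admissible_cst.
have H1 (j : 'I_(e - n)) := random_step (admissible_site (A := fun m => m = (n + j)%N)
  ws erefl) (IH (n + j)%N).1 (ltn_ord j).
have H2 (j : 'I_(e - n)) := random_step (admissible_site (A := fun m => m = (n + j)%N)
  wl erefl) (@random_path_sum k e q (fc (n + j)%N) (n + j)%N (wc _) q0).1 (ltn_ord j).
have H (j : 'I_(e - n)) : (fun w => K j * (fs (n + j)%N (X (n + j)%N w) *
    phase_sum K k e q (fun m => fs m (X m w)) (fun m => fl m (X m w))
      (fun i m => fc i m (X m w)) (n + j) + fl (n + j)%N (X (n + j)%N w) *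
      path_sum K k e q (fun m => fc (n + j)%N m (X m w)) (n + j))) =
   (fun w => K j * (fs (n + j)%N (X (n + j)%N w) *
    phase_sum K k e q (fun m => fs m (X m w)) (fun m => fl m (X m w))
      (fun i m => fc i m (X m w)) (n + j)) + K j * (fl (n + j)%N (X (n + j)%N w) *
      path_sum K k e q (fun m => fc (n + j)%N m (X m w)) (n + j))).
  by apply/funext => w; rewrite mulrDr.
have aH (j : 'I_(e - n)) : adm (between n e)
    (fun w => K j * (fs (n + j)%N (X (n + j)%N w) *
    phase_sum K k e q (fun m => fs m (X m w)) (fun m => fl m (X m w))
      (fun i m => fc i m (X m w)) (n + j) + fl (n + j)%N (X (n + j)%N w) *
      path_sum K k e q (fun m => fc (n + j)%N m (X m w)) (n + j))).
  by rewrite H; apply: admissibleD; [exact: (H1 j).1|exact: (H2 j).1].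
have ac : adm (between n e) (fun=> q n) by exact: admissible_cst.
have aS := @admissible_sum _ _ _ _ _ P X (between n e) 'I_(e - n)
  (index_enum _) xpredT _ (fun j _ => aH j).
split; first exact: (admissibleD ac aS).
rewrite (ExD ac aS) Ex_cst (Ex_sum _ (fun j _ => aH j)).
congr (_ + _); apply: eq_bigr => j _; rewrite H (ExD (H1 j).1 (H2 j).1).
rewrite (H1 j).2 (H2 j).2 (IH _).2 mulrDr.
by rewrite (@random_path_sum k e q (fc (n + j)%N) (n + j)%N (wc _) q0).2.
Qed.

End random_path_sums.

(** * Penalised chunks *)

Definition step_fun {R : realType} (c x : R) : R := (c <= x)%R%:R.

Lemma step_fun01 {R : realType} (c x : R) : 0 <= step_fun c x <= 1.
Proof. by rewrite /step_fun; case: (c <= x); rewrite ?lexx ?ler01. Qed.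

Lemma measurable_step_fun {R : realType} (c : R) :
  measurable_fun setT (step_fun c).
Proof.
have -> : step_fun c = \1_[set x : R | c <= x].
  by apply/funext => x; rewrite /step_fun indicE mem_setE.
apply: measurable_indic.
have -> : [set x : R | c <= x] = `[c, +oo[%classic.
  by apply/seteqP; split => x /=; rewrite in_itv/= andbT.
exact: measurable_itv.
Qed.

Lemma prodr_union_bound {R : realType} (I : Type) (s : seq I) (p : pred I) (a : I -> R) :
  (forall i, p i -> 0 <= a i <= 1) ->
  1 - \prod_(i <- s | p i) (1 - a i) <= \sum_(i <- s | p i) a i.
Proof.
move=> a01; suff : 0 <= \prod_(i <- s | p i) (1 - a i) <= 1 /\
    1 - \prod_(i <- s | p i) (1 - a i) <= \sum_(i <- s | p i) a i by case.
elim: s => [|i s [/andP[P0 P1] IH]].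
  by rewrite !big_nil subrr ler01 lexx.
rewrite !big_cons; case: ifPn => [/a01/andP[i0 i1]|_]; last by rewrite P0 P1.
have h : 0 <= 1 - a i by lra.
split; last by nra.
by rewrite mulr_ge0//= mulr_ile1//; lra.
Qed.

Section chunk.
Context {d : measure_display} {W : measurableType d} {R : realType}.
Variables (P : probability W R) (X : nat -> W -> R) (K : nat -> R).
Hypotheses (iidX : iid P X) (K_0 : K 0%N = 0) (K_ge0 : forall n, 0 <= K n).

Local Notation adm := (admissible P X).
Local Notation E := (Ex P).

Let mX : forall n, measurable_fun setT (X n). Proof. by case: iidX. Qed.
Let indX : mutually_independent P X. Proof. by case: iidX. Qed.

Lemma ident_integral (f : R -> R) m n : measurable_fun setT f ->
  (forall x, 0 <= f x) ->
  (\int[P]_w (f (X m w))%:E = \int[P]_w (f (X n w))%:E)%E.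
Proof.
move=> mf f0; have [_ _ idX] := iidX.
pose Y i : {mfun W >-> R} := HB.pack (X i) (isMeasurableFun.Build _ _ _ _ _ (mX i)).
have mfe : measurable_fun setT (EFin \o f) by exact/measurable_EFinP.
have tr i : (\int[P]_w (f (X i w))%:E = \int[distribution P (Y i)]_y (EFin \o f) y)%E.
  by rewrite (@ge0_integral_distribution _ _ _ _ _ P (Y i) (EFin \o f) mfe)// => y;
    rewrite lee_fin.
rewrite !tr; apply: eq_measure_integral => C mC _.
exact: idX.
Qed.

Lemma Ex_ident (f : R -> R) m n : measurable_fun setT f ->
  (forall x, 0 <= f x) -> E (f \o X m) = E (f \o X n).
Proof. by move=> mf f0; rewrite /Ex /Rintegral (ident_integral m n). Qed.

Variables (beta A : R) (thr : nat -> R).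

(* The absolute value makes the weight nonnegative everywhere; it is almost surely
   superfluous since [beta * omega > - 1]. *)
Definition site_weight (x : R) : R := `|1 + beta * x|.

Lemma measurable_site_weight : measurable_fun setT site_weight.
Proof.
apply: measurableT_comp; first exact: normr_measurable.
by apply: measurable_funD => //; exact: measurable_funM.
Qed.

Hypothesis weight1 : P.-integrable setT (EFin \o (site_weight \o X 1%N)).
Hypothesis mean1 : E (site_weight \o X 1%N) = 1.

Lemma weight_bdd (u : nat -> R -> R) :
  (forall m, measurable_fun setT (u m)) -> (forall m x, 0 <= u m x <= 1) ->
  weight P X (fun m x => u m x * site_weight x).
Proof.
move=> mu u01 m.
have mg : measurable_fun setT (fun x => u m x * site_weight x).
  by apply: measurable_funM => //; exact: measurable_site_weight.
split => //.
- by move=> x; case/andP: (u01 m x) => u0 _; rewrite mulr_ge0 ?normr_ge0.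
- apply/integrableP; split.
    by apply/measurable_EFinP; exact: (measurableT_comp mg (mX m)).
  rewrite (eq_integral (fun w => (u m (X m w) * site_weight (X m w))%:E)); last first.
    move=> w _ /=; rewrite ger0_norm// mulr_ge0 ?normr_ge0//.
    by case/andP: (u01 m (X m w)).
  apply: (@le_lt_trans _ _ (\int[P]_w (site_weight (X m w))%:E)%E).
    apply: ge0_le_integral => //.
    + move=> w _; rewrite lee_fin mulr_ge0 ?normr_ge0//.
      by case/andP: (u01 m (X m w)).
    + by apply/measurable_EFinP; exact: (measurableT_comp mg (mX m)).
    + by apply/measurable_EFinP;
        exact: (measurableT_comp measurable_site_weight (mX m)).
    + move=> w _; rewrite lee_fin ler_piMl ?normr_ge0//.
      by case/andP: (u01 m (X m w)).
  rewrite (ident_integral m 1%N measurable_site_weight (fun=> normr_ge0 _)).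
  have := integrable_fin_num measurableT weight1.
  by rewrite fin_numElt => /andP[].
Qed.

(* Probability that a charge exceeds [c] under the law tilted by [site_weight]. *)
Definition heavy (c : R) : R := E (fun w => step_fun c (X 1%N w) * site_weight (X 1%N w)).

Lemma weight_site : weight P X (fun=> site_weight).
Proof.
have := @weight_bdd (fun _ _ => 1) (fun=> measurable_cst _).
have -> : (fun (_ : nat) x => 1 * site_weight x) = fun=> site_weight.
  by apply/funext => m; apply/funext => x; rewrite mul1r.
by apply => m x; rewrite lexx ler01.
Qed.

Lemma weight_step (c : nat -> R) :
  weight P X (fun m x => step_fun (c m) x * site_weight x).
Proof.
apply: weight_bdd => [m|m x]; [exact: measurable_step_fun|exact: step_fun01].
Qed.

Lemma weight_costep (c : nat -> R) :
  weight P X (fun m x => (1 - step_fun (c m) x) * site_weight x).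
Proof.
apply: weight_bdd => [m|m x]; last by have := step_fun01 (c m) x; lra.
by apply: measurable_funB => //; exact: measurable_step_fun.
Qed.

Lemma mean_site m : E (site_weight \o X m) = 1.
Proof.
rewrite (Ex_ident m 1%N measurable_site_weight (fun=> normr_ge0 _)).
exact: mean1.
Qed.

Lemma mean_step c m : E ((fun x => step_fun c x * site_weight x) \o X m) = heavy c.
Proof.
apply: (Ex_ident m 1%N); first by have [] := weight_step (fun=> c) 0%N.
by move=> x; have [_ h _] := weight_step (fun=> c) 0%N; exact: h.
Qed.

Lemma mean_costep c m :
  E ((fun x => (1 - step_fun c x) * site_weight x) \o X m) = 1 - heavy c.
Proof.
have a1 := @admissible_site _ _ _ P X [set: nat] _ m (weight_step (fun=> c)) I.
have a2 := @admissible_site _ _ _ P X [set: nat] _ m (weight_costep (fun=> c)) I.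
have := ExD a1 a2; rewrite (mean_step c m).
rewrite [X in E X](_ : _ = site_weight \o X m); last first.
  by apply/funext => w /=; ring.
by rewrite mean_site => /eqP; rewrite addrC -subr_eq => /eqP <-.
Qed.

Lemma heavy01 c : 0 <= heavy c <= 1.
Proof.
rewrite -(mean_step c 1) Ex_ge0/=; last first.
  by move=> w; rewrite mulr_ge0 ?normr_ge0//; case/andP: (step_fun01 c (X 1%N w)).
have := mean_costep c 1; rewrite mean_step.
have : 0 <= E ((fun x => (1 - step_fun c x) * site_weight x) \o X 1%N).
  apply: Ex_ge0 => w /=; rewrite mulr_ge0 ?normr_ge0//.
  by have := step_fun01 c (X 1%N w); lra.
lra.
Qed.

Definition big_pair (i j : nat) (w : W) : R :=
  step_fun A (X i w) * step_fun (thr (j - i)) (X j w).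

(** Indicator of a good chunk, in product form so that locality and the union bound are obtained
    factor by factor. *)
Definition no_pair (s e : nat) (w : W) : R :=
  \prod_(s <= i < e) \prod_(i.+1 <= j < e) (1 - big_pair i j w).

Lemma big_pair01 i j w : 0 <= big_pair i j w <= 1.
Proof.
have /andP[a0 a1] := step_fun01 A (X i w).
have /andP[b0 b1] := step_fun01 (thr (j - i)) (X j w).
by rewrite /big_pair mulr_ge0//= mulr_ile1.
Qed.

Lemma no_pair01 s e w : 0 <= no_pair s e w <= 1.
Proof.
rewrite /no_pair; apply/andP; split.
  apply: prodr_ge0 => i _; apply: prodr_ge0 => j _.
  by have := big_pair01 i j w; lra.
apply: prodr_ile1 => i _; apply/andP; split.
  by apply: prodr_ge0 => j _; have := big_pair01 i j w; lra.
by apply: prodr_ile1 => j _; have := big_pair01 i j w; lra.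
Qed.

Lemma no_pairP s e w : no_pair s e w = 0 \/ no_pair s e w = 1 /\
  forall i j, (s <= i)%N -> (i < j < e)%N -> big_pair i j w = 0.
Proof.
have bp i j : big_pair i j w = 0 \/ big_pair i j w = 1.
  by rewrite /big_pair /step_fun; case: (_ <= _); case: (_ <= _);
    rewrite ?mul0r ?mulr0 ?mulr1; [right|left|left|left].
have [[i [j [si ij b1]]]|nb] := pselect (exists i j, [/\ (s <= i)%N, (i < j < e)%N &
    big_pair i j w = 1]).
  left; rewrite /no_pair.
  have ie : i \in index_iota s e by rewrite mem_index_iota; clear -si ij; lia.
  have je : j \in index_iota i.+1 e by rewrite mem_index_iota; clear -si ij; lia.
  apply/eqP; rewrite prodf_seq_eq0; apply/hasP; exists i => //=.
  by rewrite prodf_seq_eq0; apply/hasP; exists j => //=; rewrite b1 subrr.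
right; have z i j : (s <= i)%N -> (i < j < e)%N -> big_pair i j w = 0.
  by move=> si ij; have [//|b1] := bp i j; case: nb; exists i, j; split.
split => //; rewrite /no_pair big_nat big1// => i /andP[si ie].
by rewrite big_nat big1// => j ij; rewrite z ?subr0.
Qed.

Definition chunk_sites (s e : nat) : set nat := [set m | (s <= m < e)%N].

Lemma locfun_prod (s : set nat) (I : eqType) (r : seq I) (F : I -> W -> R) :
  (forall i, i \in r -> locfun X s (F i)) -> locfun X s (fun w => \prod_(i <- r) F i w).
Proof.
elim: r => [|i r IH] sF.
  rewrite [X in locfun _ _ X](_ : _ = fun=> 1); first exact: locfun_cst.
  by apply/funext => w; rewrite big_nil.
rewrite [X in locfun _ _ X](_ : _ = fun w => F i w * \prod_(j <- r) F j w).
  apply: locfunM; first by apply: sF; rewrite mem_head.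
  by apply: IH => j jr; apply: sF; rewrite inE jr orbT.
by apply/funext => w; rewrite big_cons.
Qed.

Lemma locfun_big_pair (s : set nat) i j : s i -> s j -> locfun X s (big_pair i j).
Proof.
by move=> si sj; apply: locfunM; apply: (@locfun_site _ _ _ _ _ X s) => //;
  exact: measurable_step_fun.
Qed.

Lemma locfun_no_pair s e : locfun X (chunk_sites s e) (no_pair s e).
Proof.
apply: locfun_prod => i; rewrite mem_index_iota => /andP[si ie].
apply: locfun_prod => j; rewrite mem_index_iota => /andP[ij je].
apply: measurable_funB; first exact: measurable_cst.
apply: locfun_big_pair; rewrite /chunk_sites /= ?si ?ie ?je//.
by rewrite (leq_trans si)// ltnW.
Qed.

Variables (eta : R).
Hypothesis (eta01 : 0 < eta < 1).

(** Equal to 1 on good chunks and to [eta] on bad ones; the affine form in [no_pair] lets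
    expectations act on it. *)
Definition penalty (s e : nat) (w : W) : R := eta + (1 - eta) * no_pair s e w.

Lemma penalty_gt0 s e w : 0 < penalty s e w.
Proof.
case/andP: eta01 => e0 e1; rewrite /penalty; case/andP: (no_pair01 s e w) => n0 n1.
by rewrite ltr_pwDl// mulr_ge0//; lra.
Qed.

Lemma penalty_le1 s e w : penalty s e w <= 1.
Proof.
rewrite /penalty; case/andP: eta01 => e0 e1; case/andP: (no_pair01 s e w) => n0 n1; nra.
Qed.

Lemma penalty_le s e w : penalty s e w <= eta + no_pair s e w.
Proof.
rewrite /penalty; case/andP: eta01 => e0 e1; case/andP: (no_pair01 s e w) => n0 n1; nra.
Qed.

Lemma locfun_penalty s e : locfun X (chunk_sites s e) (penalty s e).
Proof.
apply: locfunD; first exact: locfun_cst.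
by apply: locfunM; [exact: locfun_cst|exact: locfun_no_pair].
Qed.

(* Equal to [penalty ^ (- t)] up to the additive constant 1, and affine in [no_pair]. *)
Definition inv_penalty (t : R) (s e : nat) (w : W) : R :=
  1 + eta `^ (- t) * (1 - no_pair s e w).

Lemma inv_penalty_ge t s e w : penalty s e w `^ (- t) <= inv_penalty t s e w.
Proof.
rewrite /penalty /inv_penalty; case: (no_pairP s e w) => [->|[-> _]].
  by rewrite mulr0 addr0 subr0 mulr1 lerDr.
by rewrite mulr1 subrr mulr0 addr0 addrC subrK powR1.
Qed.

Lemma admissible_inv_penalty t s e :
  adm (chunk_sites s e) (inv_penalty t s e).
Proof.
have p0 := powR_ge0 eta (- t).
apply: (@admissible_dom _ _ _ _ _ P X mX _ (fun=> 1 + eta `^ (- t))).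
- apply: locfunD; first exact: locfun_cst.
  apply: locfunM; first exact: locfun_cst.
  by apply: measurable_funB; [exact: measurable_cst|exact: locfun_no_pair].
- move=> w; case/andP: (no_pair01 s e w) => n0 n1; rewrite /inv_penalty; nra.
- exact: (finite_measure_integrable_cst P _ measurableT).
Qed.

Lemma admissible_step c i : adm (fun m => m = i) (fun w => step_fun c (X i w)).
Proof.
apply: (@admissible_dom _ _ _ _ _ P X mX _ (fun=> 1)).
- by apply: (@locfun_site _ _ _ _ _ X (fun m => m = i) i) => //;
    exact: measurable_step_fun.
- by move=> w; exact: step_fun01.
- exact: (finite_measure_integrable_cst P _ measurableT).
Qed.

Lemma Ex_step c i : E (fun w => step_fun c (X i w)) = fine (P [set w | c <= X 1%N w]).
Proof.
rewrite (@Ex_ident (step_fun c) i 1%N (measurable_step_fun c)); last first.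
  by move=> x; case/andP: (step_fun01 c x).
rewrite /Ex /Rintegral; congr fine.
have -> : (fun w => ((step_fun c \o X 1%N) w)%:E) =
    (fun w => (\1_[set w | c <= X 1%N w] w)%:E).
  by apply/funext => w; rewrite /= /step_fun indicE mem_setE.
rewrite integral_indic ?setIT//.
rewrite -[X in measurable X]setTI.
have -> : [set w | c <= X 1%N w] = X 1%N @^-1` `[c, +oo[%classic.
  by apply/seteqP; split => x /=; rewrite in_itv/= andbT.
exact: mX.
Qed.

(** On the event [c <= X 1] the weight is at least [beta * c]: the tilt makes heavy charges that
    much more frequent. *)
Lemma heavy_ge c : 0 <= beta -> 0 <= c ->
  beta * c * fine (P [set w | c <= X 1%N w]) <= heavy c.
Proof.
move=> b0 c0; have bc0 : 0 <= beta * c by rewrite mulr_ge0.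
have a1 := admissibleZ bc0 (admissible_step c 1).
have a2 := @admissible_site _ _ _ P X (fun m => m = 1%N) _ 1%N (weight_step (fun=> c)) erefl.
rewrite -(Ex_step c 1) -(ExZ _ (admissible_step c 1)) -(mean_step c 1).
apply: (le_Ex a1 a2) => w /=; rewrite /step_fun /site_weight.
case: (lerP c (X 1%N w)) => cX; last by rewrite mulr0 mul0r.
rewrite mulr1 mul1r; apply: le_trans (ler_norm _).
have : beta * c <= beta * X 1%N w by rewrite ler_wpM2l.
lra.
Qed.

(** Union bound over the pairs of sites, whose two charges are independent. *)
Lemma Ex_inv_penalty t s e :
  E (inv_penalty t s e) <= 1 + eta `^ (- t) *
  \sum_(s <= i < e) \sum_(i.+1 <= j < e)
     fine (P [set w | A <= X 1%N w]) * fine (P [set w | thr (j - i) <= X 1%N w]).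
Proof.
have p0 := powR_ge0 eta (- t).
have apair i j : (i < j)%N -> adm [set: nat] (big_pair i j) /\
    E (big_pair i j) = fine (P [set w | A <= X 1%N w]) *
      fine (P [set w | thr (j - i) <= X 1%N w]).
  move=> ij.
  have disj k : k = i -> k = j -> False by move=> -> h; move: ij; rewrite h ltnn.
  split; last by rewrite (ExM mX indX disj (admissible_step _ _) (admissible_step _ _)) !Ex_step.
  by apply: (admissibleM mX indX disj _ _ (admissible_step _ _) (admissible_step _ _)).
have arow i : adm [set: nat] (fun w => \sum_(i.+1 <= j < e) big_pair i j w).
  rewrite [X in admissible _ _ _ X](_ : _ =
    fun w => \sum_(i.+1 <= j < e | (i < j)%N) big_pair i j w); last first.
    by apply/funext => w; rewrite big_nat_cond [RHS]big_nat_cond;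
      apply: eq_bigl => j; case: (i < j)%N.
  by apply: admissible_sum => j ij; have [] := apair i j ij.
have aall : adm [set: nat] (fun w => \sum_(s <= i < e) \sum_(i.+1 <= j < e) big_pair i j w).
  by apply: admissible_sum.
have aZ := admissibleZ p0 aall.
have a1 : adm [set: nat] (fun=> 1 : R) by exact: admissible_cst.
have le1 : E (inv_penalty t s e) <= E (fun w => 1 + eta `^ (- t) *
    \sum_(s <= i < e) \sum_(i.+1 <= j < e) big_pair i j w).
  have ai : adm [set: nat] (inv_penalty t s e).
    by have := admissible_inv_penalty t s e; exact: admissible_sub.
  apply: (le_Ex ai (admissibleD a1 aZ)).
  - move=> w; rewrite /inv_penalty lerD2l ler_wpM2l//.
    have h i : 1 - \prod_(i.+1 <= j < e) (1 - big_pair i j w) <=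
        \sum_(i.+1 <= j < e) big_pair i j w.
      by apply: prodr_union_bound => j _; exact: big_pair01.
    have := @prodr_union_bound R nat (index_iota s e) xpredT
      (fun i => 1 - \prod_(i.+1 <= j < e) (1 - big_pair i j w)).
    under eq_bigr do rewrite subKr; move=> hh.
    apply: (le_trans (hh _)); last by apply: ler_sum => i _; exact: h.
    move=> i _; rewrite subr_ge0 lerBlDr lerDl; apply/andP; split.
      by apply: prodr_ile1 => j _; have := big_pair01 i j w; lra.
    by apply: prodr_ge0 => j _; have := big_pair01 i j w; lra.
apply: (le_trans le1); rewrite (ExD a1 aZ) Ex_cst (ExZ _ aall) lerD2l ler_wpM2l//.
rewrite (Ex_sum _ (fun i _ => arow i)); apply: ler_sum => i _.
rewrite le_eqVlt; apply/orP; left; apply/eqP.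
rewrite [X in E X](_ : _ =
    fun w => \sum_(i.+1 <= j < e | (i < j)%N) big_pair i j w); last first.
  by apply/funext => w; rewrite big_nat_cond [RHS]big_nat_cond;
    apply: eq_bigl => j; case: (i < j)%N.
rewrite (Ex_sum _ (fun j ij => (apair i j ij).1)).
rewrite [RHS]big_nat_cond [LHS]big_nat_cond; apply: eq_big => j.
  by case: (i < j)%N.
by move=> /andP[_ ij]; rewrite (apair i j ij).2.
Qed.

Local Notation psum k e q n w := (path_sum K k e q (fun m => site_weight (X m w)) n).

Lemma admissible_chunk k s e q n : (s <= n < e)%N -> (forall m, 0 <= q m) ->
  adm (chunk_sites s e) (fun w =>
    penalty s e w * (site_weight (X n w) * psum k e q n w)).
Proof.
move=> sn q0.
have a1 := (random_path_sum mX indX K_0 K_ge0 k e n weight_site q0).1.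
have a2 := @admissible_site _ _ _ P X (fun m => m = n) _ n weight_site erefl.
have disj i : i = n -> between n e i -> False.
  by rewrite /between /= => ->; rewrite ltnn.
apply: (@admissible_bdd _ _ _ _ _ P X mX _ _ _ 1).
- apply: (admissibleM mX indX disj _ _ a2 a1).
  + by move=> i /= ->.
  + by move=> i; rewrite /between /chunk_sites /=; clear -sn; lia.
- exact: locfun_penalty.
- by move=> w; rewrite ltW ?penalty_gt0// penalty_le1.
Qed.

(** In a good chunk, once a charge at [m] exceeds [A], every later charge lies below the threshold
    of its distance to [m]. Truncating the later weights at these thresholds then changes nothing,
    and [phase_sum_eq] applies. *)
Lemma no_pair_phase k s e q n w : (s <= n)%N -> (forall m, 0 <= q m) ->
  no_pair s e w * psum k e q n w <=
  phase_sum K k e q (fun m => (1 - step_fun A (X m w)) * site_weight (X m w))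
    (fun m => step_fun A (X m w) * site_weight (X m w))
    (fun i m => (1 - step_fun (thr (m - i)) (X m w)) * site_weight (X m w)) n.
Proof.
move=> sn q0.
have st0 c x : 0 <= step_fun c x * site_weight x.
  by rewrite mulr_ge0 ?normr_ge0//; case/andP: (step_fun01 c x).
have cst0 c x : 0 <= (1 - step_fun c x) * site_weight x.
  by rewrite mulr_ge0 ?normr_ge0// subr_ge0; case/andP: (step_fun01 c x).
case: (no_pairP s e w) => [->|[-> np]].
  by rewrite mul0r phase_sum_ge0.
rewrite mul1r.
rewrite (@phase_sum_eq R K K_0 k e q (fun m => site_weight (X m w))
  (fun m => (1 - step_fun A (X m w)) * site_weight (X m w))
  (fun m => step_fun A (X m w) * site_weight (X m w))
  (fun i m => (1 - step_fun (thr (m - i)) (X m w)) * site_weight (X m w)) n)//.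
  by move=> m _; ring.
move=> m m' nm mm'.
have sm : (s <= m)%N by rewrite (leq_trans sn)// ltnW.
have /eqP := np m m' sm mm'; rewrite /big_pair mulf_eq0 => /orP[/eqP ->|/eqP ->].
  by left; rewrite mul0r.
by right; rewrite subr0 mul1r.
Qed.

(** * Expectation of a penalised piece of trajectory *)

Section chunk_estimate.
Variables (al c2 : R) (s e n L j0 : nat) (q : nat -> R) (Cq c1 : R).
Hypotheses (al01 : 0 < al < 1) (tail_ge0 : forall n, 0 <= tail K n).
Hypothesis (tail_up : forall n, (0 < n)%N -> tail K n <= c2 * n%:R `^ (- al)).
Hypotheses (q_ge0 : forall m, 0 <= q m) (Cq_ge0 : 0 <= Cq) (c1_ge0 : 0 <= c1).
Hypothesis (q_tail : forall m, (n <= m < e)%N -> q m <= Cq * tail K (e - m)).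
Hypothesis (q_window : forall m, (n <= m < n + L.*2)%N ->
  q m <= c1 * tail K L.*2).
Hypotheses (sn : (s <= n)%N) (window : (n + L.*2 <= e)%N) (j0L : (j0 < L)%N).
Hypothesis (Kj0 : 1 / 2 <= \sum_(j < j0.+1) K j).

(** The penalty is dropped and the weights have mean one. This serves for the last piece, where no
    gain is required. *)
Lemma chunk_le_cst k :
  E (fun w => penalty s e w * (site_weight (X n w) * psum k e q n w)) <= Cq.
Proof.
have sne : (s <= n < e)%N by rewrite sn /=; clear -window j0L; lia.
have nne : (n <= n < e)%N by rewrite leqnn; case/andP: sne.
have a0 := admissible_chunk k sne q_ge0.
have [a1 E1] := random_path_sum mX indX K_0 K_ge0 k e n weight_site q_ge0.
have a2 := @admissible_site _ _ _ P X (fun m => m = n) _ n weight_site erefl.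
have disj i : i = n -> between n e i -> False.
  by rewrite /between /= => ->; rewrite ltnn.
have a3 : adm (chunk_sites s e) (fun w => site_weight (X n w) * psum k e q n w).
  apply: (admissibleM mX indX disj _ _ a2 a1); first by move=> i /= ->.
  by move=> i; rewrite /between /chunk_sites /=; clear -sne; lia.
apply: (@le_trans _ _ (E (fun w => site_weight (X n w) * psum k e q n w))).
  apply: (le_Ex a0 a3) => w; rewrite ler_piMl ?penalty_le1//.
  by case: a3.
rewrite (ExM mX indX disj a2 a1) mean_site mul1r E1.
apply: (path_sum_le_cst K_ge0 Cq_ge0 q_tail k _ nne) => //.
by move=> m; rewrite mean_site ler01 lexx.
Qed.

Variables (ka0 ka1 : R) (n0 : nat).
Hypotheses (n00 : (0 < n0)%N) (ka0P : 0 < ka0 <= al / 2) (ka1P : 0 < ka1 <= al / 2).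
Hypothesis (hp : escape_cst al c2 * ka0 * n0%:R `^ (- al) <= heavy A).
Hypothesis (hr1 : forall n j, (0 < j <= j0)%N ->
  escape_cst al c2 * ka1 * (n + 1)%:R `^ (- al) <= heavy (thr (n + j))).

(** Bound the penalty by [eta + no_pair]. The part with [eta] costs [eta * Cq]; the other is a phase
    sum whose expectation is the deterministic one, killed at rate [heavy A] in the first phase and
    [heavy (thr k)] at distance [k] in the second. *)
Lemma chunk_le_barrier k :
  E (fun w => penalty s e w * (site_weight (X n w) * psum k e q n w)) <=
  eta * Cq + (c1 + Cq * (barrier n0 (L - j0) ka0 0 + barrier 1 (L - j0) ka1 0)).
Proof.
have sne : (s <= n < e)%N by rewrite sn /=; clear -window j0L; lia.
have nne : (n <= n < e)%N by rewrite leqnn; case/andP: sne.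
have eta0 : 0 <= eta by case/andP: eta01 => /ltW.
have a0 := admissible_chunk k sne q_ge0.
have [a1 E1] := random_path_sum mX indX K_0 K_ge0 k e n weight_site q_ge0.
have [a4 E4] := random_phase_sum mX indX K_0 K_ge0 k e n
  (weight_costep (fun=> A)) (weight_step (fun=> A))
  (fun i => weight_costep (fun m => thr (m - i))) q_ge0.
have a2 := @admissible_site _ _ _ P X (fun m => m = n) _ n weight_site erefl.
have disj i : i = n -> between n e i -> False.
  by rewrite /between /= => ->; rewrite ltnn.
have s1 i : i = n -> chunk_sites s e i by move=> ->.
have s2 : between n e `<=` chunk_sites s e.
  by move=> i; rewrite /between /chunk_sites /=; clear -sne; lia.
have a5 := admissibleD (admissibleZ eta0 a1) a4.
have a3 := admissibleM mX indX disj s1 s2 a2 a5.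
apply: (le_trans (le_Ex a0 a3 _)).
  move=> w; rewrite mulrCA ler_wpM2l ?normr_ge0//.
  apply: (le_trans (ler_wpM2r _ (penalty_le s e w))).
    by apply: path_sum_ge0 => // m; exact: normr_ge0.
  by rewrite mulrDl lerD2l; exact: no_pair_phase.
rewrite (ExM mX indX disj a2 a5) mean_site mul1r.
rewrite (ExD (admissibleZ eta0 a1) a4) (ExZ _ a1) E1 E4; apply: lerD.
  rewrite ler_wpM2l//; apply: (path_sum_le_cst K_ge0 Cq_ge0 q_tail k _ nne) => //.
  by move=> m; rewrite mean_site ler01 lexx.
have -> : (fun m => E ((fun x => (1 - step_fun A x) * site_weight x) \o X m)) =
    fun=> 1 - heavy A by apply/funext => m; exact: mean_costep.
have -> : (fun m => E ((fun x => step_fun A x * site_weight x) \o X m)) =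
    fun=> heavy A by apply/funext => m; exact: mean_step.
have -> : (fun i m => E ((fun x => (1 - step_fun (thr (m - i)) x) * site_weight x)
     \o X m)) = (fun i m => 1 - heavy (thr (m - i))).
  by apply/funext => i; apply/funext => m; exact: mean_costep.
have -> : c1 = window_cst n L c1 n.
  by rewrite /window_cst ifT//; clear -j0L; lia.
have -> : barrier n0 (L - j0) ka0 0 = barrier n0 (L - j0) ka0 (n - n) by rewrite subnn.
exact: (phase_sum_le_barrier K_0 K_ge0 al01 tail_ge0 tail_up Cq_ge0 c1_ge0
  q_tail q_window window j0L (heavy01 A) (fun k => heavy01 (thr k)) Kj0 n00
  ka0P ka1P hp hr1 k nne).
Qed.

End chunk_estimate.

End chunk.

(** * Coarse graining and fractional moments *)

Section powR_subadditive.
Context {R : realType}.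

Lemma powRD_le (x y t : R) : 0 <= x -> 0 <= y -> 0 < t < 1 ->
  (x + y) `^ t <= x `^ t + y `^ t.
Proof.
move=> x0 y0 /andP[t0 t1].
have [->|xn] := eqVneq x 0; first by rewrite add0r powR0 ?add0r// gt_eqF.
have [->|yn] := eqVneq y 0; first by rewrite addr0 powR0 ?addr0// gt_eqF.
have xp : 0 < x by rewrite lt_neqAle eq_sym xn.
have yp : 0 < y by rewrite lt_neqAle eq_sym yn.
have sp : 0 < x + y by rewrite addr_gt0.
have h u : 0 < u -> u <= x + y -> u / (x + y) * (x + y) `^ t <= u `^ t.
  move=> u0 us; have : u / (x + y) <= (u / (x + y)) `^ t.
    by apply: ger1_powR; rewrite ?divr_gt0 ?ler_pdivrMr ?mul1r//= ltW.
  rewrite powRM ?invr_ge0 ?(ltW u0) ?(ltW sp)// powR_inv ?(ltW sp)//.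
  by move=> hh; rewrite -ler_pdivlMr ?powR_gt0.
have h1 : x <= x + y by rewrite lerDl.
have h2 : y <= x + y by rewrite lerDr.
have := lerD (h x xp h1) (h y yp h2).
by rewrite -mulrDl -mulrDl divff ?gt_eqF// mul1r.
Qed.

Lemma powR_sum_le (J : Type) (s : seq J) (f : J -> R) t : (forall i, 0 <= f i) ->
  0 < t < 1 -> (\sum_(i <- s) f i) `^ t <= \sum_(i <- s) f i `^ t.
Proof.
move=> f0 t01; elim: s => [|i s IH].
  by rewrite !big_nil powR0// gt_eqF//; case/andP: t01.
rewrite !big_cons; apply: (le_trans (powRD_le _ _ t01)) => //.
  exact: sumr_ge0.
by rewrite lerD2l.
Qed.

End powR_subadditive.

Section more_path_sums.
Context {R : realType} (K : nat -> R).
Hypotheses (K_0 : K 0%N = 0) (K_ge0 : forall n, 0 <= K n).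

Lemma path_sum_linear (J : Type) (r : seq J) k e q (c : J -> R) (Q : J -> nat -> R) z n :
  path_sum K k e (fun m => q m + \sum_(i <- r) c i * Q i m) z n =
  path_sum K k e q z n + \sum_(i <- r) c i * path_sum K k e (Q i) z n.
Proof.
elim: k n => [|k IH] n /=; first by rewrite big1 ?addr0// => i _; rewrite mulr0.
have -> : \sum_(i <- r) c i * (Q i n + \sum_(j < e - n)
     K j * (z (n + j)%N * path_sum K k e (Q i) z (n + j))) =
   \sum_(i <- r) c i * Q i n + \sum_(j < e - n) K j * (z (n + j)%N *
     \sum_(i <- r) c i * path_sum K k e (Q i) z (n + j)).
  under [X in _ = _ + X]eq_bigr do rewrite !mulr_sumr.
  rewrite [X in _ = _ + X]exchange_big -big_split /=; apply: eq_bigr => i _.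
  rewrite mulrDr mulr_sumr; congr (_ + _); apply: eq_bigr => j _; ring.
rewrite addrACA; congr (_ + _); rewrite -big_split; apply: eq_bigr => j _ /=.
by rewrite IH; ring.
Qed.

Lemma path_sum_eq0 k e q z n : (forall m, (n <= m)%N -> q m = 0) ->
  path_sum K k e q z n = 0.
Proof.
elim: k n => [|k IH] n qn //=; rewrite qn// add0r big1// => j _.
by rewrite IH ?mulr0// => m nm; apply: qn; rewrite (leq_trans _ nm)// leq_addr.
Qed.

Lemma path_sum_mono k e e' q z n : (e <= e')%N -> (forall m, 0 <= q m) ->
  (forall m, 0 <= z m) -> path_sum K k e q z n <= path_sum K k e' q z n.
Proof.
move=> ee' q0 z0; elim: k n => [|k IH] n //=; rewrite lerD2l.
have h : (e - n <= e' - n)%N by rewrite leq_sub2r.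
rewrite -(big_mkord xpredT (fun j => K j * (z (n + j)%N * path_sum K k e' q z (n + j)))).
rewrite (big_cat_nat (leq0n _) h) /= -[leLHS]addr0; apply: lerD.
  by rewrite big_mkord; apply: ler_sum => j _; rewrite ler_wpM2l// ler_wpM2l.
by apply: sumr_ge0 => j _; rewrite !mulr_ge0// path_sum_ge0.
Qed.

End more_path_sums.

Lemma sum_blocks {R : realType} (F : nat -> R) l i B :
  \sum_(i' <- iota i B) \sum_(i' * l <= m < i'.+1 * l) F m =
  \sum_(i * l <= m < (i + B) * l) F m.
Proof.
elim: B i => [|B IH] i; first by rewrite big_nil addn0 big_geq.
rewrite big_cons IH addSnnS.
have h1 : (i * l <= i.+1 * l)%N by rewrite leq_mul2r leqnSn orbT.
have h2 : (i.+1 * l <= (i + B.+1) * l)%N by rewrite leq_mul2r -addSnnS leq_addr orbT.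
by rewrite [RHS](big_cat_nat h1 h2).
Qed.

(* The lists of blocks visited after block [i], at most [r - 1] of them; the next
   block is never adjacent because the chunk of [i] also covers block [i + 1]. *)
Fixpoint coarse_paths (r B i : nat) : seq (seq nat) :=
  if r is r'.+1 then
    [::] :: flatten [seq [seq i' :: J | J <- coarse_paths r' B i'] | i' <- iota i.+2 B]
  else [::].

Definition gaps (i : nat) (J : seq nat) : bool := path (fun a b => (a.+2 <= b)%N) i J.

Lemma sum_coarse_paths {R : realType} (F : seq nat -> R) r B i :
  \sum_(J <- coarse_paths r.+1 B i) F J = F [::] +
  \sum_(i' <- iota i.+2 B) \sum_(J <- coarse_paths r B i') F (i' :: J).
Proof.
rewrite /= big_cons big_flatten big_map; congr (_ + _).
by apply: eq_bigr => i' _; rewrite big_map.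
Qed.

Lemma coarse_paths_gaps r B i J : J \in coarse_paths r B i -> gaps i J.
Proof.
elim: r i J => [//|r IH] i J /=; rewrite inE => /orP[/eqP->//|].
case/flattenP => s /mapP[i' i'B ->] /mapP[J' J'r ->].
by have := IH _ _ J'r; rewrite /gaps /= => ->; move: i'B;
  rewrite mem_iota andbT => /andP[].
Qed.

Section coarse_graining.
Context {d : measure_display} {W : measurableType d} {R : realType}.
Variables (P : probability W R) (X : nat -> W -> R) (K : nat -> R).
Hypotheses (iidX : iid P X) (K_0 : K 0%N = 0) (K_ge0 : forall n, 0 <= K n).
Variables (beta A : R) (thr : nat -> R) (eta t : R).
Hypothesis weight1 : P.-integrable setT (EFin \o (site_weight beta \o X 1%N)).
Hypotheses (eta01 : 0 < eta < 1) (t01 : 0 < t < 1).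
Variables (l N k : nat) (c : R).
Hypotheses (l0 : (0 < l)%N) (c1 : 1 <= c).

Local Notation adm := (admissible P X).
Local Notation E := (Ex P).
Local Notation wgt := (fun w m => site_weight beta (X m w)).
Let mX : forall n, measurable_fun setT (X n). Proof. by case: iidX. Qed.
Let indX : mutually_independent P X. Proof. by case: iidX. Qed.

Definition chunk_end (i : nat) : nat := (i.+2 * l)%N.
Definition last_point (m : nat) : R := (m == N)%:R.
(** Bounds the product of all factors [c] in one chunk, which has [2 * l] sites. For [c = expR h0]
    with [h0 * l <= 1] it is at most [expR 3]. *)
Definition chunk_cst : R := c ^+ (l.*2.+1).

Local Notation psum i q n w := (path_sum K k (chunk_end i) q (wgt w) n).

(** Weight of the trajectories from [n] that follow the blocks of [J]. A piece carries the charge of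
    its first point and ends at some [f] in its chunk; the jump [K (m - f)] to the entry point [m]
    of the next block acts as its terminal weight. *)
Fixpoint coarse_weight (J : seq nat) (i n : nat) (w : W) : R :=
  chunk_cst * (wgt w n *
  if J is i' :: J' then
    \sum_(i' * l <= m < i'.+1 * l)
      psum i (fun f => K (m - f)) n w * coarse_weight J' i' m w
  else psum i last_point n w).

Lemma wgt_ge0 w m : 0 <= wgt w m.
Proof. exact: normr_ge0. Qed.

Lemma last_point_ge0 m : 0 <= last_point m.
Proof. by rewrite /last_point; case: eqP. Qed.

Lemma chunk_cst_ge0 : 0 <= chunk_cst.
Proof. by rewrite exprn_ge0// (le_trans ler01). Qed.

Lemma coarse_weight_ge0 J i n w : 0 <= coarse_weight J i n w.
Proof.
elim: J i n => [|i' J IH] i n /=.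
  rewrite !mulr_ge0 ?chunk_cst_ge0 ?wgt_ge0//.
  by apply: path_sum_ge0 => // m; exact: wgt_ge0.
rewrite !mulr_ge0 ?chunk_cst_ge0 ?wgt_ge0// sumr_ge0// => m _.
by rewrite mulr_ge0// path_sum_ge0// => j; exact: wgt_ge0.
Qed.

Lemma scale_chunk i n w q : (i * l <= n)%N -> (forall m, 0 <= q m) ->
  c * wgt w n * path_sum K k (chunk_end i) q (fun m => c * wgt w m) n <=
  chunk_cst * (wgt w n * psum i q n w).
Proof.
move=> il q0; have c0 : 0 <= c by rewrite (le_trans ler01).
have h := path_sum_scale K_0 K_ge0 k (chunk_end i) n q0 (wgt_ge0 w) c1.
have w0 := wgt_ge0 w n.
apply: (le_trans (ler_wpM2l (mulr_ge0 c0 w0) h)).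
rewrite [leLHS](_ : _ = c ^+ (chunk_end i - n).+1 * (wgt w n * psum i q n w)); last first.
  by rewrite exprS; ring.
rewrite ler_wpM2r//; first by rewrite mulr_ge0// path_sum_ge0//; exact: wgt_ge0.
by rewrite /chunk_cst ler_weXn2l// ltnS /chunk_end; clear -il; nia.
Qed.

Lemma coarse_bound r B i n w : (i * l <= n < i.+1 * l)%N -> (N < (i + r) * l)%N ->
  (N < B * l)%N ->
  c * wgt w n * path_sum K k N.+1 last_point (fun m => c * wgt w m) n <=
  \sum_(J <- coarse_paths r B i) coarse_weight J i n w.
Proof.
move=> + + NB; have c0 : 0 <= c by rewrite (le_trans ler01).
have z0 m : 0 <= c * wgt w m by rewrite mulr_ge0// wgt_ge0.
elim: r i n => [|r IH] i n il Nr.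
  rewrite path_sum_eq0 ?mulr0 ?big_nil// => m nm.
  by rewrite /last_point; case: eqP => // mN; clear -il Nr nm mN; nia.
rewrite sum_coarse_paths.
have il' : (i * l <= n)%N by case/andP: il.
have head := @scale_chunk i n w last_point il' last_point_ge0.
have rest0 : 0 <= \sum_(i' <- iota i.+2 B) \sum_(J <- coarse_paths r B i')
    coarse_weight (i' :: J) i n w.
  by apply: sumr_ge0 => i' _; apply: sumr_ge0 => J _; exact: coarse_weight_ge0.
(* When the chunk extends past [N] no cut occurs, and the empty list of blocks already dominates. *)
have [Ne|eN] := ltnP N.+1 (chunk_end i).
  rewrite -[leLHS]addr0; apply: lerD rest0; apply: le_trans head.
  by rewrite ler_wpM2l//; apply: path_sum_mono => //; exact: ltnW.
have ne : (n < chunk_end i)%N by rewrite /chunk_end; clear -il l0; nia.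
have := path_sum_cut K_ge0 eN ne last_point_ge0 z0 (leqnn k).
move/(ler_wpM2l (z0 n)) => /le_trans; apply.
have -> : (fun m => last_point m + \sum_(chunk_end i <= m0 < N.+1) K (m0 - m) *
     (c * wgt w m0 * path_sum K k N.+1 last_point (fun m1 => c * wgt w m1) m0)) =
  (fun m => last_point m + \sum_(chunk_end i <= m0 < N.+1)
     (c * wgt w m0 * path_sum K k N.+1 last_point (fun m1 => c * wgt w m1) m0) *
     K (m0 - m)).
  apply/funext => m; congr (_ + _); apply: eq_bigr => m0 _; exact: mulrC.
rewrite path_sum_linear mulrDr; apply: lerD => //.
pose F m := (c * wgt w m * path_sum K k N.+1 last_point (fun m1 => c * wgt w m1) m) *
  (c * wgt w n * path_sum K k (chunk_end i) (fun f => K (m - f)) (fun m1 => c * wgt w m1) n).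
have F0 m : 0 <= F m.
  by rewrite /F !mulr_ge0 ?wgt_ge0// path_sum_ge0//; exact: last_point_ge0.
rewrite mulr_sumr (eq_bigr F); last by move=> m _; rewrite /F; ring.
have eB : (N.+1 <= (i.+2 + B) * l)%N by clear -NB; nia.
apply: (@le_trans _ _ (\sum_(chunk_end i <= m < (i.+2 + B) * l) F m)).
  rewrite [leRHS](big_cat_nat eN eB) /= lerDl; exact: sumr_ge0.
rewrite -sum_blocks big_seq [leRHS]big_seq; apply: ler_sum => i'.
rewrite mem_iota => /andP[ii' _].
have Fle m : (i' * l <= m < i'.+1 * l)%N -> F m <=
    chunk_cst * (wgt w n * (psum i (fun f => K (m - f)) n w *
      \sum_(J <- coarse_paths r B i') coarse_weight J i' m w)).
  move=> mi'; have Nr' : (N < (i' + r) * l)%N by clear -Nr ii'; nia.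
  have h1 := IH i' m mi' Nr'.
  have h2 := @scale_chunk i n w (fun f => K (m - f)%N) il' (fun f => K_ge0 _).
  have p1 : 0 <= c * wgt w n * path_sum K k (chunk_end i) (fun f => K (m - f))
      (fun m1 => c * wgt w m1) n.
    by rewrite mulr_ge0// path_sum_ge0.
  apply: (le_trans (ler_wpM2r p1 h1)).
  have s0 : 0 <= \sum_(J <- coarse_paths r B i') coarse_weight J i' m w.
    by apply: sumr_ge0 => J _; exact: coarse_weight_ge0.
  apply: (le_trans (ler_wpM2l s0 h2)).
  by rewrite le_eqVlt; apply/orP; left; apply/eqP; ring.
apply: (le_trans (ler_sum_nat Fle)).
rewrite le_eqVlt; apply/orP; left; apply/eqP => /=.
rewrite -!mulr_sumr; congr (_ * (_ * _)); rewrite exchange_big /=.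
by apply: eq_bigr => m _; rewrite mulr_sumr.
Qed.

Definition chunk_penalty (i : nat) : W -> R :=
  penalty X A thr eta (i * l) (chunk_end i).

Definition chunk_inv (i : nat) : W -> R :=
  inv_penalty X A thr eta (t / (1 - t)) (i * l) (chunk_end i).

Fixpoint coarse_penalty (J : seq nat) (i : nat) (w : W) : R :=
  chunk_penalty i w * if J is i' :: J' then coarse_penalty J' i' w else 1.

Fixpoint coarse_inv (J : seq nat) (i : nat) (w : W) : R :=
  chunk_inv i w * if J is i' :: J' then coarse_inv J' i' w else 1.

Lemma coarse_penalty_gt0 J i w : 0 < coarse_penalty J i w.
Proof. by elim: J i => [|i' J IH] i /=; rewrite ?mulr1 ?mulr_gt0// penalty_gt0. Qed.

Lemma coarse_inv_ge J i w : coarse_penalty J i w `^ (- (t / (1 - t))) <= coarse_inv J i w.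
Proof.
have h j : chunk_penalty j w `^ (- (t / (1 - t))) <= chunk_inv j w.
  exact: inv_penalty_ge.
elim: J i => [|i' J IH] i /=; first by rewrite !mulr1.
rewrite powRM; [|by rewrite ltW// penalty_gt0|by rewrite ltW// coarse_penalty_gt0].
by apply: ler_pM; rewrite ?powR_ge0.
Qed.

Variables (gap_weight : nat -> R) (a0 : R).
Hypotheses (gap_weight_gt0 : forall g, (2 <= g)%N -> 0 < gap_weight g) (a0_gt0 : 0 < a0).
Hypothesis chunk_jump : forall i i' n, (i * l <= n < i.+1 * l)%N -> (i.+2 <= i')%N ->
  chunk_cst * E (fun w => chunk_penalty i w *
    (wgt w n * psum i (fun f => \sum_(i' * l <= m < i'.+1 * l) K (m - f)) n w)) <=
  gap_weight (i' - i).
Hypothesis chunk_last : forall i n, (i * l <= n < i.+1 * l)%N ->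
  chunk_cst * E (fun w => chunk_penalty i w * (wgt w n * psum i last_point n w)) <= a0.
Hypothesis chunk_invE : forall i, E (chunk_inv i) <= 2.

(** Bounds the penalised expectation of [coarse_weight], and is also the balancing weight in the
    AM-GM inequality. *)
Fixpoint coarse_cst (J : seq nat) (i : nat) : R :=
  if J is i' :: J' then gap_weight (i' - i) * coarse_cst J' i' else a0.

Definition from (n : nat) : set nat := [set m | (n <= m)%N].

Lemma block_chunk i n : (i * l <= n < i.+1 * l)%N -> (i * l <= n < chunk_end i)%N.
Proof. by rewrite /chunk_end; clear -l0; nia. Qed.

Lemma chunk_from i : chunk_sites (i * l) (chunk_end i) `<=` from (i * l).
Proof. by move=> m; rewrite /chunk_sites /from /= => /andP[]. Qed.

Lemma chunk_from_disj i i' m : (i.+2 <= i')%N ->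
  chunk_sites (i * l) (chunk_end i) m -> from (i' * l) m -> False.
Proof. by rewrite /chunk_sites /from /chunk_end /= => ii' /andP[_ +] +; clear -ii'; nia. Qed.

Lemma from_sub i i' : (i.+2 <= i')%N -> from (i' * l) `<=` from (i * l).
Proof. by move=> ii' m; rewrite /from /=; clear -ii'; nia. Qed.

Lemma coarse_cst_gt0 J i : gaps i J -> 0 < coarse_cst J i.
Proof.
elim: J i => [//|i' J IH] i; rewrite /gaps /= => /andP[g1 g2].
by rewrite mulr_gt0 ?IH// gap_weight_gt0//; clear -g1; lia.
Qed.

(** Consecutive blocks of [J] are at distance at least two, so their chunks are disjoint and the
    expectation factorises along [J]. *)
Lemma coarse_expectation J i n : gaps i J -> (i * l <= n < i.+1 * l)%N ->
  adm (from (i * l)) (fun w => coarse_penalty J i w * coarse_weight J i n w) /\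
  E (fun w => coarse_penalty J i w * coarse_weight J i n w) <= coarse_cst J i.
Proof.
elim: J i n => [|i' J IH] i n.
  move=> _ il; have an := admissible_chunk iidX K_0 K_ge0 A thr weight1 eta01 k
    (block_chunk il) last_point_ge0.
  have -> : (fun w => coarse_penalty [::] i w * coarse_weight [::] i n w) =
      (fun w => chunk_cst * (chunk_penalty i w * (wgt w n * psum i last_point n w))).
    by apply/funext => w /=; ring.
  rewrite (ExZ _ an); split; last exact: chunk_last.
  by apply: (admissible_sub (@chunk_from i)); exact: admissibleZ chunk_cst_ge0 an.
rewrite /gaps /= => /andP[ii' gJ] il.
have am m := admissible_chunk iidX K_0 K_ge0 A thr weight1 eta01 k
    (block_chunk il) (fun f => K_ge0 (m - f)).
have disj j : chunk_sites (i * l) (chunk_end i) j -> from (i' * l) j -> False.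
  exact: chunk_from_disj.
pose F m w := chunk_penalty i w * (wgt w n * psum i (fun f => K (m - f)) n w).
pose G m w := coarse_penalty J i' w * coarse_weight J i' m w.
have eqFG : (fun w => coarse_penalty (i' :: J) i w * coarse_weight (i' :: J) i n w) =
    fun w => chunk_cst * \sum_(i' * l <= m < i'.+1 * l | (i' * l <= m < i'.+1 * l)%N)
      F m w * G m w.
  apply/funext => w /=; rewrite -big_nat !mulr_sumr; apply: eq_bigr => m _.
  by rewrite /F /G; ring.
have aFG m : (i' * l <= m < i'.+1 * l)%N -> adm (from (i * l)) (fun w => F m w * G m w).
  move=> mi'; have [aG _] := IH i' m gJ mi'.
  exact: (admissibleM mX indX disj (@chunk_from i) (from_sub ii') (am m) aG).
have aS := @admissible_sum _ _ _ _ _ P X (from (i * l)) nat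
  (index_iota (i' * l) (i'.+1 * l)) _ _ aFG.
rewrite eqFG (ExZ _ aS); split; first exact: admissibleZ chunk_cst_ge0 aS.
rewrite (Ex_sum _ aFG).
have EFG m : (i' * l <= m < i'.+1 * l)%N ->
    E (fun w => F m w * G m w) <= E (F m) * coarse_cst J i'.
  move=> mi'; have [aG EG] := IH i' m gJ mi'.
  rewrite (ExM mX indX disj (am m) aG) ler_wpM2l//.
  by apply: Ex_ge0; case: (am m).
apply: (@le_trans _ _ (chunk_cst * \sum_(i' * l <= m < i'.+1 * l | (i' * l <= m < i'.+1 * l)%N) E (F m) * coarse_cst J i')).
  by rewrite ler_wpM2l ?chunk_cst_ge0//; apply: ler_sum => m /EFG.
rewrite -mulr_suml mulrA /= ler_wpM2r ?(ltW (coarse_cst_gt0 gJ))//.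
(* The bound on the rest of the path does not depend on the entry point [m], so the entry points can
   be summed back into one jump to the whole block. *)
rewrite -big_nat -(Ex_sum _ (fun m _ => am m)).
apply: le_trans (chunk_jump il ii'); rewrite ler_wpM2l ?chunk_cst_ge0//.
rewrite le_eqVlt; apply/orP; left; apply/eqP; congr (Ex P _).
by apply/funext => w; rewrite (path_sum_add K (index_iota _ _) xpredT) !mulr_sumr.
Qed.

Lemma coarse_inv_expectation J i : gaps i J ->
  adm (from (i * l)) (coarse_inv J i) /\ E (coarse_inv J i) <= 2 ^+ (size J).+1.
Proof.
have ai j := admissible_inv_penalty iidX A thr eta (t / (1 - t)) (j * l) (chunk_end j).
elim: J i => [|i' J IH] i.
  move=> _; have -> : coarse_inv [::] i = chunk_inv i.
    by apply/funext => w /=; rewrite mulr1.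
  by rewrite expr1; split => //; apply: (admissible_sub (@chunk_from i)); exact: ai.
rewrite /gaps /= => /andP[ii' gJ]; have [aJ EJ] := IH i' gJ.
have disj j : chunk_sites (i * l) (chunk_end i) j -> from (i' * l) j -> False.
  exact: chunk_from_disj.
split; first exact: (admissibleM mX indX disj (@chunk_from i) (from_sub ii') (ai i) aJ).
rewrite (ExM mX indX disj (ai i) aJ) exprS ler_pM//.
- by apply: Ex_ge0; case: (ai i).
- by apply: Ex_ge0; case: aJ.
- exact: chunk_invE.
Qed.

(** Stands in for the power [t] of [coarse_weight]: as a combination of admissible functions, its
    expectation follows by linearity. *)
Definition coarse_majorant (J : seq nat) (i n : nat) (w : W) : R :=
  t * (coarse_cst J i `^ (t - 1) * (coarse_penalty J i w * coarse_weight J i n w)) +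
  (1 - t) * (coarse_cst J i `^ t * coarse_inv J i w).

(* Weighted AM-GM, with the weight that balances the two expectations. *)
Lemma coarse_majorantP J i n w : gaps i J ->
  coarse_weight J i n w `^ t <= coarse_majorant J i n w.
Proof.
move=> gJ; have a_gt0 := coarse_cst_gt0 gJ.
have [t0 t1] : 0 < t /\ t < 1 by case/andP: t01.
have s0 : 0 < 1 - t by lra.
set a := coarse_cst J i in a_gt0 *; set g := coarse_penalty J i w.
have g0 : 0 < g by exact: coarse_penalty_gt0.
set Z := coarse_weight J i n w; have Z0 : 0 <= Z by exact: coarse_weight_ge0.
(* With this [b], the mean of [b * Z] is at most [a ^ t], and [b ^ (- q)] equals [a ^ t * g ^ (- q)]
   because [(t - 1) * - q = t]: both terms have the same order. *)
pose b := a `^ (t - 1) * g; have b0 : 0 < b by rewrite mulr_gt0 ?powR_gt0.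
pose q := t / (1 - t).
have h := @powR_amgm R (b * Z) (b `^ (- q)) t (mulr_ge0 (ltW b0) Z0) (powR_ge0 _ _) t01.
have e1 : (b * Z) `^ t * (b `^ (- q)) `^ (1 - t) = Z `^ t.
  rewrite powRM ?(ltW b0)// -powRrM.
  rewrite (_ : - q * (1 - t) = - t); last by rewrite /q; field; rewrite gt_eqF.
  by rewrite powRN mulrAC mulfV ?mul1r// gt_eqF// powR_gt0.
rewrite e1 in h; apply: (le_trans h); rewrite /coarse_majorant -/a -/g -/Z.
rewrite (mulrA (a `^ (t - 1))) -/b lerD2l ler_wpM2l ?(ltW s0)//.
rewrite /b powRM ?powR_ge0 ?(ltW g0)// -powRrM.
rewrite (_ : (t - 1) * - q = t); last by rewrite /q; field; rewrite gt_eqF.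
by rewrite ler_wpM2l ?powR_ge0//; exact: coarse_inv_ge.
Qed.

Lemma coarse_majorantE J i n : gaps i J -> (i * l <= n < i.+1 * l)%N ->
  adm (from (i * l)) (coarse_majorant J i n) /\
  E (coarse_majorant J i n) <= 2 ^+ (size J).+1 * coarse_cst J i `^ t.
Proof.
move=> gJ il; have a_gt0 := coarse_cst_gt0 gJ.
have [aZ EZ] := coarse_expectation gJ il.
have [aJ EJ] := coarse_inv_expectation gJ.
have [t0 t1] : 0 < t /\ t < 1 by case/andP: t01.
have s0 : 0 < 1 - t by lra.
set a := coarse_cst J i in a_gt0 EZ *.
have b1 := admissibleZ (powR_ge0 a (t - 1)) aZ.
have b2 := admissibleZ (ltW t0) b1.
have b3 := admissibleZ (powR_ge0 a t) aJ.
have b4 := admissibleZ (ltW s0) b3.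
split; first exact: admissibleD b2 b4.
rewrite /coarse_majorant (ExD b2 b4) (ExZ _ b1) (ExZ _ aZ) (ExZ _ b3) (ExZ _ aJ).
have h1 : a `^ (t - 1) * E (fun w => coarse_penalty J i w * coarse_weight J i n w) <=
    a `^ t.
  apply: (le_trans (ler_wpM2l (powR_ge0 _ _) EZ)).
  rewrite powRD; last by rewrite (gt_eqF a_gt0) implybT.
  by rewrite powR_inv1 ?(ltW a_gt0)// mulfVK// gt_eqF.
have p0 : 0 <= a `^ t by exact: powR_ge0.
have p1 : 1 <= 2 ^+ (size J).+1 :> R by rewrite exprn_ege1// ler1n.
set v := 2 ^+ _ * _.
have h3 : a `^ t <= v by rewrite ler_peMl.
have {}h2 : a `^ t * E (coarse_inv J i) <= v by rewrite /v mulrC ler_wpM2r.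
have := ler_wpM2l (ltW t0) (le_trans h1 h3); have := ler_wpM2l (ltW s0) h2.
rewrite mulrBl mul1r; lra.
Qed.

Hypothesis gap_sum : forall B, \sum_(g < B) 2 * gap_weight g.+2 `^ t <= 1 / 2.

(** Each further block multiplies by [2 * gap_weight ^ t], whose sum over gaps is at most [1 / 2].
    The constant 4 is the fixed point: [2 * a0 ^ t] for the empty list plus half of [4 * a0 ^ t]. *)
Lemma sum_coarse_cst r B i :
  \sum_(J <- coarse_paths r B i) 2 ^+ (size J).+1 * coarse_cst J i `^ t <=
  4 * a0 `^ t.
Proof.
have p0 := powR_ge0 a0 t.
elim: r i => [|r IH] i; first by rewrite big_nil mulr_ge0.
rewrite sum_coarse_paths /= expr1.
have : \sum_(i' <- iota i.+2 B) \sum_(J <- coarse_paths r B i')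
    2 ^+ (size J).+2 * (gap_weight (i' - i) * coarse_cst J i') `^ t <=
    \sum_(i' <- iota i.+2 B) 2 * gap_weight (i' - i) `^ t * (4 * a0 `^ t).
  rewrite big_seq [leRHS]big_seq; apply: ler_sum => i'.
  rewrite mem_iota => /andP[ii' _].
  have g0 : 0 < gap_weight (i' - i) by apply: gap_weight_gt0; clear -ii'; lia.
  apply: le_trans (ler_wpM2l _ (IH i')); last by rewrite mulr_ge0 ?powR_ge0.
  rewrite mulr_sumr big_seq [leRHS]big_seq; apply: ler_sum => J /coarse_paths_gaps gJ.
  rewrite powRM ?(ltW g0) ?(ltW (coarse_cst_gt0 gJ))// exprS.
  by rewrite le_eqVlt; apply/orP; left; apply/eqP; ring.
rewrite -mulr_suml.
have -> : \sum_(i' <- iota i.+2 B) 2 * gap_weight (i' - i) `^ t =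
    \sum_(g < B) 2 * gap_weight g.+2 `^ t.
  rewrite -[i.+2]addn0 iotaDl big_map.
  rewrite (_ : iota 0 B = index_iota 0 B) ?big_mkord; last by rewrite /index_iota subn0.
  by apply: eq_bigr => g _; congr (2 * gap_weight _ `^ _); clear; lia.
have p4 : 0 <= 4 * a0 `^ t by rewrite mulr_ge0.
have := ler_wpM2r p4 (gap_sum B); lra.
Qed.

Lemma fractional_moment : exists F : W -> R,
  [/\ adm [set: nat] F,
      forall w, (c * wgt w 0%N * path_sum K k N.+1 last_point (fun m => c * wgt w m) 0%N) `^ t
        <= F w &
      E F <= 4 * a0 `^ t].
Proof.
pose r := N.+1.
have il : (0 * l <= 0 < 1 * l)%N by rewrite mul1n l0.
have Nr : (N < (0 + r) * l)%N by rewrite /r; clear -l0; nia.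
have NB : (N < r * l)%N by exact: Nr.
(* The gap condition, true of all listed paths, is made a filter of the sum because the majorant is
   only controlled under it. *)
have gs (F : seq nat -> R) : \sum_(J <- coarse_paths r r 0 | gaps 0 J) F J =
    \sum_(J <- coarse_paths r r 0) F J.
  by rewrite big_mkcond; apply: eq_big_seq => J /coarse_paths_gaps ->.
exists (fun w => \sum_(J <- coarse_paths r r 0 | gaps 0 J) coarse_majorant J 0 0 w).
split.
- apply: admissible_sum => J gJ.
  have := (coarse_majorantE gJ il).1; exact: admissible_sub.
- move=> w; have h := coarse_bound w il Nr NB.
  have t0 : 0 <= t by case/andP: t01 => /ltW.
  have c0 : 0 <= c by rewrite (le_trans ler01).
  have z0 m : 0 <= c * wgt w m by rewrite mulr_ge0// wgt_ge0.
  have p0 : 0 <= path_sum K k N.+1 last_point (fun m => c * wgt w m) 0%N.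
    by apply: path_sum_ge0 => // m; exact: last_point_ge0.
  apply: (le_trans (ge0_ler_powR t0 _ _ h)).
  + by rewrite nnegrE mulr_ge0.
  + by rewrite nnegrE sumr_ge0// => J _; exact: coarse_weight_ge0.
  apply: (le_trans (powR_sum_le _ (fun J => coarse_weight_ge0 J 0 0 w) t01)).
  rewrite -gs; apply: ler_sum => J gJ; exact: coarse_majorantP.
- rewrite (Ex_sum _ (fun J gJ => (coarse_majorantE gJ il).1)).
  apply: le_trans (sum_coarse_cst r r 0); rewrite -gs.
  by apply: ler_sum => J gJ; exact: (coarse_majorantE gJ il).2.
Qed.

End coarse_graining.

(** * The partition function as a sum over renewal paths *)

Section renewal_paths.
Context {d : measure_display} {T : measurableType d} {R : realType}.
Variables (Q : probability T R) (tau : nat -> T -> nat).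
Hypothesis tau_renewal : is_renewal Q tau.

Local Notation K := (interarrival_law Q tau).
Local Notation X := (fun n t => (tau n.+1 t - tau n t)%N).

Let tau0 t : tau 0%N t = 0%N. Proof. by case: tau_renewal. Qed.
Let tau_lt n t : (tau n t < tau n.+1 t)%N. Proof. by case: tau_renewal. Qed.
Let mX n : measurable_fun setT (X n). Proof. by case: tau_renewal => _ _ []. Qed.
Let indX : mutually_independent Q X. Proof. by case: tau_renewal => _ _ []. Qed.
Let identX : identically_distributed Q X.
Proof. by case: tau_renewal => _ _ []. Qed.

Let tau1E : tau 1 = X 0%N.
Proof. by apply/funext => t; rewrite tau0 subn0. Qed.

Lemma law_ge0 n : 0 <= K n.
Proof. exact: fine_ge0. Qed.

Lemma law0 : K 0%N = 0.
Proof.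
rewrite /interarrival_law (_ : [set t | tau 1 t = 0%N] = set0) ?measure0//.
by apply/seteqP; split => t //= h; have := tau_lt 0 t; rewrite h.
Qed.

Lemma measurable_increment n (B : set nat) : measurable (X n @^-1` B).
Proof. by rewrite -[X in measurable X]setTI; exact: mX. Qed.

Lemma tail_law n : tail K n = fine (Q [set t | (n <= tau 1 t)%N]).
Proof.
have mB (B : set nat) : measurable (tau 1 @^-1` B).
  by rewrite tau1E; exact: measurable_increment.
elim: n => [|n IH].
  rewrite /tail big_ord0 subr0 (_ : [set t | _] = setT) ?probability_setT//.
  by apply/seteqP; split.
have m1 : measurable [set t | tau 1 t = n] by exact: (mB [set n]).
have m2 : measurable [set t | (n.+1 <= tau 1 t)%N].
  exact: (mB [set m | (n.+1 <= m)%N]).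
have e : [set t | (n <= tau 1 t)%N] =
    [set t | tau 1 t = n] `|` [set t | (n.+1 <= tau 1 t)%N].
  apply/seteqP; split => t /=.
    by rewrite leq_eqVlt => /orP[/eqP ->|]; [left|right].
  by case=> [->//|/ltnW].
have := tailS K n; rewrite IH e measureU//; last first.
  by apply/seteqP; split => t //= -[->]; rewrite ltnn.
rewrite fineD ?fin_num_measure// -/(K n) => /addrI ->.
by [].
Qed.

Lemma tail_law_ge0 n : 0 <= tail K n.
Proof. by rewrite tail_law fine_ge0. Qed.

Section walk.
Variables (N : nat) (z : nat -> R).
Hypothesis z_ge0 : forall n, 0 <= z n.

Let q (m : nat) : R := (m == N)%:R.

(** Pathwise counterpart of [path_sum], with the indicator of increment [i] in place of [K]. The
    position [n] is a parameter rather than [tau i t], so that the function depends on the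
    increments from [i] on only. *)
Fixpoint walk (k i n : nat) (t : T) : R :=
  if k is k'.+1 then
    q n + \sum_(j < N.+1 - n) (X i t == j)%:R * (z (n + j)%N * walk k' i.+1 (n + j)%N t)
  else 0.

Lemma admissible_increment i (j : nat) :
  admissible Q X (fun m => m = i) (fun t => (X i t == j)%:R : R) /\
  Ex Q (fun t => (X i t == j)%:R : R) = K j.
Proof.
have e : (fun t => (X i t == j)%:R : R) = \1_(X i @^-1` [set j]).
  apply/funext => t; rewrite indicE; congr ((nat_of_bool _)%:R).
  by apply/eqP/idP; rewrite inE.
split.
  apply: (@admissible_dom _ _ _ _ _ Q X mX _ (fun=> 1)).
  - apply: (@locfun_site _ _ _ _ _ X (fun m => m = i) i (fun m => (m == j)%:R)) => //.
  - by move=> t; case: eqP => _; rewrite ?lexx ?ler01.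
  - exact: (finite_measure_integrable_cst Q _ measurableT).
rewrite e /Ex /Rintegral integral_indic ?setIT//; last exact: measurable_increment.
rewrite /interarrival_law; congr fine.
have mj : measurable [set j] by [].
apply: (etrans (@identX i 0%N [set j] mj)); congr (Q _).
by apply/seteqP; split => t /=; rewrite tau0 subn0.
Qed.

Lemma walk_expectation k i n :
  admissible Q X [set m | (i <= m)%N] (walk k i n) /\
  Ex Q (walk k i n) = path_sum K k N.+1 q z n.
Proof.
elim: k i n => [|k IH] i n /=.
  by rewrite Ex_cst; split => //; exact: admissible_cst.
have disj m : m = i -> (i.+1 <= m)%N -> False by move=> ->; rewrite ltnn.
have sub1 : (fun m => m = i) `<=` [set m | (i <= m)%N] by move=> m ->; exact: leqnn.
have sub2 : (fun m => is_true (i.+1 <= m)%N) `<=` [set m | (i <= m)%N].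
  by move=> m /ltnW.
have aw (j : 'I_(N.+1 - n)) := admissibleZ (z_ge0 (n + j)) (IH i.+1 (n + j)%N).1.
have at_ (j : 'I_(N.+1 - n)) : admissible Q X [set m | (i <= m)%N]
    (fun t => (X i t == j)%:R * (z (n + j)%N * walk k i.+1 (n + j)%N t)).
  exact: (admissibleM mX indX disj sub1 sub2 (admissible_increment i j).1 (aw j)).
have ac : admissible Q X [set m | (i <= m)%N] (fun=> q n).
  by apply: admissible_cst; rewrite ler0n.
have aS := @admissible_sum _ _ _ _ _ Q X [set m | (i <= m)%N] 'I_(N.+1 - n)
  (index_enum _) xpredT _ (fun j _ => at_ j).
split; first exact: (admissibleD ac aS).
rewrite (ExD ac aS) Ex_cst (Ex_sum _ (fun j _ => at_ j)); congr (_ + _).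
apply: eq_bigr => j _.
rewrite (ExM mX indX disj (admissible_increment i j).1 (aw j)).
by rewrite (admissible_increment i j).2 (ExZ _ (IH _ _).1) (IH _ _).2.
Qed.

Lemma tau_homo i j t : (i < j)%N -> (tau i t < tau j t)%N.
Proof.
move/subnKC <-; elim: (j - i.+1)%N => [|k IH]; first by rewrite addn0.
by rewrite addnS (ltn_trans IH).
Qed.

Lemma renewal_gap i m t : (tau i t < m < tau i.+1 t)%N -> ~ renewal_set tau t m.
Proof.
move=> /andP[im mi] [j _ jm]; move: im mi; rewrite -jm => im mi.
have [ij|ji|ij] := ltngtP i j; last by move: im; rewrite ij ltnn.
- have [h|h|h] := ltngtP i.+1 j.
  + by have := tau_homo t h; rewrite ltnNge ltnW.
  + by rewrite ltnS leqNgt ij in h.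
  + by rewrite h ltnn in mi.
- by have := tau_homo t ji; rewrite ltnNge ltnW.
Qed.

(** Along the trajectory only the summand of the true increment survives, and the sites it jumps
    over carry no renewal point. Increments are positive, so [k] steps pass [N]. *)
Lemma walkE k i t : (tau i t <= N)%N -> (N < tau i t + k)%N ->
  walk k i (tau i t) t =
  (\prod_((tau i t).+1 <= m < N.+1 | m \in renewal_set tau t) z m) *
  \1_(renewal_set tau t) N.
Proof.
elim: k i => [|k IH] i iN Nk; first by rewrite addn0 ltnNge iN in Nk.
rewrite [LHS]/=; set n := tau i t in iN Nk *.
have n'E : tau i.+1 t = (n + X i t)%N by rewrite /= subnKC //; exact/ltnW/tau_lt.
have [n'N|Nn'] := leqP (tau i.+1 t) N.
  have nn' : (n < tau i.+1 t)%N by exact: tau_lt.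
  have jN : (X i t < N.+1 - n)%N by clear -n'E n'N nn'; lia.
  rewrite (bigD1 (Ordinal jN))//= eqxx mul1r -n'E.
  rewrite big1 ?addr0; last first.
    move=> j jX; rewrite (_ : (_ == _) = false) ?mul0r//.
    by apply/negbTE; apply: contra jX => /eqP jX; apply/eqP/val_inj.
  rewrite /q (_ : (n == N) = false) ?add0r; last first.
    by apply/negbTE; rewrite neq_ltn (leq_trans nn' n'N).
  rewrite IH//; last by clear -Nk nn'; lia.
  rewrite mulrA; congr (_ * _).
  rewrite [RHS](@big_cat_nat _ _ _ (tau i.+1 t))//=; last by rewrite ltnW// ltnS.
  rewrite [X in _ = X * _]big_nat_cond [X in _ = X * _]big1 ?mul1r; last first.
    by move=> m /andP[mn /set_mem mR]; have := renewal_gap mn mR.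
  rewrite [RHS]big_ltn_cond ?ltnS// ifT// inE.
  by exists i.+1.
rewrite big1 ?addr0; last first.
  move=> j _; rewrite (_ : (_ == _) = false) ?mul0r//.
  by apply/negbTE; rewrite neq_ltn; apply/orP; right; case: j => j /= jn; clear -jn n'E Nn'; lia.
rewrite /q; case: eqP => [nN|nN].
  rewrite nN big_geq// mul1r indicE mem_set//.
  by exists i.
rewrite indicE memNset ?mulr0//.
by apply: (@renewal_gap i); rewrite Nn' ltn_neqAle iN andbT; apply/andP; split => //; exact/eqP.
Qed.

End walk.

Section partition.
Context {d' : measure_display} {W : measurableType d'}.
Variables (P : probability W R) (omega : nat -> W -> R).

Lemma partition_functionE (beta h : R) N w :
  (forall n, 0 <= 1 + beta * omega n w) ->
  partition_function Q tau omega beta h N w =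
  path_sum K N.+1 N.+1 (fun m => (m == N)%:R)
    (fun m => expR h * (1 + beta * omega m w)) 0.
Proof.
move=> w0; set z := (fun m => expR h * (1 + beta * omega m w)).
have z0 n : 0 <= z n by rewrite mulr_ge0 ?expR_ge0.
rewrite -(walk_expectation N z0 N.+1 0 0).2 /partition_function unlock.
congr fine; apply: eq_integral => t _; congr (_%:E).
have t0 : (tau 0 t <= N)%N by rewrite tau0.
have := @walkE N z N.+1 0 t t0; rewrite tau0 => ->//.
by congr (_ * _); apply: eq_bigr => n _; rewrite /z [beta * _ + 1]addrC.
Qed.

End partition.

End renewal_paths.

(** * From fractional moments to the free energy *)

Lemma path_sum_weight_le {R : realType} (K : nat -> R) k e q z z' n :
  (forall n, 0 <= K n) -> (forall m, 0 <= q m) -> (forall m, 0 <= z m <= z' m) ->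
  path_sum K k e q z n <= path_sum K k e q z' n.
Proof.
move=> K0 q0 zz; elim: k n => [|k IH] n //=; rewrite lerD2l.
apply: ler_sum => j _; rewrite ler_wpM2l//.
case/andP: (zz (n + j)%N) => z0 zz'; rewrite ler_pM ?path_sum_ge0// => m.
by case/andP: (zz m).
Qed.

Section free_energy_bound.
Context {d d' : measure_display} {T : measurableType d} {W : measurableType d'}.
Context {R : realType}.
Variables (Q : probability T R) (tau : nat -> T -> nat).
Variables (P : probability W R) (omega : nat -> W -> R).
Hypothesis tau_renewal : is_renewal Q tau.

Local Notation K := (interarrival_law Q tau).

Lemma measurable_superlevel (F : W -> R) (y : R) : measurable_fun setT F ->
  measurable [set w | y <= F w].
Proof.
move=> mF; rewrite -[X in measurable X]setTI.
have -> : [set w | y <= F w] = F @^-1` `[y, +oo[%classic.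
  by apply/seteqP; split => x /=; rewrite in_itv/= andbT.
exact: mF.
Qed.

Lemma markov_Ex (F : W -> R) (y : R) : measurable_fun setT F ->
  P.-integrable setT (EFin \o F) -> (forall w, 0 <= F w) -> 0 < y ->
  y * fine (P [set w | y <= F w]) <= Ex P F.
Proof.
move=> mF iF F0 y0.
have mE := measurable_superlevel y mF.
have h := @le_integral_comp_abse _ W R P setT measurableT (EFin \o F) y id
  (@measurable_id _ _ _) (fun r r0 => r0) (fun r s _ _ rs => rs) (iffRL (measurable_EFinP _ _) mF) y0.
have iFin := integrable_fin_num measurableT iF.
rewrite -lee_fin EFinM fineK ?fin_num_measure// /Ex /Rintegral fineK//.
have e1 : setT `&` [set x | (y%:E <= `|(EFin \o F) x|)%E] = [set w | y <= F w].
  by apply/seteqP; split => w /=; rewrite ger0_norm// lee_fin; case.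
rewrite e1 in h; apply: (le_trans h); rewrite le_eqVlt; apply/orP; left; apply/eqP.
by apply: eq_integral => w _ /=; rewrite ger0_norm.
Qed.

(** For each rank [n], the event that the growth holds from [n] on is null by Markov's inequality at
    a large [N]; so is the countable union of these events. *)
Lemma eventually_large_false (F : nat -> W -> R) (B C : R) (r : R) :
  0 < C -> 0 < r -> 
  (forall N, [/\ measurable_fun setT (F N), P.-integrable setT (EFin \o F N),
     forall w, 0 <= F N w & Ex P (F N) <= B]) ->
  ~ {ae P, forall w, exists n, forall N, (n <= N)%N ->
      C * expR (r * N%:R) <= F N w}.
Proof.
move=> C0 r0 HF.
pose E N := [set w | C * expR (r * N%:R) <= F N w].
have mE N : measurable (E N) by apply: measurable_superlevel; case: (HF N).
have Ce N : 0 < C * expR (r * N%:R) by rewrite mulr_gt0 ?expR_gt0.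
have PE N : C * expR (r * N%:R) * fine (P (E N)) <= B.
  have [mF iF F0 FB] := HF N; apply: le_trans FB; exact: markov_Ex.
pose G n := \bigcap_(N in [set N | (n <= N)%N]) E N.
have mG n : measurable (G n).
  by apply: bigcap_measurable => [|N _]; [exists n => /=|exact: mE].
have PG n : P.-negligible (G n).
  apply/negligibleP => //.
  have [//|Pn0] := eqVneq (P (G n)) 0%E.
  have fG : P (G n) \is a fin_num by exact: fin_num_measure.
  have p0 : 0 < fine (P (G n)).
    by rewrite fine_gt0// lt0e Pn0 measure_ge0 ltey_eq fG.
  set p := fine _ in p0.
  (* As [expR y >= y], Markov's inequality yields [C * r * N%:R * p <= B], which fails for every [N]
     above [x]. *)
  pose x := B / (C * p * r).
  pose N := maxn n (Num.bound x).
  have GE : p <= fine (P (E N)).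
    rewrite fine_le ?fin_num_measure// le_measure ?inE//.
    by move=> w Gw; apply: Gw => /=; exact: leq_maxl.
  have xN : x < N%:R.
    have [x0|x0] := leP 0 x; last by rewrite (lt_le_trans x0).
    apply: (lt_le_trans (archi_boundP x0)).
    by rewrite ler_nat leq_maxr.
  have rN : r * N%:R <= expR (r * N%:R).
    by have := expR_ge1Dx (r * N%:R); lra.
  have h1 : C * expR (r * N%:R) * p <= B.
    by apply: le_trans (PE N); rewrite ler_wpM2l// ltW.
  have h2 : C * (r * N%:R) * p <= B.
    apply: le_trans h1; rewrite ler_wpM2r ?(ltW p0)// ler_wpM2l// ltW//.
  move: xN; rewrite /x ltr_pdivrMr ?mulr_gt0// => h3.
  exfalso; move: h2; rewrite leNgt => /negP; apply.
  by apply: (lt_le_trans h3); rewrite le_eqVlt; apply/orP; left; apply/eqP; ring.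
move=> H; have nU : P.-negligible (\bigcup_n G n) by exact: negligible_bigcup.
have nT : P.-negligible [set: W].
  apply: (negligibleS _ (negligibleU nU H)) => w _.
  have [[n Hn]|nH] := pselect (exists n, forall N, (n <= N)%N ->
      C * expR (r * N%:R) <= F N w); last by right.
  by left; exists n => // N /= nN; exact: Hn.
have /= := @probability_setT _ _ _ P.
by move/negligibleP: nT => /(_ measurableT) /= -> /eqP; rewrite eq_sym onee_eq0.
Qed.

(** A positive limit would make the power [t] of the partition function grow exponentially, against
    majorants of bounded mean. These also contain the charge at site 0, absent from the partition
    function and bounded below through [b]; since the weights increase with [h], one [h0] settles
    all [h <= h0]. *)
Lemma free_energy_le0 (beta h h0 t b B : R) : h <= h0 -> 0 < t < 1 -> 0 < b ->
  {ae P, forall w, forall n, b <= 1 + beta * omega n w} ->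
  (forall N, exists F : W -> R,
    [/\ measurable_fun setT F /\ P.-integrable setT (EFin \o F),
        forall w, (expR h0 * site_weight beta (omega 0%N w) *
          path_sum K N.+1 N.+1 (last_point N)
            (fun m => expR h0 * site_weight beta (omega m w)) 0%N) `^ t <= F w &
        Ex P F <= B]) ->
  free_energy Q tau P omega beta h <= 0.
Proof.
move=> hh0 /andP[t0 t1] b0 aeb HF; rewrite leNgt; apply/negP => fpos.
rewrite /free_energy in fpos; set S := [set f | _] in fpos.
(* Positivity excludes the default value, so the limit does exist. *)
have Sf : S (xget 0 S).
  by move: fpos; case: xgetP => [f -> //|_]; rewrite ltxx.
set f := xget 0 S in Sf fpos.
have [F HF'] := @choice _ _ _ HF.
have HG N : [/\ measurable_fun setT (F N), P.-integrable setT (EFin \o F N),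
     forall w, 0 <= F N w & Ex P (F N) <= B].
  have [[mF iF] lF eF] := HF' N; split => // w.
  exact: le_trans (powR_ge0 _ _) (lF w).
have C0 : 0 < (expR h0 * b) `^ t by rewrite powR_gt0// mulr_gt0 ?expR_gt0.
have r0 : 0 < t * (f / 2) by rewrite mulr_gt0 ?divr_gt0.
apply: (eventually_large_false C0 r0 HG).
apply: filterS2 Sf aeb => w cvf wb.
have f2 : f / 2 < f by rewrite ltr_pdivrMr// ltr_pMr// ltr1n.
have /= := cvgr_gt f cvf _ f2.
case => n0 _ Hn0; exists (maxn n0 1) => N nN.
have N0 : (0 < N)%N by rewrite (leq_trans _ nN)// leq_maxr.
have NR0 : (0 : R) < N%:R by rewrite ltr0n.
have := Hn0 N (leq_trans (leq_maxl _ _) nN) => /=.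
rewrite [_^-1 * _]mulrC ltr_pdivlMr// => lnZ.
set Z := partition_function Q tau omega beta h N w in lnZ.
have Z1 : expR (f / 2 * N%:R) <= Z.
  (* [ln] vanishes on nonpositive numbers, so a positive logarithm forces [Z] to be positive. *)
  have lnp : 0 < ln Z by apply: le_lt_trans lnZ; rewrite mulr_ge0 ?divr_ge0 ?ltW.
  have Z0 : 0 < Z.
    by rewrite ltNge; apply/negP => Zn; rewrite ln0// ltxx in lnp.
  by rewrite -[leRHS]lnK ?posrE// ler_expR ltW.
have w0 n : 0 <= 1 + beta * omega n w by exact: le_trans (ltW b0) (wb n).
have [_ lF _] := HF' N; apply: le_trans (lF w).
have -> : t * (f / 2) * N%:R = (f / 2 * N%:R) * t by ring.
have b1 : 0 <= expR h0 * b by rewrite mulr_ge0 ?expR_ge0 ?(ltW b0).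
rewrite expRM -powRM ?expR_ge0//.
have sw n : site_weight beta (omega n w) = 1 + beta * omega n w.
  by rewrite /site_weight ger0_norm.
have K0 := law_ge0 Q tau.
have q0 m : 0 <= (m == N)%:R :> R by rewrite ler0n.
have Zle : Z <= path_sum K N.+1 N.+1 (last_point N)
    (fun m => expR h0 * site_weight beta (omega m w)) 0%N.
  rewrite /Z partition_functionE//; apply: path_sum_weight_le => // m.
  by rewrite sw mulr_ge0 ?expR_ge0//= ler_wpM2r// ler_expR.
apply: ge0_ler_powR; rewrite ?nnegrE ?(ltW t0)//.
- by rewrite mulr_ge0 ?expR_ge0.
- rewrite mulr_ge0 ?mulr_ge0 ?expR_ge0 ?normr_ge0// (le_trans _ Zle)//.
  by rewrite (le_trans _ Z1)// expR_ge0.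
- rewrite ler_pM ?expR_ge0//; last exact: le_trans Zle.
  by rewrite sw ler_wpM2l ?expR_ge0.
Qed.

End free_energy_bound.

(** * Choice of the scales *)

Lemma expR_ge_id {R : realType} (x : R) : x <= expR x.
Proof. by have := expR_ge1Dx x; lra. Qed.

Lemma powRE {R : realType} (x y : R) : 0 < x -> x `^ y = expR (y * ln x).
Proof. by move=> x0; rewrite /powR gt_eqF. Qed.

(** All scales are driven by [Y = AA * beta ^ (- 2 ga)], with [l] just below [expR Y]. The
    conclusions concern, in order, size and rarity of pairs, the first phase, and the second
    phase. *)
Lemma scales {R : realType} (ga al x0 de C1 c Es : R) (b j0 : nat) :
  1 < ga -> al = 1 - ga^-1 -> 0 < x0 -> 0 < de < 1 -> 0 < C1 -> x0 `^ ga <= C1 ->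
  0 < c -> 0 < Es -> (0 < b)%N -> (0 < j0)%N ->
  exists AA : R, 0 < AA /\ forall beta : R, 0 < beta <= 1 ->
  exists (L n0 : nat) (A u ka : R), let l := (b * L)%N in
  [/\ [/\ (j0 < L)%N, expR (- AA * beta `^ (- (2 * ga))) * l%:R <= 1,
          x0 <= A, x0 <= u &
          A `^ (- ga) * l%:R * (u `^ (- ga) * (C1 * (1 + ln (l%:R *+ 2)))) <= 1],
      (0 < n0)%N, Es * (al / 2) * n0%:R `^ (- al) <= c * (beta * A `^ (1 - ga)),
      (n0%:R / (L - j0 + n0)%:R) `^ (al / 2) <= de &
      [/\ 0 < ka <= al / 2, Es * ka * j0%:R `^ al <= c * (beta * u `^ (1 - ga)) &
          (1 / (L - j0 + 1)%:R) `^ ka <= de]].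
Proof.
move=> ga_gt1 alE x0_gt0 de01 C10 C1x0 c0 Es0 b_gt0 j0_gt0.
have ga0 : 0 < ga by lra.
have gi1 : ga^-1 < 1 by rewrite invf_lt1.
have gi0 : 0 < ga^-1 by rewrite invr_gt0.
have al0 : 0 < al by rewrite alE subr_gt0.
have al1 : al < 1 by rewrite alE ltrBlDr ltrDl.
have ga1 : 0 < ga - 1 by lra.
have gaal : ga * al = ga - 1 by rewrite alE; field; rewrite gt_eqF.
have [de0 de1] := andP de01.
have bR : (0 : R) < b%:R by rewrite ltr0n.
have jR : (0 : R) < j0%:R by rewrite ltr0n.
(* With [n0] about [eps * L], the first barrier at its origin is at most
   [(4 * eps) ^ (al / 2) = de]. *)
pose eps := de `^ (2 / al) / 4.
have eps0 : 0 < eps by rewrite divr_gt0 ?powR_gt0.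
have epsE : (4 * eps) `^ (al / 2) = de.
  rewrite /eps mulrC divfK// -powRrM (_ : _ * _ = 1) ?powRr1 ?(ltW de0)//.
  by field; rewrite gt_eqF.
(* As [l = b * L], the rate required in the first phase is at most [c * B1 * l ^ (- al)]. It is
   supplied by arranging [beta * A ^ (1 - ga) = B0 * l ^ (- al)] with [B0 >= B1]. *)
pose B1 := Es * (al / 2) * eps `^ (- al) * b%:R `^ al / c.
have B10 : 0 < B1 by rewrite !(mulr_gt0, divr_gt0, powR_gt0, invr_gt0).
pose B0 := 1 + B1.
have B00 : 0 < B0 by rewrite /B0; lra.
(* [v ^ ga] will be [(beta / B0) ^ m1], because [ga / (ga - 1) = 1 / al]; [C5] is what
   [beta ^ m1 * l] must reach for [x0 <= A]. *)
pose m1 := 1 / al. pose C5 := x0 `^ ga * B0 `^ m1.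
have m10 : 0 < m1 by rewrite divr_gt0.
have C50 : 0 < C5 by rewrite mulr_gt0 ?powR_gt0.
pose lam := - ln de. have lam0 : 0 < lam by rewrite oppr_gt0 ln_lt0.
(* The 3 comes from [Lam <= 3 * Y], and the 4 cancels the one in [ln (L - j0 + 1) >= Y / 4]. *)
pose c' := c * (3 * C1) `^ (- al) / (4 * B0 * Es * j0%:R `^ al).
have c'0 : 0 < c' by rewrite !(mulr_gt0, divr_gt0, powR_gt0, invr_gt0).
pose C4 := 4 + 2 * b%:R + 2 * j0%:R + eps^-1.
have ei0 : 0 < eps^-1 by rewrite invr_gt0.
have C40 : 0 < C4 by rewrite /C4; lra.
(* One summand per demand: [L] large against the fixed constants, [x0 <= A], and each of the two
   values that the minimum [ka] may take in the second barrier. *)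
pose AA := 2 * C4 + 2 * (m1 + C5) + 8 * lam / al + (lam / c') `^ ga.
have q1 : 0 < 8 * lam / al by rewrite divr_gt0// mulr_gt0.
have q2 : 0 < (lam / c') `^ ga by rewrite powR_gt0// divr_gt0.
have AA0 : 0 < AA by rewrite /AA; lra.
exists AA; split => // beta /andP[be0 be1].
pose lb := - ln beta; have lb0 : 0 <= lb by rewrite oppr_ge0 ln_le0.
pose ta := beta `^ (- (2 * ga)).
have taE : ta = expR (2 * ga * lb) by rewrite /ta powRE// mulNr /lb mulrN.
have ta1 : 1 <= ta by rewrite taE -expR0 ler_expR !mulr_ge0// ltW.
have ta0 : 0 < ta by lra.
have lbta : lb <= ta.
  apply: (le_trans (expR_ge_id lb)); rewrite taE ler_expR ler_peMl//; lra.
pose Y := AA * ta.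
have YAA : AA <= Y by rewrite /Y ler_peMr// ltW.
(* Square root of [expR Y]: one factor [S] bounds [L] from below, the other absorbs the fixed
   constants. *)
pose S := expR (Y / 2).
have SY : Y / 2 <= S by exact: expR_ge_id.
have SC4 : C4 <= S by move: SY YAA; rewrite /AA; lra.
have S4 : 4 + 2 * b%:R + 2 * j0%:R + eps^-1 <= S by [].
have S0 : 0 < S by exact: expR_gt0.
have XE : expR Y = S * S by rewrite /S -expRD; congr expR; field.
pose L := Num.truncn (expR Y / b%:R).
have X0 : 0 <= expR Y / b%:R by rewrite divr_ge0 ?expR_ge0// ltW.
have /andP[LX XL] := truncn_itv X0.
rewrite -/L in LX XL.
have LS : S <= L%:R.
  have h : 2 * S <= expR Y / b%:R.
    by rewrite XE ler_pdivlMr// mulrAC ler_pM2r//; move: S4 ei0 jR; clear; lra.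
  by move: XL h S4 ei0 bR jR; rewrite -natr1; clear; lra.
have LR0 : (0 : R) < L%:R by exact: lt_le_trans LS.
pose l := (b * L)%N.
have lE : l%:R = b%:R * L%:R :> R by rewrite /l natrM.
have b1 : (1 : R) <= b%:R by rewrite ler1n.
have lS : S <= l%:R by rewrite lE (le_trans LS)// ler_peMl// ltW.
have l0 : (0 : R) < l%:R by exact: lt_le_trans lS.
have lX : l%:R <= expR Y by rewrite lE mulrC -ler_pdivlMr.
pose v := (beta / B0) `^ ((ga - 1)^-1).
have bB : 0 < beta / B0 by rewrite divr_gt0.
have v0 : 0 < v by rewrite powR_gt0.
have bB1 : beta / B0 <= 1 by rewrite ler_pdivrMr// mul1r /B0; move: be1 B10; clear; lra.
have v1 : v <= 1.
  rewrite /v; apply: (le_trans (y := 1 `^ ((ga - 1)^-1))); last by rewrite powR1.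
  apply: ge0_ler_powR; rewrite ?nnegrE ?invr_ge0 ?(ltW bB) ?ler01 ?(ltW ga1)//.
have vga : v `^ ga = beta `^ m1 * B0 `^ (- m1).
  rewrite /v -powRrM (_ : _ * ga = m1); last first.
    by rewrite /m1 -gaal; field; rewrite !gt_eqF.
  by rewrite powRM ?invr_ge0 ?(ltW be0) ?(ltW B00)// powR_inv ?(ltW B00)// powRN.
have vga1 : v `^ (ga - 1) = beta / B0.
  by rewrite /v -powRrM mulVf ?gt_eqF// powRr1// ltW.
clearbody v.
pose Lam : R := 1 + ln (l%:R *+ 2).
have l2 : 1 <= l%:R *+ 2 :> R by move: lS S4 ei0 bR jR; clear; lra.
have Lam1 : 1 <= Lam by rewrite lerDl ln_ge0.
have Lam0 : 0 < Lam by exact: lt_le_trans Lam1.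
have CL0 : 0 < C1 * Lam by rewrite mulr_gt0.
pose A := v * l%:R `^ ga^-1.
pose u := v^-1 * (C1 * Lam) `^ ga^-1.
have vi0 : 0 < v^-1 by rewrite invr_gt0.
have u0 : 0 < u by rewrite mulr_gt0 ?powR_gt0.
have x0E : x0 = (x0 `^ ga) `^ ga^-1.
  by rewrite -powRrM mulfV ?gt_eqF// powRr1// ltW.
have x0A : x0 <= A.
  have -> : A = (v `^ ga * l%:R) `^ ga^-1.
    rewrite powRM ?powR_ge0 ?(ltW l0)// -powRrM mulfV ?gt_eqF// powRr1//; exact: ltW.
  rewrite {1}x0E; apply: ge0_ler_powR; rewrite ?nnegrE ?powR_ge0 ?(ltW gi0)//.
    by rewrite mulr_ge0 ?powR_ge0 ?(ltW l0).
  have h1 : C5 <= beta `^ m1 * l%:R.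
    apply: (@le_trans _ _ (beta `^ m1 * S)); last by rewrite ler_wpM2l// powR_ge0.
    rewrite powRE// /S -expRD; apply: le_trans (expR_ge_id _).
    rewrite -[ln beta]opprK -/lb mulrN.
    have h1 : m1 * lb <= m1 * ta by rewrite ler_wpM2l// ltW.
    have h2 : C5 <= C5 * ta by rewrite ler_peMr// ltW.
    have h3 : (2 * (m1 + C5)) * ta <= Y.
      by rewrite /Y ler_wpM2r ?(ltW ta0)// /AA; move: C40 q1 q2; clear; lra.
    move: h1 h2 h3; clear; lra.
  rewrite vga powRN mulrAC ler_pdivlMr ?powR_gt0//.
have x0u : x0 <= u.
  have h : x0 <= (C1 * Lam) `^ ga^-1.
    rewrite {1}x0E; apply: ge0_ler_powR; rewrite ?nnegrE ?powR_ge0 ?(ltW gi0) ?(ltW CL0)//.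
    by apply: (le_trans C1x0); rewrite ler_peMr// ltW.
  apply: (le_trans h); rewrite /u ler_peMl ?powR_ge0//.
  by rewrite invf_ge1.
have AN t : A `^ t = v `^ t * l%:R `^ (ga^-1 * t).
  by rewrite /A powRM ?powR_ge0 ?(ltW v0)// -powRrM.
have uN t : u `^ t = v `^ (- t) * (C1 * Lam) `^ (ga^-1 * t).
  rewrite /u (powRM t (ltW vi0) (powR_ge0 _ _)) powR_inv ?(ltW v0)// powRN.
  by rewrite powRrM.
(* Equality holds: [A ^ (- ga) * l = v ^ (- ga)], and [u] is chosen so that the remaining factor is
   [v ^ ga]. *)
have pairs : A `^ (- ga) * l%:R * (u `^ (- ga) * (C1 * Lam)) <= 1.
  rewrite AN uN opprK mulrN mulVf ?gt_eqF// !powR_inv1 ?(ltW l0) ?(ltW CL0)//.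
  rewrite powRN le_eqVlt; apply/orP; left; apply/eqP.
  have vn : v `^ ga != 0 by rewrite gt_eqF// powR_gt0.
  by field; rewrite vn !gt_eqF.
have exE : ga^-1 * (1 - ga) = - al by rewrite alE; field; rewrite gt_eqF.
have vE : v `^ (1 - ga) = B0 / beta.
  by rewrite -opprB powRN vga1 invf_div.
have bA : beta * A `^ (1 - ga) = B0 * l%:R `^ (- al).
  by rewrite AN exE vE; field; rewrite gt_eqF.
clearbody A u.
pose n0 := (Num.truncn (eps * L%:R)).+1.
have eL0 : 0 < eps * L%:R by rewrite mulr_gt0.
have /andP[n0lo n0hi] := truncn_itv (ltW eL0).
rewrite -/n0 in n0hi.
have n0R : (0 : R) < n0%:R by rewrite ltr0n.
have five : Es * (al / 2) * n0%:R `^ (- al) <= c * (beta * A `^ (1 - ga)).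
  rewrite bA lE powRM ?ler0n//.
  have h1 : n0%:R `^ (- al) <= (eps * L%:R) `^ (- al).
    rewrite !powRN lef_pV2 ?posrE ?powR_gt0//.
    by apply: ge0_ler_powR; rewrite ?nnegrE ?ler0n ?(ltW eL0) ?(ltW al0)// ltW.
  have Eal : 0 <= Es * (al / 2) by rewrite mulr_ge0 ?divr_ge0 ?ltW.
  apply: (le_trans (ler_wpM2l Eal h1)); rewrite powRM ?ler0n ?(ltW eps0)//.
  have -> : Es * (al / 2) * (eps `^ (- al) * L%:R `^ (- al)) =
      c * (B1 * (b%:R `^ (- al) * L%:R `^ (- al))).
    rewrite /B1 [b%:R `^ (- al)]powRN; field.
    by rewrite !gt_eqF ?powR_gt0.
  by rewrite ler_wpM2l ?(ltW c0)// ler_wpM2r ?mulr_ge0 ?powR_ge0// /B0 lerDr.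
have jLr : 2 * j0%:R <= L%:R :> R by move: S4 LS ei0 bR; clear; lra.
have jL : (j0 < L)%N by rewrite -(ltr_nat R); move: jLr jR; clear; lra.
have LjE : (L - j0)%:R = L%:R - j0%:R :> R by rewrite natrB// ltnW.
have six : (n0%:R / (L - j0 + n0)%:R) `^ (al / 2) <= de.
  rewrite -epsE; apply: ge0_ler_powR.
  - by rewrite divr_ge0 ?(ltW al0).
  - by rewrite nnegrE divr_ge0 ?ler0n.
  - by rewrite nnegrE mulr_ge0 ?(ltW eps0).
  have eL1 : 1 <= eps * L%:R.
    by rewrite mulrC -ler_pdivrMr// mul1r; move: S4 LS bR jR; clear; lra.
  have n0le : n0%:R <= 2 * (eps * L%:R) by rewrite /n0 -natr1; move: n0lo eL1; clear; lra.
  have D0 : (0 : R) < (L - j0 + n0)%:R by rewrite ltr0n addn_gt0 orbT.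
  rewrite ler_pdivrMr// natrD LjE; apply: (le_trans n0le).
  have h : 0 <= eps * (L%:R - 2 * j0%:R + 2 * n0%:R).
    by rewrite mulr_ge0 ?(ltW eps0)//; move: jLr n0R; clear; lra.
  by move: h; clear; lra.
(* The largest exponent that the heavy charges of the second phase can pay for, at least of order
   [beta ^ 2 * Y ^ (- al)]; [ka] caps it at [al / 2], as the barrier requires. *)
pose k2 := c * (beta * u `^ (1 - ga)) / (Es * j0%:R `^ al).
have D20 : 0 < Es * j0%:R `^ al by rewrite mulr_gt0 ?powR_gt0.
have k20 : 0 < k2.
  apply: divr_gt0 D20; apply: mulr_gt0 c0 _; apply: mulr_gt0 be0 _.
  exact: powR_gt0.
pose ka := Num.min (al / 2) k2.
have ka0 : 0 < ka <= al / 2.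
  by rewrite /ka lt_min k20 divr_gt0//= ge_min lexx.
have seven : Es * ka * j0%:R `^ al <= c * (beta * u `^ (1 - ga)).
  have h : ka <= k2 by rewrite /ka ge_min lexx orbT.
  rewrite mulrAC; apply: (le_trans (ler_wpM2l (ltW D20) h)).
  by rewrite /k2 mulrC divfK// gt_eqF.
have Y0 : 0 < Y by exact: lt_le_trans YAA.
have Y1 : 1 <= Y.
  by apply: le_trans YAA; rewrite /AA /C4; move: bR jR ei0 m10 C50 q1 q2; clear; lra.
have lnL : Y / 4 <= ln ((L - j0 + 1)%:R : R).
  have D0 : (0 : R) < (L - j0 + 1)%:R by rewrite ltr0n addn_gt0 orbT.
  rewrite -ler_expR lnK ?posrE// natrD LjE.
  have SS : S = expR (Y / 4) * expR (Y / 4).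
    by rewrite /S -expRD; congr expR; field.
  have e2 : 2 <= expR (Y / 4).
    rewrite leNgt; apply/negP => lt2.
    have e0 := expR_gt0 (Y / 4).
    have : expR (Y / 4) * expR (Y / 4) < 2 * 2 by rewrite ltr_pM ?(ltW e0).
    by rewrite -SS; move: S4 ei0 bR jR; clear; lra.
  have : 2 * expR (Y / 4) <= S by rewrite SS ler_wpM2r ?expR_ge0.
  by move: jLr LS; clear; lra.
have eight : (1 / (L - j0 + 1)%:R) `^ ka <= de.
  have D0 : (0 : R) < (L - j0 + 1)%:R by rewrite ltr0n addn_gt0 orbT.
  have [ka00 _] := andP ka0.
  rewrite powRE ?divr_gt0// div1r lnV ?posrE// -[leRHS]lnK ?posrE// ler_expR.
  rewrite mulrN lerNl -/lam.
  suff : lam <= ka * (Y / 4).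
    by move/le_trans; apply; rewrite ler_wpM2l ?(ltW ka00).
  have hmin : lam <= al / 2 * (Y / 4) /\ lam <= k2 * (Y / 4).
    split.
      have h1 : 8 * lam / al <= Y.
        by apply: le_trans YAA; rewrite /AA; move: C40 m10 C50 q2; clear; lra.
      by move: h1; rewrite ler_pdivrMr//; clear; lra.
    have LamY : Lam <= 3 * Y.
      have h1 : ln (l%:R *+ 2) <= 1 + Y.
        rewrite -mulr_natr mulrC lnM ?posrE//; apply: lerD.
          by rewrite (_ : 2 = 1 + 1 :> R)// le_ln1Dx//; clear; lra.
        by rewrite -ler_expR lnK ?posrE.
      by rewrite /Lam; move: h1 Y1; clear; lra.
    have k2lo : c' * 4 * (beta ^+ 2 * Y `^ (- al)) <= k2.
      rewrite /k2 uN exE opprB vga1.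
      have h1 : (3 * C1 * Y) `^ (- al) <= (C1 * Lam) `^ (- al).
        rewrite !powRN lef_pV2 ?posrE ?powR_gt0 ?mulr_gt0//.
        have nY : 0 <= 3 * C1 * Y := mulr_ge0 (mulr_ge0 (ler0n _ 3) (ltW C10)) (ltW Y0).
        apply: ge0_ler_powR; rewrite ?nnegrE ?(ltW al0) ?(ltW CL0) ?nY//.
        by rewrite (mulrC 3 C1) -mulrA ler_wpM2l// ltW.
      rewrite (powRM (- al) (mulr_ge0 (ler0n _ 3) (ltW C10)) (ltW Y0)) in h1.
      have -> : c' * 4 * (beta ^+ 2 * Y `^ (- al)) =
          c * (beta * (beta / B0 * ((3 * C1) `^ (- al) * Y `^ (- al)))) / (Es * j0%:R `^ al).
        by rewrite /c'; field; rewrite !gt_eqF ?powR_gt0.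
      rewrite ler_wpM2r ?invr_ge0 ?(ltW D20)// ler_wpM2l ?(ltW c0)//.
      by rewrite ler_wpM2l ?(ltW be0)// ler_wpM2l// ltW.
    apply: (@le_trans _ _ (c' * 4 * (beta ^+ 2 * Y `^ (- al)) * (Y / 4))); last first.
      by apply: ler_wpM2r k2lo; rewrite divr_ge0 ?(ltW Y0).
    (* This is where the exponent [2 * ga] is forced: [beta ^ 2 * Y ^ (1 / ga)] reduces to
       [AA ^ (1 / ga)], free of [beta]. *)
    have YE : Y `^ (- al) * Y = AA `^ ga^-1 / beta ^+ 2.
      have -> : - al = ga^-1 - 1 by rewrite alE; ring.
      rewrite [LHS]mulrC.
      rewrite (mulr_powRB1 (ltW Y0) gi0).
      rewrite /Y powRM ?(ltW AA0) ?(ltW ta0)//; congr (_ * _).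
      rewrite /ta -powRrM (_ : _ * ga^-1 = - 2); last by field; rewrite gt_eqF.
      by rewrite powRN -powR_mulrn ?(ltW be0).
    have -> : c' * 4 * (beta ^+ 2 * Y `^ (- al)) * (Y / 4) = c' * AA `^ ga^-1.
      rewrite (_ : _ * (Y / 4) = c' * (beta ^+ 2 * (Y `^ (- al) * Y))); last by field.
      by rewrite YE; congr (c' * _); field; rewrite gt_eqF.
    rewrite mulrC -ler_pdivrMr//.
    have h1 : (lam / c') `^ ga <= AA.
      by rewrite /AA; move: C40 m10 C50 q1; clear; lra.
    have lc0 : 0 <= lam / c' by rewrite divr_ge0 ?ltW.
    have -> : lam / c' = ((lam / c') `^ ga) `^ ga^-1.
      by rewrite -powRrM mulfV ?gt_eqF// powRr1.
    by apply: ge0_ler_powR; rewrite ?nnegrE ?powR_ge0 ?(ltW gi0) ?(ltW AA0).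
  by rewrite /ka; case: hmin; case: (leP (al / 2) k2).
exists L, n0, A, u, ka; split => //; split => //.
rewrite -/ta mulNr -/Y expRN mulrC ler_pdivrMr ?expR_gt0// mul1r.
exact: lX.
Qed.

(** * Tails of the renewal and of the environment *)

Lemma tail_sum {R : realType} (K : nat -> R) n M :
  tail K n = \sum_(n <= j < n + M) K j + tail K (n + M).
Proof.
elim: M => [|M IH]; first by rewrite addn0 big_geq// add0r.
by rewrite addnS big_nat_recr ?leq_addr//= -addrA -tailS.
Qed.

Lemma powRN_le {R : realType} (m n : nat) (s : R) : 0 <= s -> (0 < m)%N ->
  (m <= n)%N -> n%:R `^ (- s) <= m%:R `^ (- s).
Proof.
move=> s0 m0 mn; rewrite !powRN lef_pV2 ?posrE ?powR_gt0 ?ltr0n//; last first.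
  exact: leq_trans mn.
by apply: ge0_ler_powR; rewrite ?nnegrE ?ler0n ?ler_nat.
Qed.

(** The equivalence controls [K] from some [n0] on; earlier terms are at most 1 and absorbed by the
    constant. Tails are finite sums up to a remainder, which vanishes by [tlim] in the upper bound
    and is dropped in the lower one. *)
Lemma tail_bounds {R : realType} (K : nat -> R) (al CK : R) :
  0 < al < 1 -> 0 < CK -> (forall n, 0 <= K n) -> (forall n, 0 <= tail K n) ->
  (forall e, 0 < e -> exists n, tail K n < e) ->
  asymp_equiv \oo K (fun n : nat => CK * n%:R `^ (- (1 + al))) ->
  exists cl c2 : R, [/\ 0 < cl, 0 < c2,
    forall n, (0 < n)%N -> K n <= c2 * n%:R `^ (- (1 + al)),
    forall n, (0 < n)%N -> tail K n <= c2 * n%:R `^ (- al) &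
    forall n, (0 < n)%N -> cl * n%:R `^ (- al) <= tail K n].
Proof.
move=> al01 CK0 K0 t0 tlim asy; have [al0 al1] := andP al01.
have s0 : 0 <= 1 + al by lra.
have K1 n : K n <= 1.
  have h1 := t0 n.+1; have h2 := tail_le K0 (leq0n n).
  have h3 : tail K 0 = 1 by rewrite /tail big_ord0 subr0.
  have := tailS K n; lra.
pose g (n : nat) := CK * n%:R `^ (- (1 + al)).
have g0 n : (0 < n)%N -> 0 < g n by move=> n0; rewrite mulr_gt0// powR_gt0// ltr0n.
have half : (1 / 2 : R) < 1 by lra.
have two : (1 : R) < 2 by lra.
have [n1 _ Hn1] := cvgr_gt _ asy _ half.
have [n2 _ Hn2] := cvgr_lt _ asy _ two.
pose n0 := (maxn n1 n2).+1.
have n00 : (0 < n0)%N by [].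
have lo n : (n0 <= n)%N -> g n / 2 <= K n.
  move=> nn; have gn := g0 n (leq_trans n00 nn).
  have := Hn1 n (leq_trans (leq_trans (leq_maxl _ _) (leqnSn _)) nn).
  by rewrite /= ltr_pdivlMr// -/(g n); lra.
have hi n : (n0 <= n)%N -> K n <= 2 * g n.
  move=> nn; have gn := g0 n (leq_trans n00 nn).
  have := Hn2 n (leq_trans (leq_trans (leq_maxr _ _) (leqnSn _)) nn).
  by rewrite /= ltr_pdivrMr// -/(g n); lra.
pose cK := 2 * CK + n0%:R `^ (1 + al).
have p0 : 0 < n0%:R `^ (1 + al) :> R by rewrite powR_gt0// ltr0n.
have cK0 : 0 < cK by rewrite /cK; lra.
have hK n : (0 < n)%N -> K n <= cK * n%:R `^ (- (1 + al)).
  move=> n_gt0; rewrite /cK mulrDl.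
  have q0 : 0 <= n%:R `^ (- (1 + al)) :> R by exact: powR_ge0.
  have [nn|nn] := leqP n0 n.
    apply: (le_trans (hi n nn)); rewrite /g mulrA lerDl mulr_ge0// ltW//.
  apply: (le_trans (K1 n)); apply: ler_wpDl; first by rewrite !mulr_ge0// ltW.
  rewrite powRN ler_pdivlMr ?powR_gt0 ?ltr0n// mul1r.
  by apply: ge0_ler_powR; rewrite ?nnegrE ?ler0n ?ler_nat// ltnW.
have ai0 : 0 < al^-1 by rewrite invr_gt0.
exists (CK / 4 * (n0 * 2)%:R `^ (- al)), (cK * (1 + al^-1)); split.
- by rewrite mulr_gt0 ?divr_gt0// powR_gt0// ltr0n.
- by rewrite mulr_gt0//; lra.
- move=> n n_gt0; apply: (le_trans (hK n n_gt0)).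
  by rewrite ler_wpM2r ?powR_ge0// ler_peMr ?(ltW cK0)//; lra.
- move=> n n_gt0; apply/ler_addgt0Pr => e e0.
  have [M HM] := tlim e e0.
  rewrite tailS (tail_sum K n.+1 M).
  have h1 : tail K (n.+1 + M) <= e.
    by apply/ltW/(le_lt_trans _ HM)/(tail_le K0); exact: leq_addl.
  have h2 : K n <= cK * n%:R `^ (- al).
    apply: (le_trans (hK n n_gt0)); rewrite ler_wpM2l ?(ltW cK0)//.
    by apply: ler_powR; [rewrite ler1n|lra].
  have h3 : \sum_(n.+1 <= j < n.+1 + M) K j <= cK * (n%:R `^ (- al) / al).
    apply: (@le_trans _ _ (cK * \sum_(n <= j < n + M) j.+1%:R `^ (- (1 + al)))).
      rewrite big_add1 /= mulr_sumr; apply: ler_sum => j _; exact: hK.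
    by rewrite ler_wpM2l ?(ltW cK0)// sum_powRN_tail.
  by rewrite mulrDr mulr1 mulrDl; lra.
(* The multiple [m = n * n0] is at least [n] and [n0] and stays comparable to [n]; the terms from
   [m] to [2 * m] already give the right order. *)
- move=> n n_gt0; pose m := (n * n0)%N.
  have m0 : (0 < m)%N by rewrite muln_gt0 n_gt0.
  have mn : (n <= m)%N by rewrite leq_pmulr.
  have mn0 : (n0 <= m)%N by rewrite leq_pmull.
  apply: le_trans (tail_le K0 mn); rewrite (tail_sum K m m).
  apply: ler_wpDr => //.
  have : \sum_(m <= j < m + m) CK / 2 * (m + m)%:R `^ (- (1 + al)) <=
      \sum_(m <= j < m + m) K j.
    apply: ler_sum_nat => j /andP[mj jm].
    apply: le_trans (lo j (leq_trans mn0 mj)).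
    rewrite /g mulrAC ler_wpM2r ?invr_ge0// ler_wpM2l ?(ltW CK0)//.
    by apply: powRN_le => //; [exact: leq_trans mj|exact: ltnW].
  apply: le_trans; rewrite sumr_const_nat addnK -[leRHS]mulr_natr.
  have mmE : (m + m)%N = (n0 * 2 * n)%N by rewrite /m; lia.
  have mm0 : (0 : R) < (m + m)%:R by rewrite ltr0n addn_gt0 m0.
  have -> : (m + m)%:R `^ (- (1 + al)) = (m + m)%:R^-1 * (m + m)%:R `^ (- al) :> R.
    rewrite opprD powRD; last by rewrite (gt_eqF mm0) implybT.
    by rewrite powR_inv1// ltW.
  rewrite {2}mmE (natrM _ (n0 * 2) n) (@powRM _ (n0 * 2)%:R) ?ler0n// le_eqVlt; apply/orP; left; apply/eqP.
  by rewrite natrD; field; rewrite -natrD gt_eqF.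
Qed.

Lemma ae_sure {d : measure_display} {W : measurableType d} {R : realType}
    (P : probability W R) (D : set W) :
  measurable D -> P D = 1%E -> {ae P, forall w, D w}.
Proof.
move=> mD PD; exists (~` D); split => //; first exact: measurableC.
by rewrite probability_setC// PD subee.
Qed.

Section environment_tail.
Context {d : measure_display} {W : measurableType d} {R : realType}.
Variables (P : probability W R) (X : nat -> W -> R).
Hypothesis mX : forall n, measurable_fun setT (X n).

Local Notation F := (fun x : R => fine (P [set w | x <= X 1%N w])).

Lemma env_bounds (ga CP : R) : 0 < ga -> 0 < CP ->
  asymp_equiv +oo F (fun x : R => CP * x `^ (- ga)) ->
  exists x0 CF : R, [/\ 0 < x0, 0 < CF,
    forall x, 0 < x -> F x <= CF * x `^ (- ga) &
    forall x, x0 <= x -> CP / 2 * x `^ (- ga) <= F x].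
Proof.
move=> ga0 CP0 asy.
have F1 x : F x <= 1.
  have mE := measurable_superlevel x (mX 1%N).
  by rewrite -lee_fin fineK ?fin_num_measure// probability_le1.
pose g (x : R) := CP * x `^ (- ga).
have g0 x : 0 < x -> 0 < g x by move=> x0; rewrite mulr_gt0// powR_gt0.
have half : (1 / 2 : R) < 1 by lra.
have two : (1 : R) < 2 by lra.
have [m1 [_ Hm1]] := cvgr_gt _ asy _ half.
have [m2 [_ Hm2]] := cvgr_lt _ asy _ two.
pose x0 := `|m1| + `|m2| + 1.
have x00 : 0 < x0 by rewrite /x0 ltr_wpDl// addr_ge0.
have lo x : x0 <= x -> g x / 2 <= F x.
  move=> xx; have gx := g0 x (lt_le_trans x00 xx).
  have /Hm1 : m1 < x.
    apply: lt_le_trans xx; rewrite /x0; have := ler_norm m1; have := normr_ge0 m2; lra.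
  by rewrite /= ltr_pdivlMr// -/(g x); lra.
have hi x : x0 <= x -> F x <= 2 * g x.
  move=> xx; have gx := g0 x (lt_le_trans x00 xx).
  have /Hm2 : m2 < x.
    apply: lt_le_trans xx; rewrite /x0; have := ler_norm m2; have := normr_ge0 m1; lra.
  by rewrite /= ltr_pdivrMr// -/(g x); lra.
have p0 : 0 < x0 `^ ga by rewrite powR_gt0.
exists x0, (2 * CP + x0 `^ ga); split => //; first by rewrite ltr_wpDl// mulr_ge0// ltW.
- move=> x xgt0; rewrite mulrDl.
  have q0 : 0 <= x `^ (- ga) by exact: powR_ge0.
  have [xx|xx] := leP x0 x.
    by apply: (le_trans (hi x xx)); rewrite /g mulrA lerDl mulr_ge0// ltW.
  apply: (le_trans (F1 x)); apply: ler_wpDl; first by rewrite !mulr_ge0// ltW.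
  rewrite powRN ler_pdivlMr ?powR_gt0// mul1r.
  by apply: ge0_ler_powR; rewrite ?nnegrE ?ltW.
- by move=> x xx; have := lo x xx; rewrite /g; lra.
Qed.

Variables (a : R).
Hypotheses (a01 : 0 < a < 1) (lowX : P [set w | - a <= X 1%N w] = 1%E).
Hypothesis meanX : ('E_P[X 1%N] = 0)%E.

Lemma ae_low : {ae P, forall w, - a <= X 1%N w}.
Proof. by apply: ae_sure => //; exact: measurable_superlevel. Qed.

(** A zero expectation does not by itself mean integrability. The negative part is bounded by [a],
    hence integrable; an infinite positive part would then make the expectation infinite. *)
Lemma integrable_env : P.-integrable setT (EFin \o X 1%N).
Proof.
have mE : measurable_fun setT (EFin \o X 1%N) by exact/measurable_EFinP.
apply/integrableP; split => //.
have neg : (\int[P]_w ((EFin \o X 1%N)^\- w) < +oo)%E.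
  apply: (@le_lt_trans _ _ (\int[P]_w (cst a%:E w))%E); last first.
    have := integrable_fin_num measurableT
      (finite_measure_integrable_cst P a measurableT).
    by rewrite fin_numElt => /andP[].
  apply: ae_ge0_le_integral => //.
  - exact: measurable_funeneg.
  - by move=> w _; rewrite lee_fin; case/andP: a01 => /ltW.
  - apply: filterS ae_low => w lw _; rewrite funenegE /=.
    by rewrite ge_max !lee_fin lerNl lw /=; case/andP: a01 => /ltW.
move: meanX; rewrite unlock integralE => mean0.
have pos : (\int[P]_w ((EFin \o X 1%N)^\+ w) < +oo)%E.
  rewrite ltey; apply/eqP => pinf; move: mean0; rewrite pinf.
  have fneg : (\int[P]_w ((EFin \o X 1%N)^\- w) \is a fin_num)%E.
    by rewrite ge0_fin_numE// integral_ge0.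
  by move: fneg; case: (\int[P]_w ((EFin \o X 1%N)^\- w))%E.
under eq_integral do rewrite -/((abse \o (EFin \o X 1%N)) _) fune_abse.
rewrite ge0_integralD//; first exact: lte_add_pinfty.
- exact: measurable_funepos.
- exact: measurable_funeneg.
Qed.

Lemma mean_env : Ex P (X 1%N) = 0.
Proof. by rewrite /Ex /Rintegral; move: meanX; rewrite unlock => ->. Qed.

Variable beta : R.
Hypothesis beta01 : 0 < beta <= 1.

Lemma env_low x : - a <= x -> 1 - a <= 1 + beta * x.
Proof. by move=> ax; have := a01; have := beta01; nra. Qed.

Lemma weight_env :
  P.-integrable setT (EFin \o (site_weight beta \o X 1%N)) /\
  Ex P (site_weight beta \o X 1%N) = 1.
Proof.
have i1 : P.-integrable setT (EFin \o (fun w => beta * X 1%N w)).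
  exact: (integrableZl measurableT beta integrable_env).
have i2 : P.-integrable setT (EFin \o cst 1).
  exact: (finite_measure_integrable_cst P 1 measurableT).
have i3 : P.-integrable setT (EFin \o (fun w => 1 + beta * X 1%N w)).
  exact: (integrableD measurableT i2 i1).
have m3 : measurable_fun setT (fun w => 1 + beta * X 1%N w).
  by apply: measurable_funD => //; apply: measurable_funM.
have mw : measurable_fun setT (site_weight beta \o X 1%N).
  by apply: measurableT_comp => //; exact: measurable_site_weight.
have i4 : P.-integrable setT (EFin \o (site_weight beta \o X 1%N)).
  exact: (integrable_norm i3).
split => //.
transitivity (Ex P (fun w => 1 + beta * X 1%N w)).
  rewrite /Ex /Rintegral; congr fine; apply: ae_eq_integral => //; try exact/measurable_EFinP.
  apply: filterS ae_low => w lw _ /=; rewrite /site_weight ger0_norm//.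
  by have := env_low lw; have := a01; lra.
rewrite /Ex RintegralD// RintegralZl// ?integrable_env//.
by rewrite -/(Ex P (X 1%N)) mean_env mulr0 addr0 -/(Ex P (cst 1)) Ex_cst.
Qed.

End environment_tail.

(** * Verification of the chunk estimates *)

Section block_kernel.
Context {R : realType}.
Variables (K : nat -> R) (al cl c2 : R).
Hypotheses (al01 : 0 < al < 1) (cl0 : 0 < cl) (c20 : 0 < c2).
Hypotheses (K_ge0 : forall n, 0 <= K n) (tail_ge0 : forall n, 0 <= tail K n).
Hypothesis K_up : forall n, (0 < n)%N -> K n <= c2 * n%:R `^ (- (1 + al)).
Hypothesis tail_low : forall n, (0 < n)%N -> cl * n%:R `^ (- al) <= tail K n.

Let al0 : 0 < al. Proof. by case/andP: al01. Qed.

Definition block_law (l i f : nat) : R := \sum_(i * l <= m < i.+1 * l) K (m - f).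

(** The first summand serves a gap of two blocks, where the target touches the chunk; the second
    serves the larger gaps. *)
Definition chunk_jump_cst : R := 2 `^ (1 + al) + c2 * 3 `^ (1 + al) * 2 `^ al / cl.

Definition window_jump_cst : R := c2 * 4 `^ (1 + al) * 2 `^ al / cl.

Lemma powRV (x y : R) : 0 < x -> x^-1 `^ (- y) = x `^ y.
Proof. by move=> x0; rewrite powR_inv ?(ltW x0)// powRN invrK. Qed.

(** The block has [l] sites, each at distance at least [g * l / s] from [f]. *)
Lemma block_law_le (s l g i f : nat) : (0 < s)%N -> (0 < l)%N -> (0 < g)%N ->
  (forall m, (i * l <= m)%N -> (f < m)%N /\ (g * l <= s * (m - f))%N) ->
  block_law l i f <= c2 * s%:R `^ (1 + al) * g%:R `^ (- (1 + al)) * l%:R `^ (- al).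
Proof.
move=> s0 l0 g0 far; have a0 := al0.
have l0R : 0 < l%:R :> R by rewrite ltr0n.
have s0R : 0 < s%:R :> R by rewrite ltr0n.
have g0R : 0 < g%:R :> R by rewrite ltr0n.
pose v := c2 * s%:R `^ (1 + al) * g%:R `^ (- (1 + al)) * l%:R `^ (- (1 + al)).
have step : block_law l i f <= \sum_(i * l <= m < i.+1 * l) v.
  rewrite /block_law big_nat [leRHS]big_nat; apply: ler_sum => m /andP[im _].
  have [fm gl] := far m im.
  apply: le_trans (K_up _) _; first by rewrite subn_gt0.
  rewrite /v -!mulrA ler_pM2l//.
  have -> : s%:R `^ (1 + al) * (g%:R `^ (- (1 + al)) * l%:R `^ (- (1 + al))) =
      (s%:R^-1 * (g%:R * l%:R)) `^ (- (1 + al)) :> R.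
    by rewrite !powRM ?mulr_ge0 ?invr_ge0 ?ler0n// powRV.
  rewrite !powRN lef_pV2 ?posrE ?powR_gt0 ?mulr_gt0 ?invr_gt0 ?ltr0n ?subn_gt0//.
  apply: ge0_ler_powR; rewrite ?nnegrE ?mulr_ge0 ?invr_ge0 ?ler0n//.
    by rewrite addr_ge0 ?ler01// ltW.
  by rewrite ler_pdivrMl// -!natrM ler_nat.
apply: le_trans step _; rewrite sumr_const_nat -[leLHS]mulr_natl.
have -> : (i.+1 * l - i * l = l)%N by rewrite mulSn addnK.
have -> : l%:R * v = c2 * s%:R `^ (1 + al) * g%:R `^ (- (1 + al)) *
    (l%:R `^ 1 * l%:R `^ (- (1 + al))) by rewrite powRr1 ?ler0n// /v; ring.
rewrite -powRD; last by apply/implyP => _; rewrite gt_eqF.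
by rewrite (_ : 1 + - (1 + al) = - al)//; ring.
Qed.

Lemma tail_gt0 n : 0 < tail K n.
Proof.
apply: lt_le_trans (tail_le K_ge0 (leqnSn n)).
apply: lt_le_trans (tail_low (ltn0Sn n)).
by rewrite mulr_gt0// powR_gt0// ltr0n.
Qed.

Lemma powRN_tail n : (0 < n)%N -> n%:R `^ (- al) <= 2 `^ al / cl * tail K n.*2.
Proof.
move=> n0; have n0R : 0 < n%:R :> R by rewrite ltr0n.
have h : cl * n.*2%:R `^ (- al) <= tail K n.*2 by apply: tail_low; rewrite double_gt0.
have -> : n%:R `^ (- al) = 2 `^ al * n.*2%:R `^ (- al) :> R.
  rewrite -muln2 natrM (powRM (- al)) ?ler0n// mulrCA -powRD ?subrr ?powRr0 ?mulr1//.
  by apply/implyP => _; rewrite pnatr_eq0.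
by rewrite -mulrA ler_wpM2l ?powR_ge0// ler_pdivlMl.
Qed.

(** As [L.*2] is at most half of [l], a window point is at distance at least [(i' - i) * l / 4] from
    the target. The gain [b ^ (- al)] reflects that such a jump is [b] times longer than the scale
    [L] of the window. *)
Lemma block_law_window l L b i i' n f : l = (b * L)%N -> (4 <= b)%N -> (0 < L)%N ->
  (n < i.+1 * l)%N -> (i.+2 <= i')%N -> (f < n + L.*2)%N ->
  block_law l i' f <=
  window_jump_cst * b%:R `^ (- al) * (i' - i)%:R `^ (- (1 + al)) * tail K L.*2.
Proof.
move=> lE b4 L0 ni ii' fn.
have l0 : (0 < l)%N by rewrite lE muln_gt0 L0 (leq_trans _ b4).
have Ll : (4 * L <= l)%N by rewrite lE leq_mul2r b4 orbT.
have g0 : (0 < i' - i)%N by rewrite subn_gt0; apply: leq_trans ii'.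
have far m : (i' * l <= m)%N -> (f < m)%N /\ ((i' - i) * l <= 4 * (m - f))%N.
  move=> im; have [g gE] : exists g, i' = (i + g.+2)%N.
    by exists (i' - i.+2)%N; clear -ii'; lia.
  move: im ni fn Ll; rewrite gE [(i + _)%N]addnC addnK !mulnDl !mulSn; clear.
  move: (i * l)%N (g * l)%N => x y; lia.
apply: le_trans (block_law_le _ l0 g0 far) _ => //.
have p0 : 0 <= (i' - i)%:R `^ (- (1 + al)) :> R by exact: powR_ge0.
rewrite lE natrM powRM ?ler0n//.
have := powRN_tail L0 => h.
have c0 : 0 <= c2 * 4 `^ (1 + al) * (i' - i)%:R `^ (- (1 + al)) * b%:R `^ (- al).
  by rewrite !mulr_ge0 ?powR_ge0// ltW.
rewrite [leLHS](_ : _ = c2 * 4 `^ (1 + al) * (i' - i)%:R `^ (- (1 + al)) *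
  b%:R `^ (- al) * L%:R `^ (- al)); last by ring.
apply: le_trans (ler_wpM2l c0 h) _.
by rewrite le_eqVlt /window_jump_cst; apply/orP; left; apply/eqP; ring.
Qed.

(** For [i' = i + 2] the block starts where the chunk ends, and only the tail of [K] is available.
    For larger gaps the distance is at least a third of [(i' - i) * l]. *)
Lemma block_law_tail l i i' f : (0 < l)%N -> (i.+2 <= i')%N ->
  (i * l <= f < i.+2 * l)%N ->
  block_law l i' f <=
  chunk_jump_cst * (i' - i)%:R `^ (- (1 + al)) * tail K (i.+2 * l - f).
Proof.
Proof.
move=> l0 ii' /andP[fi fi2].
have p2 : 0 < 2 `^ al :> R by rewrite powR_gt0.
have K0 : 0 <= c2 * 3 `^ (1 + al) * 2 `^ al / cl by rewrite !mulr_ge0 ?powR_ge0 ?invr_ge0 ?ltW.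
have tl : tail K l.*2 <= tail K (i.+2 * l - f).
  by apply: (tail_le K_ge0); move: fi fi2; rewrite !mulSn; clear; move: (i * l)%N => x; lia.
have [g ->] : exists g, i' = (i + g.+2)%N.
  by exists (i' - i.+2)%N; clear -ii'; lia.
rewrite [(i + _)%N]addnC addnK /chunk_jump_cst; case: g => [|g].
  have le_t : block_law l (2 + i) f <= tail K (i.+2 * l - f).
    set D := (i.+2 * l - f)%N; rewrite (tail_sum K D l) /block_law.
    have [h1 h2] : ((2 + i) * l = D + f)%N /\ ((2 + i).+1 * l = (D + l) + f)%N.
      by rewrite /D; move: fi2; rewrite !mulSn; clear; move: (i * l)%N => x; lia.
    rewrite h2 h1 big_addn addnK (eq_bigr K) ?lerDl// => m _.
    by rewrite addnK.
  apply: le_trans le_t _; rewrite ler_peMl// mulrDl -powRD ?subrr; last first.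
    by apply/implyP => _; rewrite pnatr_eq0.
  by rewrite powRr0 lerDl mulr_ge0// ?powR_ge0//.
have far m : ((g.+3 + i) * l <= m)%N -> (f < m)%N /\ (g.+3 * l <= 3 * (m - f))%N.
  by move: fi2; rewrite !mulnDl !mulSn; clear -l0; move: (i * l)%N (g * l)%N => x y; lia.
apply: le_trans (block_law_le (s := 3) (g := g.+3) _ l0 _ far) _ => //.
have c0 : 0 <= c2 * 3 `^ (1 + al) * g.+3%:R `^ (- (1 + al)).
  by rewrite !mulr_ge0 ?powR_ge0// ltW.
apply: le_trans (ler_wpM2l c0 (le_trans (powRN_tail l0) (ler_wpM2l _ tl))) _.
  by rewrite divr_ge0 ?ltW.
rewrite [leLHS](_ : _ = c2 * 3 `^ (1 + al) * 2 `^ al / cl * g.+3%:R `^ (- (1 + al)) *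
  tail K (i.+2 * l - f)); last by ring.
by rewrite ler_wpM2r// ler_wpM2r ?powR_ge0// lerDr powR_ge0.
Qed.

Lemma last_point_tail l i N f : (0 < l)%N -> (i * l <= f < i.+2 * l)%N ->
  last_point N f <= (tail K l.*2)^-1 * tail K (i.+2 * l - f) :> R.
Proof.
move=> l0 /andP[fi fi2].
have tl : tail K l.*2 <= tail K (i.+2 * l - f).
  by apply: (tail_le K_ge0); move: fi fi2; rewrite !mulSn; clear; move: (i * l)%N => x; lia.
have t0 := tail_gt0 l.*2.
rewrite /last_point ler_pdivlMl// ; apply: le_trans tl.
by case: (f == N); rewrite ?mulr1 ?mulr0 ?lexx// ltW.
Qed.

End block_kernel.

Lemma harmonic_le {R : realType} (n : nat) : (0 < n)%N ->
  \sum_(1 <= r < n.+1) (r%:R : R)^-1 <= 1 + ln n%:R.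
Proof.
case: n => // n _; elim: n => [|n IH].
  by rewrite big_nat1 invr1 ln1 addr0.
rewrite big_nat_recr//=.
have n0 : 0 < n.+1%:R :> R by rewrite ltr0n.
have n1 : 0 < n.+2%:R :> R by rewrite ltr0n.
have hx : n.+1%:R / n.+2%:R = 1 - n.+2%:R^-1 :> R.
  by rewrite -[n.+2%:R in LHS]natr1; field; rewrite gt_eqF// natr1.
have := @le_ln1Dx R (- n.+2%:R^-1).
rewrite -hx ltrN2 invf_lt1// ltr1n => /(_ isT).
rewrite ln_div ?posrE//; move: IH; clear.
move: (\sum_(1 <= i < n.+2) _) (ln n.+1%:R) (ln n.+2%:R) (n.+2%:R^-1) => *; lra.
Qed.

(** * Frequency of heavy charges and rarity of bad pairs *)

Section pair_bounds.
Context {d : measure_display} {W : measurableType d} {R : realType}.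
Variables (P : probability W R) (X : nat -> W -> R).
Hypothesis (iidX : iid P X).
Variables (ga al x0 CF CP beta A u : R).
Hypotheses (ga1 : 1 < ga) (alE : al = 1 - ga^-1).
Hypotheses (x00 : 0 < x0) (CF0 : 0 < CF) (CP0 : 0 < CP) (b01 : 0 < beta <= 1).
Hypotheses (Ax0 : x0 <= A) (ux0 : x0 <= u).

Local Notation F := (fun x : R => fine (P [set w | x <= X 1%N w])).

Hypothesis F_up : forall x, 0 < x -> F x <= CF * x `^ (- ga).
Hypothesis F_low : forall x, x0 <= x -> CP / 2 * x `^ (- ga) <= F x.
Hypothesis weight1 : P.-integrable setT (EFin \o (site_weight beta \o X 1%N)).

(** The exponent makes the untilted probability of order [1 / r], with harmonic sums over gaps, and
    the tilted one at least of order [r ^ (- al)], the critical killing rate. *)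
Definition gap_threshold (r : nat) : R := u * r%:R `^ ga^-1.

Let ga0 : 0 < ga. Proof. by have := ga1; lra. Qed.
Let A0 : 0 < A. Proof. exact: lt_le_trans Ax0. Qed.
Let u0 : 0 < u. Proof. exact: lt_le_trans ux0. Qed.

Lemma heavy_scale x : x0 <= x -> CP / 2 * (beta * x `^ (1 - ga)) <= heavy P X beta x.
Proof.
move=> xx0; have xp : 0 < x by exact: lt_le_trans xx0.
have [b0 _] := andP b01.
apply: le_trans (heavy_ge iidX weight1 (ltW b0) (ltW xp)).
have bx : 0 <= beta * x by rewrite mulr_ge0// ltW.
apply: le_trans (ler_wpM2l bx (F_low xx0)).
rewrite powRD; last by apply/implyP => _; rewrite gt_eqF.
by rewrite powRr1 ?(ltW xp)// le_eqVlt; apply/orP; left; apply/eqP; ring.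
Qed.

Lemma heavy_gap k : (0 < k)%N ->
  CP / 2 * (beta * u `^ (1 - ga)) * k%:R `^ (- al) <= heavy P X beta (gap_threshold k).
Proof.
move=> k0; have g0 := ga0.
have k1 : 1 <= k%:R `^ ga^-1 :> R.
  by rewrite -[leLHS](powRr0 k%:R) ler_powR ?ler1n// invr_ge0 ltW.
have thr0 : x0 <= gap_threshold k.
  by apply: le_trans ux0 _; rewrite /gap_threshold ler_peMr// ltW.
apply: le_trans (heavy_scale thr0).
rewrite /gap_threshold powRM ?powR_ge0 ?(ltW u0)// -powRrM.
rewrite (_ : ga^-1 * (1 - ga) = - al); last by rewrite alE; field; rewrite gt_eqF.
by rewrite le_eqVlt; apply/orP; left; apply/eqP; ring.
Qed.

(** The factor [j0 ^ al] pays for replacing [n + j] by [j0 * (n + 1)]. *)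
Lemma heavy_gap_window (Es ka : R) j0 n j : 0 < Es -> 0 < ka -> 0 < al ->
  Es * ka * j0%:R `^ al <= CP / 2 * (beta * u `^ (1 - ga)) -> (0 < j <= j0)%N ->
  Es * ka * (n + 1)%:R `^ (- al) <= heavy P X beta (gap_threshold (n + j)).
Proof.
move=> Es0 ka0 al0 h /andP[j_gt0 jj0].
have j00 : (0 < j0)%N by exact: leq_trans jj0.
apply: le_trans (heavy_gap _); last by rewrite addn_gt0 j_gt0 orbT.
have b0 : 0 < beta by case/andP: b01.
have c0 : 0 <= CP / 2 * (beta * u `^ (1 - ga)).
  by rewrite !mulr_ge0 ?powR_ge0// ?ltW// divr_gt0.
have le1 : (j0 * (n + 1))%:R `^ (- al) <= (n + j)%:R `^ (- al) :> R.
  apply: powRN_le; rewrite ?(ltW al0) ?addn_gt0 ?j_gt0 ?orbT//.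
  by move: j_gt0 jj0; clear; nia.
apply: le_trans (ler_wpM2l c0 le1).
have j0R : 0 < j0%:R :> R by rewrite ltr0n.
rewrite natrM powRM ?ler0n// [leRHS]mulrA; apply: ler_wpM2r; first exact: powR_ge0.
apply: le_trans (ler_wpM2r (powR_ge0 _ _) h).
rewrite -[leRHS]mulrA -powRD; last by apply/implyP => _; rewrite gt_eqF.
by rewrite subrr powRr0 mulr1.
Qed.

Lemma sum_pairs s m : (0 < m)%N ->
  \sum_(s <= i < s + m) \sum_(i.+1 <= j < s + m) F A * F (gap_threshold (j - i)) <=
  CF * A `^ (- ga) * m%:R * (CF * u `^ (- ga) * (1 + ln m%:R)).
Proof.
move=> m0.
have F0 x : 0 <= F x by rewrite fine_ge0.
have c0 : 0 <= CF * u `^ (- ga) by rewrite mulr_ge0 ?powR_ge0// ltW.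
have c1 : 0 <= CF * A `^ (- ga) by rewrite mulr_ge0 ?powR_ge0// ltW.
have Fthr r : (0 < r)%N -> F (gap_threshold r) <= CF * u `^ (- ga) * r%:R^-1.
  move=> r0; have r0R : 0 < r%:R :> R by rewrite ltr0n.
  apply: le_trans (F_up _) _; first by rewrite mulr_gt0 ?powR_gt0.
  rewrite /gap_threshold powRM ?powR_ge0 ?(ltW u0)// -powRrM mulrN mulVf ?gt_eqF//.
  by rewrite powR_inv1 ?ler0n// mulrA.
have row i : (s <= i < s + m)%N ->
    \sum_(i.+1 <= j < s + m) F A * F (gap_threshold (j - i)) <=
    CF * A `^ (- ga) * (CF * u `^ (- ga) * (1 + ln m%:R)).
  move=> /andP[si im]; rewrite -mulr_sumr; apply: ler_pM => //.
  - by apply: sumr_ge0.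
  - exact: F_up.
  rewrite -(add1n i) (_ : (s + m = (s + m - i) + i)%N); last by rewrite subnK// ltnW.
  rewrite big_addn addnK.
  apply: (@le_trans _ _ (\sum_(1 <= r < s + m - i) CF * u `^ (- ga) * r%:R^-1)).
    rewrite big_nat [leRHS]big_nat; apply: ler_sum => r /andP[r0 _].
    by rewrite addnK; exact: Fthr.
  rewrite -mulr_sumr ler_wpM2l//; apply: le_trans (harmonic_le m0).
  rewrite [leRHS](big_cat_nat (n := (s + m - i)%N))//=.
  - by rewrite lerDl sumr_ge0// => r _; rewrite invr_ge0.
  - by rewrite subn_gt0.
  - by clear -si m0; lia.
rewrite big_nat; apply: le_trans (ler_sum _ row) _.
rewrite -big_nat sumr_const_nat addKn -[leLHS]mulr_natl.
by rewrite le_eqVlt; apply/orP; left; apply/eqP; ring.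
Qed.

End pair_bounds.

(** * Fractional moment bound at a fixed disorder strength *)

Section one_scale.
Context {d : measure_display} {W : measurableType d} {R : realType}.
Variables (P : probability W R) (X : nat -> W -> R) (K : nat -> R).
Variables (al cl c2 : R).
Hypotheses (iidX : iid P X) (K_0 : K 0%N = 0) (K_ge0 : forall n, 0 <= K n).
Hypotheses (al01 : 0 < al < 1) (cl0 : 0 < cl) (c20 : 0 < c2).
Hypothesis tail_ge0 : forall n, 0 <= tail K n.
Hypothesis K_up : forall n, (0 < n)%N -> K n <= c2 * n%:R `^ (- (1 + al)).
Hypothesis tail_up : forall n, (0 < n)%N -> tail K n <= c2 * n%:R `^ (- al).
Hypothesis tail_low : forall n, (0 < n)%N -> cl * n%:R `^ (- al) <= tail K n.
Variables (ga x0 CF CP beta A u : R).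
Hypotheses (ga1 : 1 < ga) (alE : al = 1 - ga^-1).
Hypotheses (x00 : 0 < x0) (CF0 : 0 < CF) (CP0 : 0 < CP) (b01 : 0 < beta <= 1).
Hypotheses (Ax0 : x0 <= A) (ux0 : x0 <= u).

Local Notation E := (Ex P).
Local Notation F := (fun x : R => fine (P [set w | x <= X 1%N w])).
Local Notation CH := (chunk_jump_cst al cl c2).
Local Notation Cw := (window_jump_cst al cl c2).
Local Notation Es := (escape_cst al c2).

Hypothesis F_up : forall x, 0 < x -> F x <= CF * x `^ (- ga).
Hypothesis F_low : forall x, x0 <= x -> CP / 2 * x `^ (- ga) <= F x.
Hypothesis weight1 : P.-integrable setT (EFin \o (site_weight beta \o X 1%N)).
Hypothesis mean1 : E (site_weight beta \o X 1%N) = 1.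

(** Chosen so that [(1 + al) * t = 1 + al / 2 * t] exceeds 1: the [t]-th powers of the gap weights
    remain summable. *)
Definition moment_exponent : R := (1 + al / 2)^-1.

Local Notation t := moment_exponent.

(* The gap weights below are [jump_cst * g^(-(1 + al))]; this constant makes their
   [t]-th powers sum to at most 1/4. *)
Definition jump_cst : R := (al / 2 * t / 4) `^ (1 + al / 2).

Variables (b L n0 j0 : nat) (ka de C1 h0 : R).
Let l := (b * L)%N.
Hypotheses (de01 : 0 < de < 1) (de_small : 4 * expR 3 * (CH + Cw) * de <= jump_cst).
Hypotheses (b4 : (4 <= b)%N) (b_de : b%:R `^ (- al) <= de).
Hypothesis C1_ge : 2 * CF ^+ 2 * de `^ (- (t / (1 - t))) <= C1.
Hypotheses (j0L : (j0 < L)%N) (Kj0 : 1 / 2 <= \sum_(j < j0.+1) K j).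
Hypotheses (h00 : 0 <= h0) (h0l : h0 * l%:R <= 1).
Hypothesis pair_rare :
  A `^ (- ga) * l%:R * (u `^ (- ga) * (C1 * (1 + ln (l%:R *+ 2)))) <= 1.
Hypotheses (n00 : (0 < n0)%N)
  (heavyA : Es * (al / 2) * n0%:R `^ (- al) <= CP / 2 * (beta * A `^ (1 - ga)))
  (barrierA : (n0%:R / (L - j0 + n0)%:R) `^ (al / 2) <= de).
Hypotheses (kaP : 0 < ka <= al / 2)
  (heavyu : Es * ka * j0%:R `^ al <= CP / 2 * (beta * u `^ (1 - ga)))
  (barrieru : (1 / (L - j0 + 1)%:R) `^ ka <= de).

Local Notation thr := (gap_threshold ga u).
Local Notation psum k e q n w := (path_sum K k e q (fun m => site_weight beta (X m w)) n).

Let al0 : 0 < al. Proof. by case/andP: al01. Qed.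
Let al1 : al < 1. Proof. by case/andP: al01. Qed.
Let l0 : (0 < l)%N. Proof. by rewrite muln_gt0 (leq_trans _ b4) ?(leq_ltn_trans _ j0L). Qed.
Let L2l : (L.*2 <= l)%N.
Proof. by rewrite -mul2n leq_mul2r (leq_trans _ b4)// orbT. Qed.

Lemma moment_exponent01 : 0 < t < 1.
Proof.
have a0 := al0; have D : 0 < 1 + al / 2 by lra.
by rewrite /moment_exponent invr_gt0 D invf_lt1//; lra.
Qed.

Lemma Es_gt0 : 0 < Es.
Proof.
have a0 := al0; have a1 := al1.
rewrite /escape_cst !mulr_gt0// addr_gt0// divr_gt0// subr_gt0//.
Qed.

Lemma jump_cst_gt0 : 0 < jump_cst.
Proof.
have a0 := al0; have /andP[t0 _] := moment_exponent01.
by rewrite powR_gt0// divr_gt0// mulr_gt0// divr_gt0.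
Qed.

Lemma chunk_cst_le : chunk_cst l (expR h0) <= expR 3.
Proof.
have l1 : 1 <= l%:R :> R by rewrite ler1n.
have h1 : h0 <= h0 * l%:R by rewrite ler_peMr.
rewrite /chunk_cst -expRM_natr ler_expR -addn1 natrD -muln2 natrM.
rewrite mulrDr mulr1 mulrA.
by move: h1 h0l; move: (h0 * l%:R) => y; lra.
Qed.

(** Four small terms, each of size at most [de]: the penalty, the two barriers, and [b ^ (- al)] for
    paths jumping out of the window. The first three multiply [CH], the last one [Cw]. *)
Lemma chunk_jump_le k i i' n : (i * l <= n < i.+1 * l)%N -> (i.+2 <= i')%N ->
  chunk_cst l (expR h0) * E (fun w => chunk_penalty X A thr de l i w *
    (site_weight beta (X n w) *
     psum k (chunk_end l i) (fun f => \sum_(i' * l <= m < i'.+1 * l) K (m - f)) n w)) <=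
  jump_cst * (i' - i)%:R `^ (- (1 + al)).
Proof.
move=> /andP[iln nil] ii'.
have /andP[de0 de1] := de01.
set g := (i' - i)%:R `^ (- (1 + al)); have g0 : 0 <= g by exact: powR_ge0.
have CH0 : 0 <= CH by rewrite addr_ge0 ?powR_ge0// !mulr_ge0 ?powR_ge0 ?invr_ge0 ?ltW.
have Cw0 : 0 <= Cw by rewrite !mulr_ge0 ?powR_ge0 ?invr_ge0 ?ltW.
have CHg : 0 <= CH * g by rewrite mulr_ge0.
have Cwg : 0 <= Cw * b%:R `^ (- al) * g by rewrite mulr_ge0// mulr_ge0// powR_ge0.
have qt m : (n <= m < i.+2 * l)%N ->
    block_law K l i' m <= CH * g * tail K (chunk_end l i - m).
  move=> /andP[nm me].
  by apply: (block_law_tail al01) => //; rewrite me (leq_trans iln).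
have qw m : (n <= m < n + L.*2)%N ->
    block_law K l i' m <= Cw * b%:R `^ (- al) * g * tail K L.*2.
  move=> /andP[nm mL].
  by apply: (block_law_window al01 _ _ _ _ (erefl l) _ _ nil) => //; exact: leq_ltn_trans j0L.
have win : (n + L.*2 <= chunk_end l i)%N.
  by rewrite /chunk_end mulSn addnC (leq_add L2l)// ltnW.
have qge m : 0 <= block_law K l i' m by rewrite sumr_ge0.
have hA : Es * (al / 2) * n0%:R `^ (- al) <= heavy P X beta A.
  apply: le_trans heavyA _.
  exact: (heavy_scale iidX x00 b01 F_low weight1 Ax0).
have hu n' j : (0 < j <= j0)%N ->
    Es * ka * (n' + 1)%:R `^ (- al) <= heavy P X beta (thr (n' + j)).
  apply: (heavy_gap_window iidX ga1 alE x00 CP0 b01 ux0 F_low weight1) => //.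
    exact: Es_gt0.
  by case/andP: kaP.
have ka0P : 0 < al / 2 <= al / 2 by rewrite lexx divr_gt0.
have := chunk_le_barrier iidX K_0 K_ge0 weight1 mean1 de01 al01 tail_ge0 tail_up
  qge CHg Cwg qt qw iln win j0L Kj0 n00 ka0P kaP hA hu k.
rewrite !barrier_small ?add0n//; [|by case/andP: kaP => /ltW|by case/andP: ka0P => /ltW].
rewrite /block_law; set EE := (X in X <= _) => h.
have hM : EE <= 4 * (CH + Cw) * de * g.
  have h1 := ler_wpM2r CHg barrierA.
  have h2 := ler_wpM2r CHg barrieru.
  have h3 := ler_wpM2r (mulr_ge0 Cw0 g0) b_de.
  have h4 : 0 <= de * (CH * g) by exact: mulr_ge0 (ltW de0) CHg.
  have h5 : 0 <= de * (Cw * g) by exact: mulr_ge0 (ltW de0) (mulr_ge0 Cw0 g0).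
  by move: h h1 h2 h3 h4 h5; move: (CH) (Cw) => a1 a2; lra.
have M0 : 0 <= 4 * (CH + Cw) * de * g.
  exact: mulr_ge0 (mulr_ge0 (mulr_ge0 _ (addr_ge0 CH0 Cw0)) (ltW de0)) g0.
have cc0 : 0 <= chunk_cst l (expR h0) by rewrite exprn_ge0// expR_ge0.
apply: le_trans (ler_wpM2l cc0 hM) _.
apply: le_trans (ler_wpM2r M0 chunk_cst_le) _.
by have := ler_wpM2r g0 de_small; lra.
Qed.

Lemma chunk_last_le k N i n : (i * l <= n < i.+1 * l)%N ->
  chunk_cst l (expR h0) * E (fun w => chunk_penalty X A thr de l i w *
    (site_weight beta (X n w) * psum k (chunk_end l i) (last_point N) n w)) <=
  expR 3 / tail K l.*2.
Proof.
move=> /andP[iln nil].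
have t0 : 0 < tail K l.*2 by exact: (tail_gt0 cl0 K_ge0 tail_low).
have ti0 : 0 <= (tail K l.*2)^-1 by rewrite invr_ge0 ltW.
have win : (n + L.*2 <= chunk_end l i)%N.
  by rewrite /chunk_end mulSn addnC (leq_add L2l)// ltnW.
have qt m : (n <= m < chunk_end l i)%N ->
    last_point N m <= (tail K l.*2)^-1 * tail K (chunk_end l i - m).
  move=> /andP[nm me].
  rewrite /chunk_end in me *.
  have lm : (i * l <= m < i.+2 * l)%N by rewrite me (leq_trans iln).
  exact: (last_point_tail cl0 K_ge0 tail_ge0 tail_low N l0 lm).
have qge m : 0 <= last_point N m :> R by exact: ler0n.
have h := chunk_le_cst iidX K_0 K_ge0 A thr weight1 mean1 de01 qge ti0 qt iln win j0L k.
have cc0 : 0 <= chunk_cst l (expR h0) by rewrite exprn_ge0// expR_ge0.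
apply: le_trans (ler_wpM2l cc0 h) _.
exact: (ler_wpM2r ti0 chunk_cst_le).
Qed.

(** The 2 in the lower bound on [C1] is there because a chunk has [2 * l] sites. *)
Lemma chunk_inv_le i : E (chunk_inv X A thr de t l i) <= 2.
Proof.
apply: le_trans (Ex_inv_penalty iidX _ _ _ _ _ _) _.
rewrite -[2]/(1 + 1) lerD2l.
have -> : chunk_end l i = (i * l + l.*2)%N.
  by rewrite /chunk_end !mulSn -addnn; clear; lia.
have p0 := powR_ge0 de (- (t / (1 - t))).
have l20 : (0 < l.*2)%N by rewrite double_gt0.
apply: le_trans (ler_wpM2l p0 (sum_pairs ga1 x00 CF0 Ax0 ux0 F_up _ l20)) _.
apply: le_trans pair_rare.
have ln0 : 0 <= 1 + ln (l%:R *+ 2) :> R.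
  by rewrite addr_ge0// ln_ge0// -mulrnA ler1n muln_gt0 l0.
rewrite -muln2 natrM mulr_natr.
set D := A `^ (- ga) * u `^ (- ga) * l%:R * (1 + ln (l%:R *+ 2)).
have D0 : 0 <= D by rewrite !mulr_ge0 ?powR_ge0.
by have := ler_wpM2r D0 C1_ge; rewrite /D -[l%:R *+ 2]mulr_natr; lra.
Qed.

Lemma jump_sum B : \sum_(g < B) 2 * (jump_cst * g.+2%:R `^ (- (1 + al))) `^ t <= 1 / 2.
Proof.
have a0 := al0; have a1 := al1.
have /andP[t0 t1] := moment_exponent01.
set p := al / 2 * t; have p0 : 0 < p by rewrite mulr_gt0// divr_gt0.
have tE : (1 + al / 2) * t = 1 by rewrite /moment_exponent divff// gt_eqF//; lra.
have p1 : p < 1 by rewrite -tE /p ltr_pM2r//; lra.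
have -> : \sum_(g < B) 2 * (jump_cst * g.+2%:R `^ (- (1 + al))) `^ t =
    p / 2 * \sum_(1 <= j < 1 + B) j.+1%:R `^ (- (1 + p)).
  rewrite add1n big_add1 big_mkord mulr_sumr; apply: eq_bigr => g _.
  have p40 : 0 <= p / 4 by rewrite divr_ge0 ?ltW.
  rewrite powRM ?(ltW jump_cst_gt0) ?powR_ge0// -powRrM /jump_cst -/p -powRrM tE powRr1//.
  have -> : - (1 + al) * t = - (1 + p).
    by move: tE; rewrite /p; lra.
  by field.
have p01 : 0 < p < 1 by rewrite p0.
have := sum_powRN_tail B (isT : (0 < 1)%N) p01; rewrite powR1 mul1r => h.
have p20 : 0 <= p / 2 by rewrite divr_ge0 ?ltW.
apply: le_trans (ler_wpM2l p20 h) _.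
by rewrite le_eqVlt; apply/orP; left; apply/eqP; field; rewrite gt_eqF.
Qed.

Lemma scale_moment N : exists G : W -> R,
  [/\ admissible P X [set: nat] G,
      forall w, (expR h0 * site_weight beta (X 0%N w) *
        path_sum K N.+1 N.+1 (last_point N)
          (fun m => expR h0 * site_weight beta (X m w)) 0%N) `^ t <= G w &
      E G <= 4 * (expR 3 / tail K l.*2) `^ t].
Proof.
have e1 : 1 <= expR h0 by rewrite -expR0 ler_expR.
have g0 g : (2 <= g)%N -> 0 < jump_cst * g%:R `^ (- (1 + al)).
  by move=> g2; rewrite mulr_gt0 ?jump_cst_gt0// powR_gt0// ltr0n ltnW.
have a0 : 0 < expR 3 / tail K l.*2.
  by rewrite divr_gt0 ?expR_gt0//; exact: (tail_gt0 cl0 K_ge0 tail_low).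
exact: (fractional_moment iidX K_0 K_ge0 weight1 de01 moment_exponent01 l0 e1 g0 a0
  (chunk_jump_le N.+1) (chunk_last_le N.+1 N) chunk_inv_le jump_sum).
Qed.

End one_scale.

(** * The critical point *)

(** Continuity from above, since [tau 1] is finite everywhere. *)
Lemma tail_vanishes {d : measure_display} {T : measurableType d} {R : realType}
    (Q : probability T R) (tau : nat -> T -> nat) : is_renewal Q tau ->
  forall e, 0 < e -> exists n, tail (interarrival_law Q tau) n < e.
Proof.
move=> ren e e0.
pose D n := [set t | (n <= tau 1%N t)%N].
have mD n : measurable (D n).
  have [tau0 _ _] := ren.
  rewrite [X in measurable X](_ : _ =
      (fun t => (tau 1 t - tau 0 t)%N) @^-1` [set m | (n <= m)%N]).
    exact: (measurable_increment ren).
  by apply/seteqP; split => t /=; rewrite tau0 subn0.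
have D0 : \bigcap_n D n = set0.
  by apply/seteqP; split => t // /(_ (tau 1 t).+1 I); rewrite /D /= ltnn.
have nD : nonincreasing_seq D.
  by move=> m n mn; apply/subsetPset => t; rewrite /D /=; exact: leq_trans.
have := @nonincreasing_cvg_mu _ _ _ Q D _ mD _ nD.
rewrite D0 measure0 => /(_ _ measurable0) h.
have {h}h := h (le_lt_trans (probability_le1 Q (mD 0%N)) (ltry 1)).
have /fine_cvgP[_ /cvgrPdist_lt/(_ e e0)] := h.
rewrite /= => -[n _ /(_ n (leqnn n)) /=].
rewrite sub0r normrN ger0_norm ?fine_ge0// => hn.
by exists n; rewrite (tail_law ren).
Qed.

Lemma ae_low_all {d : measure_display} {W : measurableType d} {R : realType}
    (P : probability W R) (X : nat -> W -> R) (a : R) :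
  iid P X -> P [set w | - a <= X 1%N w] = 1%E ->
  {ae P, forall w, forall n, - a <= X n w}.
Proof.
move=> [mX _ idX] lowX; apply: ae_foralln => n.
apply: ae_sure; first exact: measurable_superlevel.
rewrite -lowX; have := idX n 1%N `[- a, +oo[%classic (measurable_itv _).
rewrite (_ : X n @^-1` _ = [set w | - a <= X n w]); last first.
  by apply/seteqP; split => w /=; rewrite in_itv/= andbT.
rewrite (_ : X 1%N @^-1` _ = [set w | - a <= X 1%N w])//.
by apply/seteqP; split => w /=; rewrite in_itv/= andbT.
Qed.

Lemma powRN_small {R : realType} (al de : R) : 0 < al -> 0 < de ->
  exists2 b : nat, (4 <= b)%N & b%:R `^ (- al) <= de.
Proof.
move=> al0 de0; pose y := de^-1 `^ al^-1; exists (4 + Num.bound y)%N; first exact: leq_addr.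
have y0 : 0 < y by rewrite powR_gt0// invr_gt0.
have yb : y <= (4 + Num.bound y)%:R.
  by rewrite natrD ler_wpDl// ltW// archi_boundP// ltW.
have -> : de = y `^ (- al).
  by rewrite /y -powRrM mulrN mulVf ?gt_eqF// powR_inv ?invr_ge0 ?(ltW de0)// powRN powRr1 ?invrK// ltW.
have b0 := lt_le_trans y0 yb.
rewrite !powRN lef_pV2 ?posrE ?powR_gt0 ?invr_gt0//.
by apply: ge0_ler_powR; rewrite ?nnegrE ?ler0n// ltW.
Qed.

Lemma jump_cst_le1 {R : realType} (al : R) : 0 < al < 1 -> jump_cst al <= 1.
Proof.
move=> al01; have /andP[a0 a1] := al01.
have /andP[t0 t1] := moment_exponent01 al01.
have p1 : 1 `^ (1 + al / 2) = 1 :> R by rewrite powR1.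
rewrite /jump_cst -[leRHS]p1; move: t0 t1; move: (moment_exponent al) => t t0 t1.
by apply: ge0_ler_powR; rewrite ?nnegrE; nra.
Qed.

Theorem theorem2p1 (R : realType)
  (d d' : measure_display) (T : measurableType d) (W : measurableType d')
  (Q : probability T R) (tau : nat -> T -> nat)
  (P : probability W R) (omega : nat -> W -> R)
  (gamma alpha a CK CP : R)
  (gamma_bounds : 1 < gamma < 2)
  (alphaE : alpha = 1 - gamma^-1)
  (tau_renewal : is_renewal Q tau)
  (CK_gt0 : 0 < CK)
  (K_tail : asymp_equiv \oo (interarrival_law Q tau)
              (fun n : nat => CK * n%:R `^ (- (1 + alpha))))
  (omega_iid : iid P omega)
  (omega_mean : ('E_P[omega 1%N] = 0)%E)
  (a_bounds : 0 < a < 1)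
  (omega_lower : P [set w | - a <= omega 1%N w] = 1%E)
  (CP_gt0 : 0 < CP)
  (omega_tail : asymp_equiv +oo
                  (fun x : R => fine (P [set w | x <= omega 1%N w]))
                  (fun x : R => CP * x `^ (- gamma))) :
  (forall beta : R, 0 < beta <= 1 -> (0 < critical_point Q tau P omega beta)%E) /\
  (exists A : R, 0 < A /\
     forall beta : R, 0 < beta <= 1 ->
       ((expR (- A * beta `^ (- (2 * gamma))))%:E
          <= critical_point Q tau P omega beta)%E).
Proof.
have [ga1 ga2] := andP gamma_bounds.
have al01 : 0 < alpha < 1.
  by rewrite alphaE subr_gt0 invf_lt1 ?ga1 ?(lt_trans _ ga1)//= gtrBl invr_gt0 (lt_trans _ ga1).
have /andP[al0 al1] := al01.
pose K := interarrival_law Q tau.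
have K_0 : K 0%N = 0 by exact: law0.
have K_ge0 n : 0 <= K n by exact: law_ge0.
have tl0 n : 0 <= tail K n by exact: tail_law_ge0.
have tlim := tail_vanishes tau_renewal.
have [cl [c2 [cl0 c20 K_up tail_up tail_low]]] := tail_bounds al01 CK_gt0 K_ge0 tl0 tlim K_tail.
have [mX _ _] := omega_iid.
have ga0 : 0 < gamma by lra.
have [x0 [CF [x00 CF0 F_up F_low]]] := env_bounds mX ga0 CP_gt0 omega_tail.
have p0 x y : 0 <= x `^ y :> R := powR_ge0 x y.
have Cw0 : 0 <= window_jump_cst alpha cl c2.
  by rewrite /window_jump_cst !mulr_ge0 ?p0 ?invr_ge0 ?ltW.
have CH1 : 1 <= chunk_jump_cst alpha cl c2.
  have h : 1 <= 2 `^ (1 + alpha) :> R.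
    by rewrite -[leLHS](powRr0 2) ler_powR ?ler1n// addr_ge0// ltW.
  by apply: (le_trans h); rewrite lerDl !mulr_ge0 ?p0 ?invr_ge0 ?ltW.
have e3 : 1 <= expR 3 :> R by rewrite -expR0 ler_expR.
pose D : R := 4 * expR 3 * (chunk_jump_cst alpha cl c2 + window_jump_cst alpha cl c2).
have D1 : 1 < D.
  apply: (@lt_le_trans _ _ (4 * 1 * 1)); first by rewrite !mulr1 ltr1n.
  by rewrite /D ler_pM ?ler_pM//; lra.
have D0 : 0 < D by lra.
(* One small constant for the penalty, the barriers and [b ^ (- alpha)]; it does not depend on
   [beta]. *)
pose de := jump_cst alpha / D.
have J0 := jump_cst_gt0 al01; have J1 := jump_cst_le1 al01.
have de01 : 0 < de < 1.
  by rewrite /de divr_gt0//= ltr_pdivrMr// mul1r (le_lt_trans J1).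
have /andP[de0 _] := de01.
have [b b4 b_de] := powRN_small al0 de0.
have de_small : D * de <= jump_cst alpha by rewrite /de mulrC divfK// gt_eqF.
pose t := moment_exponent alpha.
pose C0 := 2 * CF ^+ 2 * de `^ (- (t / (1 - t))).
have C00 : 0 <= C0 by rewrite !mulr_ge0 ?exprn_ge0 ?p0 ?ltW.
(* [C0] makes bad pairs rare enough for the penalty, and [x0 ^ gamma] guarantees [x0 <= u]. *)
pose C1 := x0 `^ gamma + C0.
have x0g : 0 < x0 `^ gamma by rewrite powR_gt0.
have C1_gt0 : 0 < C1 by rewrite /C1; lra.
have [j1 tj1] := tlim (1 / 2) (divr_gt0 ltr01 (ltr0Sn R 1)).
pose j0 := j1.+1.
have Kj0 : 1 / 2 <= \sum_(j < j0.+1) K j.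
  have := tail_le K_ge0 (leq_trans (leqnSn j1) (leqnSn j0)).
  by move: tj1; rewrite /tail -/j0; lra.
have CP20 : 0 < CP / 2 by rewrite divr_gt0.
have C1x0 : x0 `^ gamma <= C1 by rewrite /C1; lra.
have C1C0 : C0 <= C1 by rewrite /C1; lra.
have [AA [AA0 scale]] := scales ga1 alphaE x00 de01 C1_gt0 C1x0 CP20
  (Es_gt0 al01 c20) (leq_trans (isT : (0 < 4)%N) b4) (ltn0Sn j1).
have lb beta : 0 < beta <= 1 ->
    ((expR (- AA * beta `^ (- (2 * gamma))))%:E <= critical_point Q tau P omega beta)%E.
  (* By contraposition: every [h] below the claimed bound has nonpositive free energy, so the bound
     lies below the set whose infimum is taken. *)
  move=> b01; apply: le_ereal_inf_tmp => _ [h /= fpos <-]; rewrite lee_fin leNgt.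
  apply/negP => /ltW hh0; move: fpos; apply/negP; rewrite -leNgt.
  have [L [n0 [A [u [ka [[j0L hl Ax0 ux0 rare] n00 hA bA [kaP hu bu]]]]]]] := scale beta b01.
  have [w1 m1] := weight_env mX a_bounds omega_lower omega_mean b01.
  have [a0 a1] := andP a_bounds.
  have [b0 _] := andP b01.
  have a10 : 0 < 1 - a by rewrite subr_gt0.
  apply: (free_energy_le0 tau_renewal hh0 (moment_exponent01 al01) a10 _ _).
    apply: filterS (ae_low_all omega_iid omega_lower) => w lw n.
    exact: env_low (lw n).
  move=> N.
  have [G [[locG _ iG] leG EG]] := scale_moment omega_iid K_0 K_ge0 al01 cl0 c20 tl0 K_up
    tail_up tail_low ga1 alphaE x00 CF0 CP_gt0 b01 Ax0 ux0 F_up F_low w1 m1 de01 de_small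
    b4 b_de C1C0 j0L Kj0 (expR_ge0 _) hl rare n00 hA bA kaP hu bu N.
  exists G; split; [split => //|exact: leG|exact: EG].
  exact: (locfun_measurable mX locG).
split; last by exists AA.
by move=> beta b01; apply: lt_le_trans (lb beta b01); rewrite lte_fin expR_gt0.
Qed.
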